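(* Let $N\in\mathbb{N}$, $0<\alpha<1$, $h>0$ and $1\le q\le p\le\infty$. If $f\in L^q(\mathbb{R}^N)$, then the solution $u$ of the fractional diffusion problem in discrete time $${_C}\delta^{\alpha}u(nh,x)=\Delta u(nh,x),\ n\in\mathbb{N},\ x\in\mathbb{R}^N,\qquad u(0,x)=f(x),$$ given by $u(nh,\cdot)=\mathcal{G}^{\alpha}_{n,h}*f$ for $n\in\mathbb{N}$, satisfies the following, for all $n\in\mathbb{N}$: (i) If $q=\infty$, then $\|u(nh)\|_\infty\le\|f\|_\infty$. (ii) If $1\le q<\infty$ and $N>2q$, then for each $p\in[q,\frac{Nq}{N-2q})$ $$\|u(nh)\|_p\le C_p\frac{1}{(nh)^{\frac{\alpha N}{2}(1/q-1/p)}}\|f\|_q.\qquad(\ast)$$ (iii) If $1\le q<\infty$ and $N=2q$, then for each $p\in[q,\infty)$ the estimate $(\ast)$ holds. (iv) If $1\le q<\infty$ and $N<2q$, then for each $p\in[q,\infty]$ the estimate $(\ast)$ holds. Here $C_p$ is a constant independent of $h$ and $n$.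
   Context: Here $\mathbb{N}=\{1,2,\dots\}$, $\mathbb{N}_0=\{0,1,2,\dots\}$, $*$ is convolution on $\mathbb{R}^N$, $\|\cdot\|_p$ is the norm of $L^p(\mathbb{R}^N)$, $u(nh)$ denotes $u(nh,\cdot)$, and $1/\infty=0$. Cesàro numbers: for $\beta\in\mathbb{C}$, $k^\beta(0)=1$ and $k^\beta(n)=\frac{\beta(\beta+1)\cdots(\beta+n-1)}{n!}$ for $n\in\mathbb{N}$. For a sequence $g$ on $\{0,h,2h,\dots\}$ put $\delta_{\rm left}g(nh)=\frac{g(nh)-g((n-1)h)}{h}$ ($n\in\mathbb{N}$). The Caputo fractional $h$-difference is ${_C}\delta^{\alpha}g(nh)=h^{1-\alpha}\sum_{j=1}^n k^{1-\alpha}(n-j)\,\delta_{\rm left}g(jh)$, $n\in\mathbb{N}$, acting on $u$ in the variable $nh$; $\Delta$ is the Laplacian in $x$. Discrete scaled Wright function: for $0<\alpha<1$, $\beta\ge0$, $h>0$, $n,j\in\mathbb{N}_0$, $$\varphi^h_{\alpha,\beta}(n,j)=\frac{1}{2\pi i}\int_{\Upsilon}\frac{1}{z^{n+1}}\frac{\left(1-h(\frac{1-z}{h})^{\alpha}\right)^{j}}{(\frac{1-z}{h})^{\beta}}\,dz,$$ where $\Upsilon$ is the positively oriented circle centred at $0$ of radius $r\in(0,1)$ (principal powers). Gaussian kernel: $G_t(x)=(4\pi t)^{-N/2}e^{-|x|^2/(4t)}$, $t>0$, $x\in\mathbb{R}^N$. Discrete Gaussian kernel: $\mathcal{G}_{n,h}(x)=\frac{1}{h^n\Gamma(n)}\int_0^\infty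 e^{-t/h}t^{n-1}G_t(x)\,dt$, $n\in\mathbb{N}$. Fundamental solution: $$\mathcal{G}^{\alpha}_{n,h}(x)=\sum_{j=1}^{\infty}\varphi^h_{\alpha,1-\alpha}(n-1,j-1)\,\mathcal{G}_{j,h}(x),\quad n\in\mathbb{N}.$$ *)

(* Defs.v *)
From HB Require Import structures.
From mathcomp Require Import all_boot all_order all_algebra.
From mathcomp Require Import all_classical all_reals all_analysis.
From mathcomp Require Import complex.

Set Implicit Arguments.
Unset Strict Implicit.
Unset Printing Implicit Defensive.

Import Order.TTheory GRing.Theory Num.Theory.
Import numFieldNormedType.Exports.

Local Open Scope classical_set_scope.
Local Open Scope ring_scope.

(* 'rV[R]_n carries the product sigma-algebra of its n coordinates (the Borel
   sets of R^n).  Lebesgue measure on it is the n-fold product of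
   [lebesgue_measure], built by recursion on n; [lebesgue_rV_box] gives its
   value on boxes. *)
Section measurable_rV.
Context (R : realType) (n : nat).

Definition rV_coor (i : 'I_n) (x : 'rV[R]_n) : measurableTypeR R := x ord0 i.

Let rV_set0 : g_sigma_preimage rV_coor set0.
Proof. exact: sigma_algebra0. Qed.

Let rV_setC A : g_sigma_preimage rV_coor A -> g_sigma_preimage rV_coor (~` A).
Proof. exact: sigma_algebraC. Qed.

Let rV_bigcup (F : _^nat) : (forall i, g_sigma_preimage rV_coor (F i)) ->
  g_sigma_preimage rV_coor (\bigcup_i (F i)).
Proof. exact: sigma_algebra_bigcup. Qed.

HB.instance Definition _ := @isMeasurable.Build default_measure_display
  'rV[R]_n (g_sigma_preimage rV_coor) rV_set0 rV_setC rV_bigcup.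

Lemma measurable_rV_coor (i : 'I_n) : measurable_fun [set: 'rV[R]_n] (rV_coor i).
Proof.
move=> _ Y mY; rewrite setTI; apply: sub_sigma_algebra => /=.
rewrite -bigcup_seq/=; exists i => /=; first by rewrite mem_index_enum.
by exists Y => //; rewrite setTI.
Qed.

Lemma measurable_fun_rV d (T : measurableType d) (f : T -> 'rV[R]_n) :
  (forall i, measurable_fun [set: T] (rV_coor i \o f)) ->
  measurable_fun [set: T] f.
Proof.
move=> mf _ Y; rewrite setTI => mY.
pose G := [set A : set 'rV[R]_n | d.-measurable (f @^-1` A)].
suff : G Y by [].
apply: mY => /=; split.
  split => [|A GA|F GF]; rewrite /G/=.
  - by rewrite preimage_set0.
  - by rewrite (_ : _ @^-1` _ = ~` (f @^-1` A)) ?setTD//; exact: measurableC.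
  - by rewrite preimage_bigcup; apply: bigcup_measurable => k _; exact: GF.
move=> A; rewrite -bigcup_seq => -[i _ [B mB <-]].
rewrite /G/= setTI -comp_preimage -[X in measurable X]setTI.
exact: mf.
Qed.

End measurable_rV.

Section lebesgue_rV.
Context (R : realType).

Definition rV_cons n (p : measurableTypeR R * 'rV[R]_n) : 'rV[R]_n.+1 :=
  row_mx (p.1%:M : 'rV[R]_1) p.2.

Definition rV_uncons n (x : 'rV[R]_n.+1) : measurableTypeR R * 'rV[R]_n :=
  (x ord0 ord0, \row_i x ord0 (lift ord0 i)).

Lemma rV_cons0 n (p : measurableTypeR R * 'rV[R]_n) : rV_cons p ord0 ord0 = p.1.
Proof.
rewrite /rV_cons mxE; case: splitP => [j _|k//].
by rewrite (ord1 j) mxE.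
Qed.

Lemma rV_consS n (p : measurableTypeR R * 'rV[R]_n) i :
  rV_cons p ord0 (lift ord0 i) = p.2 ord0 i.
Proof.
rewrite /rV_cons mxE; case: splitP => [j|k [ik]]; first by case: j => -[].
by congr (p.2 _ _); apply/val_inj.
Qed.

Lemma rV_consK n : cancel (@rV_cons n) (@rV_uncons n).
Proof.
move=> p; rewrite /rV_uncons rV_cons0 [RHS]surjective_pairing; congr pair.
by apply/rowP => i; rewrite mxE rV_consS.
Qed.

Lemma rV_unconsK n : cancel (@rV_uncons n) (@rV_cons n).
Proof.
move=> x; apply/rowP => i; case: (unliftP ord0 i) => [j|] ->.
  by rewrite rV_consS mxE.
by rewrite rV_cons0.
Qed.

Lemma measurable_rV_cons n : measurable_fun setT (@rV_cons n).
Proof.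
apply: measurable_fun_rV => i; case: (unliftP ord0 i) => [j|] ->.
  rewrite (_ : _ \o _ = rV_coor j \o snd); last first.
    by apply/funext => p; rewrite /= /rV_coor rV_consS.
  by apply: measurableT_comp => //; exact: measurable_rV_coor.
rewrite (_ : _ \o _ = fst)//.
by apply/funext => p; rewrite /= /rV_coor rV_cons0.
Qed.

Lemma measurable_rV_uncons n : measurable_fun setT (@rV_uncons n).
Proof.
apply/measurable_fun_pair; first exact: (measurable_rV_coor ord0).
apply: measurable_fun_rV => i.
rewrite (_ : _ \o _ = rV_coor (lift ord0 i)); first exact: measurable_rV_coor.
by apply/funext => x; rewrite /= /rV_coor mxE.
Qed.

Section lebesgue_rVS.
Context n (mu : {sigma_finite_measure set 'rV[R]_n -> \bar R}).
Local Open Scope ereal_scope.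

Definition lebesgue_rVS : set 'rV[R]_n.+1 -> \bar R :=
  fun A => (@lebesgue_measure R \x mu) (@rV_cons n @^-1` A).

Let mcons A : measurable A -> measurable (@rV_cons n @^-1` A).
Proof. by move=> mA; rewrite -[X in measurable X]setTI; exact: measurable_rV_cons. Qed.

Let muncons A : measurable A -> measurable (@rV_uncons n @^-1` A).
Proof. by move=> mA; rewrite -[X in measurable X]setTI; exact: measurable_rV_uncons. Qed.

Let lebesgue_rVS0 : lebesgue_rVS set0 = 0.
Proof. by rewrite /lebesgue_rVS preimage_set0 measure0. Qed.

Let lebesgue_rVS_ge0 A : 0 <= lebesgue_rVS A.
Proof. exact: measure_ge0. Qed.

Let lebesgue_rVS_sigma_additive : semi_sigma_additive lebesgue_rVS.
Proof.
move=> F mF tF mUF; rewrite /lebesgue_rVS preimage_bigcup.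
apply: measure_semi_sigma_additive => [i||].
- exact: mcons.
- apply/trivIsetP => /= i j _ _ ij; rewrite -preimage_setI.
  by move/trivIsetP : tF => /(_ _ _ _ _ ij) ->//; rewrite preimage_set0.
- by rewrite -preimage_bigcup; exact: mcons.
Qed.

HB.instance Definition _ := isMeasure.Build _ _ _ lebesgue_rVS
  lebesgue_rVS0 lebesgue_rVS_ge0 lebesgue_rVS_sigma_additive.

Let lebesgue_rVS_sigma_finite : sigma_finite setT lebesgue_rVS.
Proof.
have /sigma_finiteP[F [TF ndF Foo]] := sigma_finiteT (@lebesgue_measure R).
have /sigma_finiteP[G [TG ndG Goo]] := sigma_finiteT mu.
exists (fun k => @rV_uncons n @^-1` (F k `*` G k)).
  rewrite -preimage_bigcup; apply/esym; rewrite -subTset => x _ /=.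
  have : (\bigcup_i F i) (rV_uncons x).1 by rewrite -TF.
  have : (\bigcup_i G i) (rV_uncons x).2 by rewrite -TG.
  move=> [j _ Gj] [i _ Fi]; exists (maxn i j) => //; split.
  - by move: Fi; exact/subsetPset/ndF/leq_maxl.
  - by move: Gj; exact/subsetPset/ndG/leq_maxr.
move=> k; have [? ?] := Foo k; have [? ?] := Goo k; split.
  by apply: muncons; exact: measurableX.
rewrite /lebesgue_rVS -comp_preimage (_ : _ \o _ = id); last first.
  by apply/funext => p /=; rewrite rV_consK.
by rewrite preimage_id product_measure1E// lte_mul_pinfty// ge0_fin_numE.
Qed.

HB.instance Definition _ := Measure_isSigmaFinite.Build _ _ _ lebesgue_rVS
  lebesgue_rVS_sigma_finite.

End lebesgue_rVS.

Fixpoint lebesgue_rV n : {sigma_finite_measure set 'rV[R]_n -> \bar R} :=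
  match n with
  | 0%N => \d_(0 : 'rV[R]_0)
  | m.+1 => lebesgue_rVS (lebesgue_rV m)
  end.

End lebesgue_rV.

Lemma lebesgue_rV_box (R : realType) n (A : 'I_n -> set (measurableTypeR R)) :
  (forall i, measurable (A i)) ->
  lebesgue_rV R n [set x | forall i, A i (x ord0 i)] =
  (\prod_(i < n) @lebesgue_measure R (A i))%E.
Proof.
elim: n A => [|n IHn] A mA.
  rewrite big_ord0 /= diracE mem_set//=; last by case.
rewrite big_ord_recl -IHn => [|i]; last exact: mA.
rewrite -product_measure1E//; last first.
  rewrite [X in measurable X](_ : _ =
      \bigcap_(i in [set: 'I_n]) (rV_coor i @^-1` A (lift ord0 i))).
    apply: fin_bigcap_measurable => [|i _]; first exact: finite_finset.
    rewrite -[X in measurable X]setTI.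
    exact: measurable_rV_coor.
  by apply/seteqP; split => [x Ax i _|x Ax i]; [exact: Ax|exact: (Ax i)].
rewrite /= /lebesgue_rVS; apply: f_equal.
apply/seteqP; split => [p Ap|p [Ap0 ApS] i] /=.
  split => [|i] /=; first by have := Ap ord0; rewrite rV_cons0.
  by have := Ap (lift ord0 i); rewrite rV_consS.
case: (unliftP ord0 i) => [j|] ->; rewrite ?rV_consS ?rV_cons0.
  exact: ApS.
exact: Ap0.
Qed.

Section convolution.
Context (R : realType) (N : nat).
Implicit Types (f g : 'rV[R]_N -> R).

Definition convolution f g (x : 'rV[R]_N) : R :=
  \int[lebesgue_rV R N]_y (f (x - y) * g y).

End convolution.

Section weak_laplacian.
Context (R : realType) (N : nat).
Implicit Types (f v w psi : 'rV[R]_N -> R).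

Definition partial (i : 'I_N) f : 'rV[R]_N -> R :=
  fun x => 'D_(delta_mx ord0 i) f x.

Definition partials (s : seq 'I_N) f := foldr partial f s.

Definition laplacian f (x : 'rV[R]_N) : R :=
  \sum_(i < N) partial i (partial i f) x.

Definition smooth f := forall s : seq 'I_N,
  continuous (partials s f) /\
  forall (i : 'I_N) x, derivable (partials s f) x (delta_mx ord0 i).

Definition test_function psi :=
  smooth psi /\
  exists2 K : set 'rV[R]_N, compact K & forall x, ~ K x -> psi x = 0.

(* Delta v = w in the sense of distributions.  For data that are only in
   L^q the functions u(nh, .) need not be twice differentiable, so this is
   the sense in which the equation of [fractional_diffusion] is read. *)
Definition weak_laplacian v w := forall psi, test_function psi ->
  [/\ (lebesgue_rV R N).-integrable setT
        (fun x => (v x * laplacian psi x)%:E),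
      (lebesgue_rV R N).-integrable setT (fun x => (w x * psi x)%:E) &
      \int[lebesgue_rV R N]_x (v x * laplacian psi x) =
      \int[lebesgue_rV R N]_x (w x * psi x)].

End weak_laplacian.

Definition cesaro (F : fieldType) (beta : F) (n : nat) : F :=
  (\prod_(i < n) (beta + i%:R)) / (n`!)%:R.

Section caputo.
Context (R : realType).

(* A sequence g on {0, h, 2h, ...} is indexed by n, i.e., g n stands for
   g(nh). *)
Definition delta_left (h : R) (g : nat -> R) (n : nat) : R :=
  (g n - g n.-1) / h.

Definition caputo (alpha h : R) (g : nat -> R) (n : nat) : R :=
  h `^ (1 - alpha) *
  \sum_(1 <= j < n.+1) cesaro (1 - alpha) (n - j) * delta_left h g j.

Definition fractional_diffusion N (alpha h : R) (f : 'rV[R]_N -> R)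
    (u : nat -> 'rV[R]_N -> R) :=
  u 0%N = f /\
  forall n, (0 < n)%N ->
    weak_laplacian (u n) (fun x => caputo alpha h (fun k => u k x) n).

End caputo.

Section wright.
Context (R : realType).
Local Open Scope complex_scope.
Implicit Types (z : R[i]).

Definition cmod z : R := Num.sqrt (complex.Re z ^+ 2 + complex.Im z ^+ 2).

(* argument in ]-pi, pi] *)
Definition carg z : R :=
  let t := acos (complex.Re z / cmod z) in
  if 0 <= complex.Im z then t else - t.

Definition cis (t : R) : R[i] := cos t +i* sin t.

(* principal power, meant for z != 0 *)
Definition cpowR z (a : R) : R[i] := (cmod z `^ a)%:C * cis (a * carg z).

(* contour z = r e^{it}, dz = i r e^{it} dt *)
Definition circle_integral (r : R) (F : R[i] -> R[i]) : R[i] :=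
  let G t := F (r%:C * cis t) * (r%:C * 'i * cis t) in
  (\int[@lebesgue_measure R]_(t in `[0, 2 * pi]) complex.Re (G t)) +i*
  (\int[@lebesgue_measure R]_(t in `[0, 2 * pi]) complex.Im (G t)).

Definition wright (alpha beta h r : R) (n j : nat) : R[i] :=
  ((2 * pi)%:C * 'i)^-1 *
  circle_integral r (fun z =>
    (z ^+ n.+1)^-1 *
    ((1 - h%:C * cpowR ((1 - z) / h%:C) alpha) ^+ j /
     cpowR ((1 - z) / h%:C) beta)).

End wright.

Section kernels.
Context (R : realType) (N : nat).

Definition gaussian (t : R) (x : 'rV[R]_N) : R :=
  (4 * pi * t) `^ (- (N%:R / 2)) *
  expR (- (\sum_(i < N) x ord0 i ^+ 2) / (4 * t)).

Definition Gamma (s : R) : R :=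
  \int[@lebesgue_measure R]_(t in `]0, +oo[) (t `^ (s - 1) * expR (- t)).

(* The integral is +oo at x = 0 when n <= N/2; this null set is irrelevant
   for the convolution. *)
Definition discrete_gaussian (n : nat) (h : R) (x : 'rV[R]_N) : R :=
  (h ^+ n * Gamma n%:R)^-1 *
  \int[@lebesgue_measure R]_(t in `]0, +oo[)
    (expR (- t / h) * t ^+ n.-1 * gaussian t x).

(* The numbers wright alpha beta h r n j are real (the integrand takes
   conjugate values at conjugate points), so taking the real part only
   changes their type.  They do not depend on the radius r in ]0, 1[. *)
Definition fundamental_solution (alpha h r : R) (n : nat)
    (x : 'rV[R]_N) : R :=
  limn (series (fun j : nat =>
    complex.Re (wright alpha (1 - alpha) h r n.-1 j) *
    discrete_gaussian j.+1 h x)).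

End kernels.

Section decay_estimate.
Context (R : realType) (N : nat).
Local Open Scope ereal_scope.

(* 1/p, with 1/oo = 0 since fine +oo = 0 *)
Definition recip (p : \bar R) : R := ((fine p)^-1)%R.

(* Both conditions are needed: the series in [fundamental_solution] diverges
   when h^(1 - alpha) > 2, and [limn] is then a default value which does not
   yield a solution. *)
Definition diffusion_solution (alpha h r : R) (f : 'rV[R]_N -> R)
    (u : nat -> 'rV[R]_N -> R) :=
  fractional_diffusion alpha h f u /\
  forall n, (0 < n)%N ->
    u n = convolution (@fundamental_solution R N alpha h r n) f.

Definition decay_estimate (alpha : R) (q p : \bar R) := exists C : R,
  forall (h r : R) (f : 'rV[R]_N -> R) (u : nat -> 'rV[R]_N -> R),
    (0 < h)%R -> (0 < r < 1)%R -> f \in Lfun (lebesgue_rV R N) q ->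
    diffusion_solution alpha h r f u ->
    forall n, (0 < n)%N ->
    'N[lebesgue_rV R N]_p[EFin \o u n] <=
    (C / (n%:R * h) `^ (alpha * N%:R / 2 * (recip q - recip p)))%R%:E *
    'N[lebesgue_rV R N]_q[EFin \o f].

End decay_estimate.

(* Main.v *)
Require Import Defs.
From HB Require Import structures.
From mathcomp Require Import all_boot all_order all_algebra.
From mathcomp Require Import all_classical all_reals all_analysis.
From mathcomp Require Import measurable_realfun ess_sup_inf ring lra complex.

Set Implicit Arguments.
Unset Strict Implicit.
Unset Printing Implicit Defensive.

Import Order.TTheory GRing.Theory Num.Theory.
Import numFieldNormedType.Exports.

(** The fundamental solution is dominated by a heat kernel run at a random
time, and all the estimates are estimates on that random time.

Put c = h^(1-alpha), lam = h^(-alpha) and m = n - 1.  Expanding the power of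
1 - c (1-z)^alpha under the contour integral leaves integrals of
z^(-m-1) (1-z)^b, that is, Taylor coefficients of (1-z)^b; so the Wright
numbers are c times the coefficient of z^m in
(1 - c (1-z)^alpha)^j (1-z)^(alpha-1) ([Re_wright]).  Rewriting this in powers
of 1 - (1-z)^alpha, a power series without constant term and with non-negative
coefficients, produces non-negative weights w(m,l) that vanish for l > m
([weight_ge0], [weight_eq0]).  Inserted in the series of the fundamental
solution and summed over j, they give the subordination formula
     K(x) = int_0^oo psi_m(t) G_t(x) dt,
     psi_m(t) = lam e^(-lam t) sum_(l <= m) w(m,l) (lam t)^l / l!  >= 0.

The series itself need not converge.  When c <= 2 its Abel sums converge to
K(x), so by Abel's theorem its sum is K(x) if it converges at all
([fundamental_solution_abel]).  When c > 2 it diverges ([series_diverges]): a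
lower bound on the discrete Gaussian kernels shows that terms tending to 0
would force a combination of binomial polynomials in j to tend to 0, hence all
its coefficients, among them w(m,0), to vanish.  A limit that does not exist
has the value 0, so in every case |fundamental solution| <= K away from the
origin ([fundamental_solution_le]), and u(nh) is bounded pointwise by the
convolution of K with |f|.

For such a convolution two applications of Jensen's inequality suffice: in space
for the probability density G_t(x - y) dy, then in time for the measure
psi_m(t) (4 pi t)^(-gam) dt, where gam = (N/2)(1/q - 1/p).  With
G_t <= (4 pi t)^(-N/2) they yield ||u(nh)||_p <= W ||f||_q, where
W = int psi_m(t) (4 pi t)^(-gam) dt ([subordinated_le_finite],
[subordinated_le_pinfty]).  The Gamma integral evaluates W: by Newton's formula
sum_l w(m,l) k^(1-gam)(l) = k^(1-alpha gam)(m) ([weight_newton]), it equals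
(4 pi)^(-gam) Gamma(1-gam) lam^gam k^(1-alpha gam)(m), and
k^(1-th)(m) <= (m+1)^(-th) ([cesaro_le_powR]) turns this into
C (nh)^(-alpha gam).  The integral is finite exactly when gam < 1, and this is
what the three restrictions on N, q and p say.  For q = oo the same bound with
gam = 0 has constant Gamma(1) = 1. *)

Local Open Scope classical_set_scope.
Local Open Scope ring_scope.

(* The bare name would denote the Cesaro means of a sequence. *)
Local Notation cesaro := Defs.cesaro.

(** * Cesaro numbers *)

Section cesaro_numbers.
Context (R : realType).
Implicit Types (a b x : R) (n m : nat).

Lemma cesaro0 b : cesaro b 0 = 1.
Proof. by rewrite /cesaro big_ord0 fact0 divr1. Qed.

Lemma cesaroS b n : n.+1%:R * cesaro b n.+1 = (b + n%:R) * cesaro b n.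
Proof.
rewrite /cesaro big_ord_recr/= factS natrM invfM.
have n0 : n.+1%:R != 0 :> R by rewrite pnatr_eq0.
move: (\prod_(i < n) _) => P; move: n.+1%:R n0 => x x0.
have f0 : n`!%:R != 0 :> R by rewrite pnatr_eq0 -lt0n fact_gt0.
by move: (n`!%:R) f0 => f f0; field; rewrite x0 f0.
Qed.

(** The generating function (1-z)^(-b) of [cesaro b] has derivative
b (1-z)^(-b-1); this is that identity at the level of coefficients, and the
inductive step in [circle_meanE]. *)
Lemma cesaroS_shift b n : n.+1%:R * cesaro b n.+1 = b * cesaro (b + 1) n.
Proof.
rewrite /cesaro big_ord_recl/= addr0 factS natrM invfM.
under eq_bigr do rewrite /bump/= natrD addrA.
have n0 : n.+1%:R != 0 :> R by rewrite pnatr_eq0.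
move: (\prod_(i < n) _) => P; move: n.+1%:R n0 => x x0.
have f0 : n`!%:R != 0 :> R by rewrite pnatr_eq0 -lt0n fact_gt0.
by move: (n`!%:R) f0 => f f0; field; rewrite x0 f0.
Qed.

Lemma cesaro_ge0 b n : 0 <= b -> 0 <= cesaro b n.
Proof.
move=> b0; apply: divr_ge0; last exact: ler0n.
by apply: prodr_ge0 => i _; exact: addr_ge0.
Qed.

Lemma cesaro_gt0 b n : 0 < b -> 0 < cesaro b n.
Proof.
move=> b0; apply: divr_gt0; last by rewrite ltr0n fact_gt0.
by apply: prodr_gt0 => i _; rewrite ltr_wpDr.
Qed.

(** All coefficients of (1-z)^a but the first are non-positive when 0 < a < 1,
since only the first factor of the product is negative.  This is where the
positivity of the whole construction comes from. *)
Lemma cesaroN_le0 a n : 0 < a < 1 -> cesaro (- a) n.+1 <= 0.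
Proof.
move=> /andP[a0 a1]; rewrite /cesaro big_ord_recl addr0.
apply: mulr_le0_ge0; last by rewrite invr_ge0.
apply: mulr_le0_ge0; first by lra.
apply: prodr_ge0 => i _ /=; have : 0 <= i%:R :> R by [].
by rewrite /bump/= natrD; lra.
Qed.

(** Coefficients of (1-z)^(-a) (1-z)^(-b) = (1-z)^(-(a+b)).  The induction uses
the derivation z d/dz, which multiplies the j-th coefficient by j. *)
Lemma cesaro_vandermonde a b m :
  cesaro (a + b) m = \sum_(j < m.+1) cesaro a j * cesaro b (m - j).
Proof.
elim: m => [|m IH]; first by rewrite big_ord1 !cesaro0 mulr1.
have m0 : m.+1%:R != 0 :> R by rewrite pnatr_eq0.
apply: (mulfI m0); rewrite cesaroS IH.
have -> : m.+1%:R * (\sum_(j < m.+2) cesaro a j * cesaro b (m.+1 - j)) =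
    \sum_(j < m.+2) j%:R * cesaro a j * cesaro b (m.+1 - j) +
    \sum_(j < m.+2) cesaro a j * ((m.+1 - j)%:R * cesaro b (m.+1 - j)).
  rewrite mulr_sumr -big_split/=; apply: eq_bigr => j _.
  rewrite natrB ?leq_ord//; ring.
rewrite [X in _ = X + _]big_ord_recl/= !mul0r add0r.
rewrite [X in _ = _ + X]big_ord_recr/= subnn mul0r mulr0 addr0.
rewrite mulr_sumr -big_split/=; apply: eq_bigr => j _.
rewrite /bump/= add1n cesaroS subSS subSn ?leq_ord// cesaroS.
have -> : m%:R = j%:R + (m - j)%:R :> R.
  by rewrite -natrD subnKC ?leq_ord.
ring.
Qed.

Lemma cesaroNn (d l : nat) : cesaro (- d%:R : R) l = (-1) ^+ l * 'C(d, l)%:R.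
Proof.
elim: l => [|l IH]; first by rewrite cesaro0 bin0 mulr1.
have l0 : l.+1%:R != 0 :> R by rewrite pnatr_eq0.
apply: (mulfI l0); rewrite cesaroS IH.
have := congr1 (fun n => n%:R : R) (mul_bin_left d l); rewrite !natrM => H.
rewrite exprS.
rewrite [RHS](_ : _ = - (-1) ^+ l * (l.+1%:R * 'C(d, l.+1)%:R)); last ring.
rewrite H; have [ld|dl] := leqP l d; first by rewrite natrB//; ring.
by rewrite bin_small// !mulr0.
Qed.

(** The ratio of consecutive terms on the left is 1 - th/(m+1), and
1 - th/(m+1) <= 1 - th ln((m+2)/(m+1)) <= ((m+2)/(m+1))^(-th). *)
Lemma cesaro_le_powR (th : R) m : 0 <= th < 1 ->
  cesaro (1 - th) m <= m.+1%:R `^ (- th).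
Proof.
move=> /andP[th0 th1]; elim: m => [|m IH]; first by rewrite cesaro0 powR1.
have m0 : 0 < m.+1%:R :> R by [].
have -> : cesaro (1 - th) m.+1 = (1 - th / m.+1%:R) * cesaro (1 - th) m.
  apply: (mulfI (lt0r_neq0 m0)); rewrite cesaroS [RHS]mulrA.
  have -> : m.+1%:R * (1 - th / m.+1%:R) = 1 - th + m%:R; last by [].
  rewrite mulrBr mulr1 mulrCA divff ?lt0r_neq0// mulr1 -natr1; ring.
have tm : th / m.+1%:R <= 1.
  by rewrite ler_pdivrMr// mul1r (le_trans (ltW th1))// ler1n.
apply: (@le_trans _ _ ((1 - th / m.+1%:R) * m.+1%:R `^ (- th))).
  by rewrite ler_wpM2l// subr_ge0.
have m2 : 0 < m.+2%:R :> R by [].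
have -> : m.+2%:R `^ (- th) =
    (m.+2%:R / m.+1%:R) `^ (- th) * m.+1%:R `^ (- th) :> R.
  by rewrite -(powRM _ (divr_ge0 (ler0n _ _) (ler0n _ _)) (ler0n _ _)) (divfK (lt0r_neq0 m0)).
rewrite ler_wpM2r ?powR_ge0//.
rewrite /powR ifF; last by apply/negbTE; rewrite mulf_neq0 ?invr_eq0 ?lt0r_neq0.
apply: le_trans (expR_ge1Dx _).
have : ln (m.+2%:R / m.+1%:R) <= (m.+1%:R)^-1 :> R.
  have -> : m.+2%:R / m.+1%:R = 1 + (m.+1%:R)^-1 :> R.
    by rewrite -natr1 mulrDl divff ?mul1r// lt0r_neq0.
  by apply: le_ln1Dx; rewrite (lt_trans _ (_ : 0 < _)) ?invr_gt0//; lra.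
move=> H; rewrite lerD2l// mulNr lerN2 ler_wpM2l//.
Qed.

End cesaro_numbers.

(** * Coefficients of powers of 1 - (1-z)^alpha *)

Section weights.
Context (R : realType) (alpha : R).
Implicit Types (p q : {poly R}) (m l : nat).

(** The coefficient of z^m in p((1-z)^alpha) (1-z)^(alpha-1), as a linear
functional of the polynomial p: on 'X^i it is the coefficient of
(1-z)^(alpha i + alpha - 1).  Working with polynomials in (1-z)^alpha avoids
power series altogether. *)
Definition symbol m p : R :=
  \sum_(i < size p) p`_i * cesaro (1 - alpha - alpha * i%:R) m.

Lemma symbolE m p n : (size p <= n)%N ->
  symbol m p = \sum_(i < n) p`_i * cesaro (1 - alpha - alpha * i%:R) m.
Proof.
move=> pn; rewrite /symbol (big_ord_widen _ (fun i => p`_i * cesaro (1 - alpha - alpha * i%:R) m) pn).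
rewrite big_mkcond/=; apply: eq_bigr => i _.
by case: ltnP => // h; rewrite nth_default// mul0r.
Qed.

Lemma symbol_is_linear m : linear_for *%R (symbol m).
Proof.
move=> a p q; set n := maxn (size (a *: p + q)) (maxn (size p) (size q)).
rewrite (@symbolE m (a *: p + q) n) ?leq_maxl//.
rewrite (@symbolE m p n) ?(@symbolE m q n) ?leq_max ?leqnn ?orbT//.
rewrite mulr_sumr -big_split/=; apply: eq_bigr => i _.
by rewrite coefD coefZ; ring.
Qed.

HB.instance Definition _ m := @GRing.isLinear.Build R {poly R} R *%R (symbol m)
  (symbol_is_linear m).

Lemma symbolXn m i : symbol m 'X^i = cesaro (1 - alpha - alpha * i%:R) m.
Proof.
rewrite (@symbolE m _ i.+1) ?size_polyXn// big_ord_recr/= coefXn eqxx mul1r.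
by rewrite big1 ?add0r// => j _; rewrite coefXn ltn_eqF ?mul0r.
Qed.

(** Multiplication by (1-z)^alpha, whose coefficients are [cesaro (- alpha)]. *)
Lemma symbolMX m p :
  symbol m ('X * p) = \sum_(j < m.+1) cesaro (- alpha) j * symbol (m - j) p.
Proof.
rewrite -{1}(coefK p).
rewrite poly_def mulr_sumr linear_sum/=.
under [RHS]eq_bigr do rewrite [symbol _ p](symbolE _ (leqnn _)) mulr_sumr.
rewrite exchange_big/=; apply: eq_bigr => i _.
rewrite -scalerAr -exprS linearZ/= symbolXn.
under [RHS]eq_bigr do rewrite mulrCA.
rewrite -mulr_sumr -cesaro_vandermonde; congr (_ * cesaro _ _).
by rewrite -natr1; ring.
Qed.

(** The coefficient of z^m in (1 - (1-z)^alpha)^l (1-z)^(alpha-1). *)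
Definition weight m l : R := symbol m ((1 - 'X) ^+ l).

Lemma weight0 m : weight m 0 = cesaro (1 - alpha) m.
Proof. by rewrite /weight expr0 -(expr0 'X) symbolXn mulr0 subr0. Qed.

(** The term j = 0 of [symbolMX] cancels against the 1 in 1 - (1-z)^alpha: what
remains has no constant term, which gives [weight_eq0], and non-negative
coefficients, which gives [weight_ge0]. *)
Lemma weightS m l : weight m l.+1 =
  \sum_(j < m) - cesaro (- alpha) j.+1 * weight (m - j.+1) l.
Proof.
rewrite /weight exprS mulrBl mul1r linearB/= symbolMX big_ord_recl/= cesaro0.
rewrite mul1r subn0 opprD addrA subrr add0r -sumrN.
by apply: eq_bigr => j _; rewrite mulNr.
Qed.

Lemma weight_ge0 m l : 0 < alpha < 1 -> 0 <= weight m l.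
Proof.
move=> a01; elim: l m => [|l IH] m.
  by rewrite weight0 cesaro_ge0// subr_ge0; case/andP: a01 => _ /ltW.
rewrite weightS; apply: sumr_ge0 => j _; apply: mulr_ge0 => //.
by rewrite oppr_ge0 cesaroN_le0.
Qed.

Lemma weight_eq0 m l : (m < l)%N -> weight m l = 0.
Proof.
elim: l m => // l IH m ml; rewrite weightS big1// => j _.
rewrite IH ?mulr0//.
by case: m ml j => [|m] ml [j jm]//=; rewrite subSS (leq_ltn_trans (leq_subr _ _)).
Qed.

(** 1 - c X is the combination (1-c) + c (1 - X). *)
Lemma symbol_expansion m (c : R) j : symbol m ((1 - c *: 'X) ^+ j) =
  \sum_(l < j.+1) 'C(j, l)%:R * c ^+ l * (1 - c) ^+ (j - l) * weight m l.
Proof.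
have -> : 1 - c *: 'X = (1 - c)%:P + c%:P * (1 - 'X) :> {poly R}.
  by rewrite -mul_polyC polyCB mulrBr mulr1 polyC1 addrA subrK.
rewrite exprDn linear_sum/=; apply: eq_bigr => l _.
rewrite exprMn -!polyC_exp mulrA -polyCM -mulrnAl -polyCMn mul_polyC.
rewrite linearZ/= /weight -mulr_natl; congr (_ * _); ring.
Qed.

Definition cesaro_poly q n : {poly R} := (n`!%:R^-1)%:P * \prod_(i < n) (q + i%:R%:P).

Lemma horner_cesaro_poly q n x : (cesaro_poly q n).[x] = cesaro q.[x] n.
Proof.
rewrite /cesaro_poly hornerM hornerC horner_prod /cesaro mulrC; congr (_ / _).
by apply: eq_bigr => i _; rewrite hornerD hornerC.
Qed.

Lemma poly_eq_at_Nnat p q : (forall d : nat, p.[- d%:R] = q.[- d%:R]) -> p = q.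
Proof.
move=> pq; apply/eqP; rewrite -subr_eq0; apply/eqP.
apply: (@roots_geq_poly_eq0 _ _ [seq - i%:R | i <- iota 0 (size (p - q))]).
- by apply/allP => _ /mapP[d _ ->]; rewrite rootE hornerD hornerN pq subrr.
- by rewrite map_inj_uniq ?iota_uniq// => i j /oppr_inj/eqP; rewrite eqr_nat => /eqP.
- by rewrite size_map size_iota.
Qed.

(** Formally, sum_l cesaro x l (1 - X)^l = X^(-x) by the binomial series, so the
left-hand side is the coefficient of z^m in (1-z)^(-alpha x) (1-z)^(alpha-1).
Both sides are polynomials in x, and for x = -d the series is the finite
expansion of X^d in powers of 1 - X. *)
Lemma weight_newton m (x : R) : \sum_(l < m.+1) weight m l * cesaro x l =
  cesaro (1 - alpha + alpha * x) m.
Proof.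
(* Two polynomials in x that agree at all x = -d are equal. *)
pose p := \sum_(l < m.+1) (weight m l)%:P * cesaro_poly 'X l.
pose q := cesaro_poly ((1 - alpha)%:P + alpha *: 'X) m.
suff pq : p = q.
  move/(congr1 (horner^~ x)): pq; rewrite /= horner_sum horner_cesaro_poly.
  rewrite hornerD hornerC hornerZ hornerX => <-.
  by apply: eq_bigr => l _; rewrite hornerM hornerC horner_cesaro_poly hornerX.
apply: poly_eq_at_Nnat => d.
rewrite horner_sum horner_cesaro_poly hornerD hornerC hornerZ hornerX mulrN.
rewrite -symbolXn.
have -> : 'X^d = \sum_(l < d.+1) ((-1) ^+ l * 'C(d, l)%:R) *: (1 - 'X) ^+ l :> {poly R}.
  rewrite -[in LHS](subKr 1 'X) exprBn; apply: eq_bigr => l _.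
  by rewrite expr1n mulr1 -scalerA scaler_nat -scalerMnr -mul_polyC polyC_exp polyCN polyC1.
rewrite linear_sum/=.
under [RHS]eq_bigr do rewrite linearZ/= -/(weight m _) -cesaroNn mulrC.
under [LHS]eq_bigr do rewrite hornerM hornerC horner_cesaro_poly hornerX.
transitivity (\sum_(l < maxn m.+1 d.+1) weight m l * cesaro (- d%:R) l).
  rewrite (big_ord_widen _ (fun l => weight m l * cesaro (- d%:R) l) (leq_maxl m.+1 d.+1)).
  rewrite big_mkcond/=; apply: eq_bigr => i _.
  by case: ifPn => //; rewrite -leqNgt => ?; rewrite weight_eq0 ?mul0r.
rewrite [RHS](big_ord_widen _ (fun l => weight m l * cesaro (- d%:R) l) (leq_maxr m.+1 d.+1)).
rewrite [RHS]big_mkcond/=; apply: eq_bigr => i _.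
by case: ifPn => //; rewrite -leqNgt => ?; rewrite cesaroNn bin_small ?mulr0.
Qed.

End weights.

(** * Rules of derivation *)

Section derivation_rules.
Context (R : realType).
Implicit Types (f g : R -> R) (x a b : R).

Lemma is_derive_mul f g x a b : is_derive x 1 f a -> is_derive x 1 g b ->
  is_derive x 1 (fun y => f y * g y) (a * g x + f x * b).
Proof.
move=> fa gb; apply: (@is_derive_eq _ _ _ _ _ _ _ _ (is_deriveM fa gb)).
by rewrite addrC ![_ *: _]mulrC [b * _]mulrC.
Qed.

Lemma is_derive_val f x a b : is_derive x 1 f a -> a = b -> is_derive x 1 f b.
Proof. by move=> ? <-. Qed.

Lemma is_derive_ext f g x a : is_derive x 1 f a -> f =1 g -> is_derive x 1 g a.
Proof. by move=> + /funext <-. Qed.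

Lemma is_derive_add f g x a b : is_derive x 1 f a -> is_derive x 1 g b ->
  is_derive x 1 (fun y => f y + g y) (a + b).
Proof. by move=> fa gb; exact: is_deriveD fa gb. Qed.

Lemma is_derive_sqr f x a : is_derive x 1 f a ->
  is_derive x 1 (fun y => f y ^+ 2) (2 * (f x * a)).
Proof.
move=> fa; rewrite (_ : (fun y => f y ^+ 2) = fun y => f y * f y).
  by apply: is_derive_val (is_derive_mul fa fa) _; ring.
by apply/funext => y; rewrite expr2.
Qed.

Lemma is_derive_scal c f x a : is_derive x 1 f a ->
  is_derive x 1 (fun y => c * f y) (c * a).
Proof.
move=> fa; apply: (@is_derive_eq _ _ _ _ _ _ _ _ (is_derive_mul (is_derive_cst c x 1) fa)).
by rewrite mul0r add0r.
Qed.

Lemma is_derive_exprn m x : is_derive x 1 (fun y => y ^+ m.+1) (m.+1%:R * x ^+ m).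
Proof.
elim: m => [|m IH]; first by rewrite mulr1; exact: is_derive_id.
apply: (is_derive_ext (f := fun y => y * y ^+ m.+1)) => [|y]; last by rewrite [RHS]exprS.
apply: is_derive_val (is_derive_mul (is_derive_id x 1) IH) _.
by rewrite mul1r mulrCA -exprS -[m.+2%:R]natr1; ring.
Qed.

Lemma is_derive_comp f g x a b : is_derive x 1 g b -> is_derive (g x) 1 f a ->
  is_derive x 1 (fun y => f (g y)) (a * b).
Proof. by move=> gb fa; exact: is_derive1_comp. Qed.

End derivation_rules.

(** * Real powers in polar form *)

Section polar.
Context (R : realType).
Implicit Types (X Y w : R -> R) (x a : R).

(** The logarithm of the modulus of X + i Y. *)
Definition lnmod (X Y : R) : R := ln (X ^+ 2 + Y ^+ 2) / 2.

(** For X > 0, the real part of (X + iY)^a e^(-iw), with the principal power.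
Writing it with real functions keeps the calculus in one real variable; the
argument is atan (Y / X) because the points 1 - z stay in the right half-plane. *)
Definition polar a (X Y w : R) : R :=
  expR (a * lnmod X Y) * cos (a * atan (Y / X) - w).

Lemma is_derive_polar a X Y w x dX dY dw :
  is_derive x 1 X dX -> is_derive x 1 Y dY -> is_derive x 1 w dw -> 0 < X x ->
  is_derive x 1 (fun y => polar a (X y) (Y y) (w y))
    (let rho2 := X x ^+ 2 + Y x ^+ 2 in
     let phi := a * atan (Y x / X x) - w x in
     expR (a * lnmod (X x) (Y x)) *
     (a * ((X x * dX + Y x * dY) / rho2) * cos phi -
      (a * ((dY * X x - Y x * dX) / rho2) - dw) * sin phi)).
Proof.
move=> hX hY hw X0 /=.
have r0 : 0 < X x ^+ 2 + Y x ^+ 2 by rewrite ltr_wpDr ?sqr_ge0 ?exprn_gt0.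
have dr : is_derive x 1 (fun y => X y ^+ 2 + Y y ^+ 2) (2 * (X x * dX + Y x * dY)).
  by apply: is_derive_val (is_derive_add (is_derive_sqr hX) (is_derive_sqr hY)) _; ring.
have dV : is_derive x 1 (fun y => (X y)^-1) (- (X x ^- 2 * dX)).
  by apply: is_derive_val (is_deriveV (lt0r_neq0 X0) hX) _; rewrite scaleNr.
have dL := is_derive_mul (is_derive_comp dr (is_derive1_ln r0)) (is_derive_cst (2^-1 : R) x 1).
have dT := is_derive_comp (is_derive_mul hY dV) (is_derive1_atan (Y x / X x)).
have dA := is_derive_add (is_derive_scal a dT) (is_derive_scal (- 1) hw).
have dE := is_derive_comp (is_derive_scal a dL) (is_derive_expR _).
have dC := is_derive_comp dA (is_derive_cos _).
have := is_derive_mul dE dC.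
rewrite (_ : (fun y => _) = (fun y => polar a (X y) (Y y) (w y))); last first.
  by apply/funext => y; rewrite /polar mulN1r.
move/is_derive_val; apply.
rewrite /= mulN1r -/(lnmod _ _).
rewrite ?mulr0 ?addr0.
move: (expR _) (cos _) (sin _) => E C S.
have X0' := lt0r_neq0 X0; have r0' := lt0r_neq0 r0.
have r1 : 1 + (Y x / X x) ^+ 2 != 0 by rewrite gt_eqF// ltr_wpDr ?sqr_ge0.
rewrite (_ : 1 + (Y x / X x) ^+ 2 = (X x ^+ 2 + Y x ^+ 2) / X x ^+ 2); last by field.
rewrite invf_div.
by field; rewrite X0' r0'.
Qed.

Lemma cos_atan_div (X Y : R) : 0 < X ->
  cos (atan (Y / X)) = X / expR (lnmod X Y).
Proof.
move=> X0; have r0 : 0 < X ^+ 2 + Y ^+ 2 by rewrite ltr_wpDr ?sqr_ge0 ?exprn_gt0.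
have -> : expR (lnmod X Y) = Num.sqrt (X ^+ 2 + Y ^+ 2).
  by rewrite -powR12_sqrt ?ltW// /powR gt_eqF// mulrC.
rewrite cos_atan.
have -> : 1 + (Y / X) ^+ 2 = (X ^+ 2 + Y ^+ 2) / X ^+ 2.
  by have := lt0r_neq0 X0 => ?; field.
rewrite sqrtrM ?ltW// sqrtrV ?sqr_ge0// sqrtr_sqr gtr0_norm//.
by rewrite invfM invrK mulrC.
Qed.

Lemma sin_atan_div (X Y : R) : 0 < X ->
  sin (atan (Y / X)) = Y / expR (lnmod X Y).
Proof.
move=> X0; have : tan (atan (Y / X)) = Y / X by rewrite atanK.
rewrite /tan => /(congr1 ( *%R^~ (cos (atan (Y / X))))).
rewrite cos_atan_div// divfK.
  by move=> ->; rewrite mulrA divfK// lt0r_neq0.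
by rewrite mulf_neq0 ?lt0r_neq0// invr_gt0 expR_gt0.
Qed.

Lemma expR2_lnmod (X Y : R) : 0 < X -> expR (lnmod X Y) ^+ 2 = X ^+ 2 + Y ^+ 2.
Proof.
move=> X0; have r0 : 0 < X ^+ 2 + Y ^+ 2 by rewrite ltr_wpDr ?sqr_ge0 ?exprn_gt0.
by rewrite expr2 -expRD /lnmod -splitr lnK.
Qed.

(** Lowering the exponent a by one divides by X + iY; the shift of the phase w
multiplies by e^(it). *)
Lemma polar_rot a (X Y w t : R) : 0 < X ->
  polar (a - 1) X Y (w - t) =
  expR (a * lnmod X Y) / (X ^+ 2 + Y ^+ 2) *
    ((X * cos t + Y * sin t) * cos (a * atan (Y / X) - w) +
     (Y * cos t - X * sin t) * sin (a * atan (Y / X) - w)).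
Proof.
move=> X0; rewrite /polar -expR2_lnmod//.
rewrite mulrBl mul1r expRD expRN.
have -> : (a - 1) * atan (Y / X) - (w - t) = (a * atan (Y / X) - w) - (atan (Y / X) - t).
  ring.
rewrite cosB (cosB (atan _)) (sinB (atan _)) cos_atan_div// sin_atan_div//.
have := expR_gt0 (lnmod X Y) => /lt0r_neq0; move: (expR (lnmod X Y)) => E E0.
by field.
Qed.

End polar.

(** * Taylor coefficients of (1-z)^a as circle integrals *)

Section circle.
Context (R : realType).
Implicit Types (a r t mu : R).

(** The real part of (1-z)^a e^(-i mu t) on the circle z = r e^(it). *)
Definition upolar a mu r t : R := polar a (1 - r * cos t) (- (r * sin t)) (mu * t).

Lemma circle_re_gt0 r t : `|r| < 1 -> 0 < 1 - r * cos t.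
Proof.
move=> r1; rewrite subr_gt0 (le_lt_trans (ler_norm _))// normrM.
by rewrite (le_lt_trans _ r1)// ler_piMr// ler_norml cos_geN1 cos_le1.
Qed.

(** d/dr (1 - r e^(it))^a = - a e^(it) (1 - r e^(it))^(a-1). *)
Lemma is_derive_upolar_r a mu r t : `|r| < 1 ->
  is_derive r 1 (fun r => upolar a mu r t) (- a * upolar (a - 1) (mu - 1) r t).
Proof.
move=> r1; have X0 := circle_re_gt0 t r1.
have dX : is_derive r 1 (fun r => 1 - r * cos t) (- cos t).
  apply: (is_derive_ext (f := fun r => 1 + (- cos t) * r)); last first.
    by move=> y; ring.
  have H := is_derive_add (is_derive_cst (1 : R) r 1)
    (is_derive_scal (- cos t) (is_derive_id r 1)).
  by apply: is_derive_val H _; rewrite add0r mulr1.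
have dY : is_derive r 1 (fun r => - (r * sin t)) (- sin t).
  apply: (is_derive_ext (f := fun r => (- sin t) * r)); last by move=> y; ring.
  exact: is_derive_val (is_derive_scal (- sin t) (is_derive_id r 1)) (mulr1 _).
have H := is_derive_polar a dX dY (is_derive_cst (mu * t) r 1) X0.
apply: is_derive_val H _; rewrite /upolar [(mu - 1) * t]mulrBl mul1r polar_rot//=.
rewrite /cst subr0.
have r0 : (1 - r * cos t) ^+ 2 + (- (r * sin t)) ^+ 2 != 0.
  by rewrite gt_eqF// ltr_wpDr ?sqr_ge0 ?exprn_gt0.
move: (expR _) (cos (_ - _)) (sin (_ - _)) => E C S.
by field.
Qed.

Lemma is_derive_circle_re r t : is_derive t 1 (fun t => 1 - r * cos t) (r * sin t).
Proof.
have H := is_derive_add (is_derive_cst (1 : R) t 1)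
  (is_derive_scal (- r) (is_derive_cos t)).
apply: (is_derive_ext (f := fun t => 1 + (- r) * cos t)) => [|y]; last ring.
by apply: is_derive_val H _; ring.
Qed.

Lemma is_derive_circle_im r t : is_derive t 1 (fun t => - (r * sin t)) (- (r * cos t)).
Proof.
apply: (is_derive_ext (f := fun t => (- r) * sin t)) => [|y]; last ring.
by apply: is_derive_val (is_derive_scal (- r) (is_derive_sin t)) _; ring.
Qed.

Lemma continuous_upolar a mu r : `|r| < 1 -> continuous (upolar a mu r).
Proof.
move=> r1 t.
have H := is_derive_polar a (is_derive_circle_re r t)
   (is_derive_circle_im r t) (is_derive_scal mu (is_derive_id t 1)) (circle_re_gt0 t r1).
by apply: differentiable_continuous; apply/derivable1_diffP; case: H.
Qed.

Lemma integrable_upolar a mu r : `|r| < 1 ->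
  (@lebesgue_measure R).-integrable `[0, 2 * pi] (EFin \o upolar a mu r).
Proof.
move=> r1; apply: continuous_compact_integrable; first exact: segment_compact.
by apply: continuous_subspaceT; exact: continuous_upolar.
Qed.

(** Up to the factor 2 pi r^mu, the mu-th Taylor coefficient of (1-z)^a.  The
index mu is real so that mu = -1 is allowed. *)
Definition circle_mean a mu r : R :=
  \int[@lebesgue_measure R]_(t in `[0, 2 * pi]) upolar a mu r t.

Lemma pi2_gt0 : 0 < 2 * pi :> R.
Proof. by rewrite mulr_gt0// pi_gt0. Qed.

Lemma Rintegral_FTC (f F : R -> R) (a b : R) : a < b -> continuous f ->
  (forall x : R, is_derive x 1 F (f x)) ->
  \int[@lebesgue_measure R]_(x in `[a, b]) f x = F b - F a.
Proof.
move=> ab cf dF.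
have cF : continuous F.
  move=> x; apply: differentiable_continuous; apply/derivable1_diffP.
  by case: (dF x).
rewrite /Rintegral (@continuous_FTC2 _ f F)//.
- exact: continuous_subspaceT.
- split => [x _||]; first by case: (dF x).
  + by apply: cvg_at_right_filter; exact: cF.
  + by apply: cvg_at_left_filter; exact: cF.
- by move=> x _; rewrite derive1E; case: (dF x).
Qed.

(** z (1-z)^(a-1) integrates to zero in t, since its product with - i a is the
derivative in t of (1-z)^a. *)
Lemma circle_mean_N1 a r : `|r| < 1 -> a * r * circle_mean (a - 1) (- 1) r = 0.
Proof.
move=> r1.
(* The phase pi/2 selects the imaginary part of (1-z)^a, whose derivative
   in t is a real part. *)
pose V t := polar a (1 - r * cos t) (- (r * sin t)) (pi / 2).
have dV t : is_derive t 1 V (- (a * r) * upolar (a - 1) (- 1) r t).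
  have X0 := circle_re_gt0 t r1.
  have := is_derive_polar a (is_derive_circle_re r t)
    (is_derive_circle_im r t) (is_derive_cst (pi / 2) t 1) X0.
  move/is_derive_val; apply; rewrite /= /cst /upolar mulN1r -[- t]sub0r polar_rot//.
  rewrite !subr0 cosBpihalf sinBpihalf.
  have r0 : (1 - r * cos t) ^+ 2 + (- (r * sin t)) ^+ 2 != 0.
    by rewrite gt_eqF// ltr_wpDr ?sqr_ge0 ?exprn_gt0.
  move: (expR _) (cos (_ * atan _)) (sin (_ * atan _)) => E C S.
  by field.
have := @Rintegral_FTC (fun t => - (a * r) * upolar (a - 1) (- 1) r t) V 0 (2 * pi) pi2_gt0 _ dV.
rewrite RintegralZl//; last exact: integrable_upolar.
rewrite -/(circle_mean _ _ _) /V cos0 sin0 !mulr_natl cos2pi sin2pi => H.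
apply/eqP; rewrite -oppr_eq0 -mulNr H ?subrr// => t.
by apply: cvgM; [exact: cvg_cst|exact: continuous_upolar].
Qed.

Lemma lnmod_bound r t (r1 : R) : `|r| <= r1 -> r1 < 1 ->
  `|lnmod (1 - r * cos t) (- (r * sin t))| <= ln 4 - ln (1 - r1).
Proof.
move=> rr1 r11; rewrite /lnmod.
have r0 : 0 <= r1 by apply: le_trans rr1.
have r1' : `|r| < 1 by exact: le_lt_trans r11.
have e : (1 - r * cos t) ^+ 2 + (- (r * sin t)) ^+ 2 = 1 - 2 * (r * cos t) + r ^+ 2.
  have := cos2Dsin2 t => h.
  rewrite [LHS](_ : _ = 1 - 2 * (r * cos t) + r ^+ 2 * (cos t ^+ 2 + sin t ^+ 2)); first by rewrite h mulr1.
  by ring.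
have rc : `|r * cos t| <= r1.
  by rewrite normrM (le_trans _ rr1)// ler_piMr// ler_norml cos_geN1 cos_le1.
have e4 : (1 - r * cos t) ^+ 2 + (- (r * sin t)) ^+ 2 <= 4.
  rewrite e; move: rc; rewrite ler_norml => /andP[? _].
  have : r ^+ 2 <= 1 by rewrite -real_normK ?num_real// expr_le1// ltW.
  lra.
have e1 : (1 - r1) ^+ 2 <= (1 - r * cos t) ^+ 2 + (- (r * sin t)) ^+ 2.
  apply: ler_wpDr; first exact: sqr_ge0.
  rewrite ler_sqr ?nnegrE ?subr_ge0 ?(ltW r11)//.
    by move: rc; rewrite ler_norml => /andP[_ ?]; lra.
  by move: rc; rewrite ler_norml => /andP[_ ?]; lra.
have p1 : 0 < 1 - r1 by rewrite subr_gt0.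
have p2 : 0 < (1 - r1) ^+ 2 by exact: exprn_gt0.
have p3 := lt_le_trans p2 e1.
have l4 : 0 <= ln 4 :> R by rewrite ln_ge0// ler1n.
have l1 : ln (1 - r1) <= 0 by rewrite ln_le0// lerBlDr lerDl.
have := e1; rewrite -ler_ln ?posrE// lnXn// mulr2n => h1.
have := e4; rewrite -ler_ln ?posrE// => h4.
rewrite ler_norml; apply/andP; split; lra.
Qed.

Lemma upolar_bound a mu r t (r1 : R) : `|r| <= r1 -> r1 < 1 ->
  `|upolar a mu r t| <= expR (`|a| * (ln 4 - ln (1 - r1))).
Proof.
move=> rr1 r11; rewrite /upolar /polar normrM (gtr0_norm (expR_gt0 _)).
rewrite -[leRHS]mulr1 ler_pM ?expR_ge0//.
  rewrite ler_expR (le_trans (ler_norm _))// normrM ler_wpM2l//.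
  exact: lnmod_bound.
by rewrite ler_norml cos_geN1 cos_le1.
Qed.

(** The radius is the variable here: differentiating in r replaces an argument
about analytic functions, and relates the coefficient of index m of (1-z)^a to
the one of index m - 1 of (1-z)^(a-1). *)
Lemma is_derive_circle_mean a mu r : `|r| < 1 ->
  is_derive r 1 (circle_mean a mu) (- a * circle_mean (a - 1) (mu - 1) r).
Proof.
(* A radius between |r| and 1 bounds the derivatives near r uniformly. *)
move=> r1; pose r2 := (`|r| + 1) / 2.
have r21 : r2 < 1 by rewrite /r2; lra.
have rr2 : `|r| < r2 by rewrite /r2; lra.
have I1 x : (`](- r2), r2[%classic : set R) x -> `|x| <= r2.
  by rewrite /= in_itv/= ler_norml => /andP[/ltW -> /ltW ->].
have I2 x : (`](- r2), r2[%classic : set R) x -> `|x| < 1.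
  by move=> /I1 /le_lt_trans; exact.
pose C := `|a| * expR (`|a - 1| * (ln 4 - ln (1 - r2))).
have C0 : 0 <= C by rewrite mulr_ge0// expR_ge0.
have Ir : (`](- r2), r2[%classic : set R) r by rewrite /= in_itv/= -ltr_norml.
have hint x : (`](- r2), r2[%classic : set R) x ->
    (@lebesgue_measure R).-integrable `[0, 2 * pi] (EFin \o upolar a mu x).
  by move=> /I2; exact: integrable_upolar.
have hder x y : (`](- r2), r2[%classic : set R) x ->
    (`[0, 2 * pi]%classic : set R) y -> derivable ((upolar a mu) ^~ y) x 1.
  by move=> /I2 h _; case: (is_derive_upolar_r a mu y h).
have dE x y : (`](- r2), r2[%classic : set R) x ->
    partial1of2 (upolar a mu) x y = - a * upolar (a - 1) (mu - 1) x y.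
  by move=> /I2 h; rewrite partial1of2E; case: (is_derive_upolar_r a mu y h).
have hC : (@lebesgue_measure R).-integrable `[0, 2 * pi] (EFin \o cst C).
  apply: continuous_compact_integrable; first exact: segment_compact.
  by apply: continuous_subspaceT => x; exact: cst_continuous.
have hub x y : (`](- r2), r2[%classic : set R) x ->
    (`[0, 2 * pi]%classic : set R) y -> `|partial1of2 (upolar a mu) x y| <= cst C y.
  move=> Ix _; rewrite (dE _ _ Ix) normrM normrN ler_wpM2l//.
  exact: upolar_bound (I1 _ Ix) r21.
have mI : measurable (`[0, 2 * pi]%classic : set (measurableTypeR R)) by [].
apply: DeriveDef.
  exact: (derivable_under_integral mI Ir hint hder (fun=> C0) hC hub).
rewrite -derive1E (differentiation_under_integral mI Ir hint hder (fun=> C0) hC hub).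
rewrite /circle_mean -RintegralZl//; last exact: integrable_upolar.
by apply: eq_Rintegral => t _; rewrite dE.
Qed.

Lemma is_derive0_const (f : R -> R) (a b : R) : a <= b ->
  (forall x, a < x < b -> is_derive x 1 f 0) -> {within `[a, b], continuous f} ->
  f b = f a.
Proof.
rewrite le_eqVlt => /predU1P[-> //|ab] df cf.
have [c _] := MVT ab (df := fun=> 0) (fun x => df x) cf.
by rewrite mul0r => /eqP; rewrite subr_eq0 => /eqP.
Qed.

Lemma circle_mean_at0 a (m : nat) :
  circle_mean a m%:R 0 = if m == 0%N then 2 * pi else 0.
Proof.
have e t : upolar a m%:R 0 t = cos (m%:R * t).
  rewrite /upolar /polar !mul0r oppr0 addr0 /lnmod expr1n expr0n/= addr0 ln1.
  by rewrite divr1 mul0r mulr0 expR0 mul1r atan0 mulr0 sub0r cosN.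
rewrite /circle_mean; under eq_Rintegral do rewrite e.
case: eqP => [->|/eqP m0].
  under eq_Rintegral do rewrite mul0r cos0.
  rewrite (@Rintegral_FTC (cst 1) id)//; first by rewrite subr0.
  - exact: pi2_gt0.
  - by move=> x; exact: cst_continuous.
have m0' : m%:R != 0 :> R by rewrite pnatr_eq0.
have dS (x : R) : is_derive x 1 (fun t => m%:R^-1 * sin (m%:R * t)) (cos (m%:R * x)).
  have H := is_derive_scal m%:R^-1
    (is_derive_comp (is_derive_scal m%:R (is_derive_id x (1:R))) (is_derive_sin _)).
  by apply: is_derive_val H _; rewrite mulr1 mulrCA mulVf// mulr1.
rewrite (Rintegral_FTC pi2_gt0 _ dS).
  rewrite mulr0 sin0 mulr0 subr0.
  have := periodicn (@sinD2pi R) m 0; rewrite add0r sin0 => s0.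
  by rewrite (_ : m%:R * (2 * pi) = pi *+ 2 *+ m) ?s0 ?mulr0// !mulr_natl.
move=> x; apply: continuous_comp; last exact: continuous_cos.
by apply: cvgM; [exact: cvg_cst|exact: cvg_id].
Qed.

(** Induction on m for all exponents at once: both sides have the same derivative
in r, by [cesaroS_shift] and the induction hypothesis (by [circle_mean_N1] when
m = 0), and they agree at r = 0. *)
Lemma circle_meanE a (m : nat) r : 0 <= r < 1 ->
  circle_mean a m%:R r = 2 * pi * cesaro (- a) m * r ^+ m.
Proof.
elim: m a r => [|m IH] a r /andP[r0 r1].
- rewrite cesaro0 expr0 !mulr1.
  transitivity (circle_mean a 0 0); last by rewrite (circle_mean_at0 a 0).
  apply: is_derive0_const => // [x /andP[x0 xr]|].
    have x1 : `|x| < 1 by rewrite gtr0_norm// (lt_trans xr).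
    apply: is_derive_val (is_derive_circle_mean a 0 x1) _.
    have := circle_mean_N1 a x1; rewrite sub0r => /eqP.
    by rewrite mulrAC mulf_eq0 (gt_eqF x0) orbF mulNr => /eqP ->; rewrite oppr0.
  apply: derivable_within_continuous => x; rewrite in_itv/= => /andP[x0 xr].
  have x1 : `|x| < 1 by rewrite ger0_norm// (le_lt_trans xr).
  by case: (is_derive_circle_mean a 0 x1).
- pose D x := circle_mean a m.+1%:R x - 2 * pi * cesaro (- a) m.+1 * x ^+ m.+1.
  have dD (x : R) : `|x| < 1 -> is_derive x 1 D (- a * circle_mean (a - 1) m%:R x -
      2 * pi * (m.+1%:R * cesaro (- a) m.+1) * x ^+ m).
    move=> x1; have := is_derive_add (is_derive_circle_mean a m.+1%:R x1)
      (is_derive_scal (- (2 * pi * cesaro (- a) m.+1)) (is_derive_exprn m x)).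
    rewrite (_ : m.+1%:R - 1 = m%:R); last by rewrite -natr1 addrK.
    move=> H; apply: (is_derive_ext (is_derive_val H _)) => [|y].
      by ring.
    by rewrite mulNr.
  suff : D r = D 0.
    rewrite /D circle_mean_at0/= expr0n/= mulr0 subrr => /eqP.
    by rewrite subr_eq0 => /eqP.
  apply: is_derive0_const => // [x /andP[x0 xr]|].
    have x1 : `|x| < 1 by rewrite gtr0_norm// (lt_trans xr).
    apply: is_derive_val (dD _ x1) _.
    rewrite IH ?(ltW x0) ?(lt_trans xr)//.
    rewrite (_ : m.+1%:R * cesaro (- a) m.+1 = - a * cesaro (- (a - 1)) m).
      by ring.
    by rewrite cesaroS_shift opprB addrC.
  apply: derivable_within_continuous => x; rewrite in_itv/= => /andP[x0 xr].
  have x1 : `|x| < 1 by rewrite ger0_norm// (le_lt_trans xr).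
  by case: (dD _ x1).
Qed.

End circle.

(** * Integrals of linear combinations *)

Lemma integrable_mulr d (T : measurableType d) (R : realType)
    (mu : {measure set T -> \bar R}) (D : set T) (mD : measurable D)
    (k : R) (f : T -> R) : mu.-integrable D (EFin \o f) ->
  mu.-integrable D (EFin \o (fun x => k * f x)).
Proof.
by move=> /(integrableZl mD k); apply: eq_integrable => // x _; rewrite /= EFinM.
Qed.

Lemma Rintegral_sum d (T : measurableType d) (R : realType)
    (mu : {measure set T -> \bar R}) (D : set T) (mD : measurable D)
    (n : nat) (f : 'I_n -> T -> R) :
  (forall i, mu.-integrable D (EFin \o f i)) ->
  \int[mu]_(x in D) (\sum_(i < n) f i x) = \sum_(i < n) \int[mu]_(x in D) f i x.
Proof.
move=> intf; rewrite /Rintegral.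
under eq_integral do rewrite -sumEFin.
rewrite (@integral_sum _ _ _ mu D mD _ (fun i x => (f i x)%:E) intf).
rewrite -[RHS]/(fine (_%:E)) -sumEFin; congr fine; apply: eq_bigr => i _.
by rewrite fineK//; exact: integrable_fin_num (intf i).
Qed.

(** * The Wright numbers *)

Section wright_coefficients.
Context (R : realType).
Local Open Scope complex_scope.
Implicit Types (r t a h : R).

Lemma eq_complex_pair (x y x' y' : R) : x = x' -> y = y' -> x +i* y = x' +i* y'.
Proof. by move=> -> ->. Qed.

Lemma cisD (s t : R) : cis (s + t) = cis s * cis t.
Proof. by rewrite /cis; simpc; rewrite cosD sinD; apply: eq_complex_pair => //; ring. Qed.

Lemma cis0 : cis (0 : R) = 1.
Proof. by rewrite /cis cos0 sin0. Qed.

Lemma cisXn t n : cis t ^+ n = cis (n%:R * t).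
Proof.
elim: n => [|n IH]; first by rewrite mul0r cis0.
by rewrite exprS IH -cisD -natr1; congr cis; ring.
Qed.

Lemma cisV t : (cis t)^-1 = cis (- t).
Proof.
have h : cis t * cis (- t) = 1 by rewrite -cisD subrr cis0.
have t0 : cis t != 0 by apply: contra_eq_neq h => ->; rewrite mul0r eq_sym oner_eq0.
by apply: (mulfI t0); rewrite h divff.
Qed.

(** For points of the right half-plane the argument defined through acos is the
arc tangent used in [polar]. *)
Lemma carg_atan (x y : R) : 0 < x -> carg (x +i* y) = atan (y / x).
Proof.
move=> x0; rewrite /carg /cmod /=.
have e : x / Num.sqrt (x ^+ 2 + y ^+ 2) = cos (atan (y / x)).
  rewrite cos_atan_div//; congr (_ / _).
  have r0 : 0 < x ^+ 2 + y ^+ 2 by rewrite ltr_wpDr ?sqr_ge0 ?exprn_gt0.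
  by rewrite -powR12_sqrt ?ltW// /powR gt_eqF// mulrC.
rewrite e; have [y0|y0] := leP 0 y.
  rewrite cosK// in_itv/= -[leLHS]atan0 le_atan ?divr_ge0 ?(ltW x0)//=.
  by apply: (le_trans (ltW (atan_ltpi2 _))); have := pi_gt0 R; lra.
rewrite -cosN -atanN cosK ?atanN ?opprK// in_itv/= -atanN -[leLHS]atan0 le_atan; last first.
  by rewrite -mulNr divr_ge0 ?oppr_ge0 ?ltW.
by apply: (le_trans (ltW (atan_ltpi2 _))); have := pi_gt0 R; lra.
Qed.

Lemma cpowRE (h x y a : R) : 0 < h -> 0 < x ->
  cpowR ((x +i* y) / h%:C) a =
  (h `^ (- a) * expR (a * lnmod x y))%:C * cis (a * atan (y / x)).
Proof.
move=> h0 x0; have h0' := lt0r_neq0 h0.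
have -> : (x +i* y) / h%:C = (x / h) +i* (y / h).
  have hC : h%:C != 0 by rewrite (fmorph_eq0 (real_complex R)).
  by apply: (mulIf hC); rewrite divfK//; simpc; rewrite !divfK.
rewrite /cpowR carg_atan ?divr_gt0// invf_div mulrA divfK//.
congr (_%:C * _).
rewrite /cmod /=.
have -> : (x / h) ^+ 2 + (y / h) ^+ 2 = (x ^+ 2 + y ^+ 2) / h ^+ 2 by field.
have r0 : 0 < x ^+ 2 + y ^+ 2 by rewrite ltr_wpDr ?sqr_ge0 ?exprn_gt0.
rewrite sqrtrM ?ltW// sqrtrV ?sqr_ge0// sqrtr_sqr gtr0_norm//.
rewrite mulrC powRM ?invr_ge0 ?sqrtr_ge0 ?ltW// -powR_inv1 ?ltW// -powRrM mulN1r.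
congr (_ * _); rewrite -powR12_sqrt ?ltW// -powRrM /powR gt_eqF//.
by congr expR; rewrite /lnmod; ring.
Qed.

(** The complex number x e^(it). *)
Definition pol (x t : R) : R[i] := x%:C * cis t.

Lemma polM x y s t : pol x s * pol y t = pol (x * y) (s + t).
Proof. by rewrite /pol cisD rmorphM/= mulrACA. Qed.

Lemma polX x t n : pol x t ^+ n = pol (x ^+ n) (n%:R * t).
Proof. by rewrite /pol exprMn cisXn rmorphXn. Qed.

Lemma polV x t : (pol x t)^-1 = pol x^-1 (- t).
Proof. by rewrite /pol invfM cisV fmorphV. Qed.

Lemma polN x t : - pol x t = pol (- x) t.
Proof. by rewrite /pol rmorphN mulNr. Qed.

Lemma polMn x t n : pol x t *+ n = pol (n%:R * x) t.
Proof. by rewrite /pol mulr_natl rmorphMn mulrnAl. Qed.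

Lemma Im_ipol x t : complex.Im ('i * pol x t) = x * cos t.
Proof. by rewrite /pol /cis; simpc. Qed.

(** The binomial expansion of the integrand of the Wright contour integral, with
every term written as i times a number in polar form; the factor i comes from
dz = i z dt. *)
Lemma wright_integrand alpha h r n j t : 0 < h -> 0 < r < 1 ->
  let z := r%:C * cis t in
  let L := lnmod (1 - r * cos t) (- (r * sin t)) in
  let T := atan (- (r * sin t) / (1 - r * cos t)) in
  (z ^+ n.+1)^-1 * ((1 - h%:C * cpowR ((1 - z) / h%:C) alpha) ^+ j /
     cpowR ((1 - z) / h%:C) (1 - alpha)) * (r%:C * 'i * cis t) =
  \sum_(i < j.+1) 'i * pol (('C(j, i)%:R * (- h `^ (1 - alpha)) ^+ i *
      h `^ (1 - alpha) / r ^+ n) * expR ((alpha * i%:R - (1 - alpha)) * L))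
    ((alpha * i%:R - (1 - alpha)) * T - n%:R * t).
Proof.
move=> h0 /andP[r0 r1] z L T; have h0' := lt0r_neq0 h0; have r0' := lt0r_neq0 r0.
set c := h `^ (1 - alpha).
have X0 : 0 < 1 - r * cos t by apply: circle_re_gt0; rewrite gtr0_norm.
have -> : 1 - z = (1 - r * cos t) +i* (- (r * sin t)).
  by rewrite /z /cis; simpc.
rewrite !cpowRE// -/L -/T -/(pol _ _) -/(pol _ _).
have -> : h%:C * pol (h `^ (- alpha) * expR (alpha * L)) (alpha * T) =
    pol (c * expR (alpha * L)) (alpha * T).
  rewrite /pol mulrA -rmorphM/= mulrA; congr ((_ * _)%:C * _).
  by rewrite /c powRD ?h0' ?implybT// powRr1// ltW.
rewrite polV invfM -powRN opprK -/c -expRN.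
rewrite polN exprDn mulr_suml mulr_sumr mulr_suml.
apply: eq_bigr => i _.
rewrite expr1n mul1r [_ ^+ i]polX -[- (c * expR (alpha * L))]mulNr
  [(- c * _) ^+ i]exprMn -expRM_natl.
rewrite [r%:C * 'i]mulrC -[_ * _ * cis t]mulrA -/z.
rewrite exprSr invfM /z -/(pol r t) polX polV polV.
rewrite polMn.
rewrite [LHS]mulrC -[LHS]mulrA; congr (_ * _).
rewrite [LHS]mulrC.
rewrite !polM; congr pol.
  rewrite (_ : (alpha * i%:R - (1 - alpha)) * L =
    i%:R * (alpha * L) + - ((1 - alpha) * L)); last by ring.
  rewrite expRD; move: (expR _) (expR _) => E F.
  have : r ^+ n != 0 by rewrite expf_neq0.
  by move: (r ^+ n) => rn rn0; field; rewrite rn0 r0'.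
ring.
Qed.

(** Each term of [wright_integrand] contributes a circle integral, that is, a
value of [symbol] on a power of 'X. *)
Lemma Re_wright alpha h r n j : 0 < h -> 0 < r < 1 ->
  complex.Re (wright alpha (1 - alpha) h r n j) =
  h `^ (1 - alpha) * symbol alpha n ((1 - h `^ (1 - alpha) *: 'X) ^+ j).
Proof.
move=> h0 /andP[r0 r1]; have h0' := lt0r_neq0 h0.
set c := h `^ (1 - alpha).
have nr1 : `|r| < 1 by rewrite gtr0_norm.
pose a (i : nat) := alpha * i%:R - (1 - alpha).
have ReE (x y : R) : complex.Re (((2 * pi)%:C * 'i)^-1 * (x +i* y)) = (2 * pi)^-1 * y.
  have p0 : 2 * pi != 0 :> R := lt0r_neq0 (@pi2_gt0 R).
  have -> : ((2 * pi)%:C * 'i)^-1 = 0 +i* - (2 * pi : R)^-1.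
    have d0 : (2 * pi)%:C * 'i != 0 :> R[i].
      by rewrite mulf_neq0 ?(fmorph_eq0 (real_complex R))// eq_complex/= oner_eq0 andbF.
    apply: (mulfI d0); rewrite divff//; simpc.
    by rewrite divff.
  by rewrite /= mul0r sub0r mulNr opprK.
rewrite /wright /circle_integral ReE.
have -> : \int[@lebesgue_measure R]_(t in `[0, 2 * pi]) complex.Im
    ((r%:C * cis t) ^- n.+1 *
     ((1 - h%:C * cpowR ((1 - r%:C * cis t) / h%:C) alpha) ^+ j /
      cpowR ((1 - r%:C * cis t) / h%:C) (1 - alpha)) * (r%:C * 'i * cis t)) =
   \int[@lebesgue_measure R]_(t in `[0, 2 * pi]) (\sum_(i < j.+1)
    ('C(j, i)%:R * (- c) ^+ i * c / r ^+ n) * upolar (a i) n%:R r t).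
  apply: eq_Rintegral => t _; rewrite wright_integrand ?r0//.
  rewrite (raddf_sum (@complex.Im R)); apply: eq_bigr => i _.
  by rewrite [LHS]Im_ipol /upolar /polar [RHS]mulrA.
have -> : \int[@lebesgue_measure R]_(t in `[0, 2 * pi]) (\sum_(i < j.+1)
    ('C(j, i)%:R * (- c) ^+ i * c / r ^+ n) * upolar (a i) n%:R r t) =
   \sum_(i < j.+1) ('C(j, i)%:R * (- c) ^+ i * c / r ^+ n) *
     circle_mean (a i) n%:R r.
  rewrite Rintegral_sum//; last first.
    move=> i; apply: integrable_mulr => //.
    exact: integrable_upolar.
  by apply: eq_bigr => i _; rewrite RintegralZl//; exact: integrable_upolar.
rewrite mulr_sumr exprBn linear_sum/= mulr_sumr; apply: eq_bigr => i _.
rewrite circle_meanE ?(ltW r0)//.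
have -> : (-1) ^+ i * 1 ^+ (j - i) * (c *: 'X) ^+ i *+ 'C(j, i) =
    ('C(j, i)%:R * (- c) ^+ i) *: 'X^i :> {poly R}.
  have -> : (-1) ^+ i = ((-1) ^+ i)%:P :> {poly R} by rewrite polyC_exp polyCN.
  rewrite expr1n mulr1 exprZn mul_polyC scalerA -scaler_nat scalerA.
  by rewrite [(- c) ^+ i]exprNn.
rewrite linearZ/= symbolXn.
have -> : - a i = 1 - alpha - alpha * i%:R by rewrite /a; ring.
have p0 : pi != 0 :> R by exact: lt0r_neq0 (pi_gt0 R).
have : r ^+ n != 0 by rewrite expf_neq0// lt0r_neq0.
by move: (r ^+ n) (pi) p0 => rn q q0 rn0; field; rewrite rn0 q0.
Qed.

End wright_coefficients.

(** * Integrals over the half-line *)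

Section half_line.
Context (R : realType).
Local Notation mu := (@lebesgue_measure R).
Local Notation HL := (`]0%R, +oo[%classic : set R).
Implicit Types (f F : R -> R) (k s lam : R).

Lemma half_lineP (t : R) : `]0, +oo[%classic t -> 0 < t.
Proof. by rewrite /= in_itv/= andbT. Qed.

Lemma ge0_integral_scale (g : R -> \bar R) k : 0 < k -> measurable_fun HL g ->
  (forall t : R, 0 < t -> (0 <= g t)%E) ->
  (\int[mu]_(t in HL) g t = k%:E * \int[mu]_(t in HL) g (k * t)%R)%E.
Proof.
move=> k0 mg g0.
have mk : measurable_fun [set: measurableTypeR R] ( *%R k : R -> measurableTypeR R).
  exact: measurable_funM.
pose phi_mixin := isMeasurableFun.Build _ _ _ _ _ mk.
pose phi : {mfun measurableTypeR R >-> measurableTypeR R} := HB.pack ( *%R k : R -> R) phi_mixin.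
have muE (A : set R) : measurable A -> mu A = mscale (NngNum (ltW k0)) (pushforward mu phi) A.
  apply: lebesgue_measure_unique => _ [[a b] _ <-].
  transitivity (k%:E * mu `](a / k)%R, (b / k)%R]%classic)%E.
    rewrite !lebesgue_measure_itv/= !lte_fin ltr_pM2r ?invr_gt0//.
    case: ifPn => _; rewrite ?mule0//.
    rewrite -!EFinB -EFinM; congr EFin; have := lt0r_neq0 k0 => ?; by field.
  congr (_ * mu _)%E; apply/seteqP.
  by split => x/=; rewrite !in_itv/= ltr_pdivrMr// ler_pdivlMr// mulrC.
rewrite (eq_measure_integral (mscale (NngNum (ltW k0)) (pushforward mu phi))); last first.
  by move=> A mA _; exact: muE.
rewrite ge0_integral_mscale//; last by move=> t /half_lineP; exact: g0.
rewrite ge0_integral_pushforward//; last by move=> t; rewrite inE => /half_lineP; exact: g0.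
congr (_ * integral _ _ _)%E.
by apply/seteqP; split => x/=; rewrite !in_itv/= !andbT pmulr_rgt0.
Qed.

(** Compact intervals that avoid the possible singularity at 0. *)
Definition exhaust (n : nat) : set R := `[n.+1%:R^-1, n.+1%:R].

Lemma exhaust_cvg f : measurable_fun HL f -> (forall t : R, 0 < t -> 0 <= f t) ->
  (\int[mu]_(t in exhaust n) (f t)%:E)%E @[n --> \oo] --> (\int[mu]_(t in HL) (f t)%:E)%E.
Proof.
move=> mf f0.
have sub n : exhaust n `<=` HL.
  move=> t; rewrite /exhaust/= !in_itv/= andbT => /andP[+ _].
  by apply: lt_le_trans; rewrite invr_gt0.
have -> : HL = \bigcup_n exhaust n.
  apply/seteqP; split => [t /half_lineP t0|t [n _]]; last exact: sub.
  exists (Num.bound (t + t^-1)) => //; rewrite /exhaust/= in_itv/=.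
  have h := archi_boundP (addr_ge0 (ltW t0) (ltW (_ : 0 < t^-1))).
  have h1 : t + t^-1 < (Num.bound (t + t^-1)).+1%:R.
    by rewrite (lt_trans (h _)) ?invr_gt0// ltr_nat.
  rewrite invf_ple ?posrE//; apply/andP; split.
    by rewrite (le_trans _ (ltW h1))// ler_wpDl// ltW.
  by rewrite (le_trans _ (ltW h1))// ler_wpDr// invr_ge0 ltW.
apply: ge0_nondecreasing_set_cvg_integral => //.
- apply/nondecreasing_seqP => n; rewrite subsetEset /exhaust => t/=.
  rewrite !in_itv/= => /andP[a b]; rewrite (le_trans b) ?ler_nat// andbT.
  by rewrite (le_trans _ a)// lef_pV2 ?posrE// ler_nat.
- by move=> n; exact: measurable_itv.
- move=> n; apply/measurable_EFinP; apply: measurable_funS mf => //.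
- by move=> n t /sub/half_lineP/f0; rewrite lee_fin.
Qed.

(** An integration by parts without boundary terms, stated for non-negative
integrands so that neither side has to be known to be finite. *)
Lemma eq_integral_primitive (f1 f2 F : R -> R) :
  {in HL, continuous f1} -> {in HL, continuous f2} ->
  (forall t : R, 0 < t -> 0 <= f1 t) -> (forall t : R, 0 < t -> 0 <= f2 t) ->
  (forall t : R, 0 < t -> is_derive t 1 F (f1 t - f2 t)) ->
  F n.+1%:R^-1 @[n --> \oo] --> (0 : R) -> F n.+1%:R @[n --> \oo] --> (0 : R) ->
  (\int[mu]_(t in HL) (f1 t)%:E = \int[mu]_(t in HL) (f2 t)%:E)%E.
Proof.
move=> c1 c2 p1 p2 dF F0 Foo.
have mHL f : {in HL, continuous f} -> measurable_fun HL f.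
  by move=> cf; apply: open_continuous_measurable_fun => //; exact: interval_open.
have sub n : exhaust n `<=` HL.
  move=> t; rewrite /exhaust/= !in_itv/= andbT => /andP[+ _].
  by apply: lt_le_trans; rewrite invr_gt0.
have L1 := exhaust_cvg (mHL _ c1) p1; have L2 := exhaust_cvg (mHL _ c2) p2.
have intx f n : {in HL, continuous f} -> mu.-integrable (exhaust n) (EFin \o f).
  move=> cf; apply: continuous_compact_integrable; first exact: segment_compact.
  apply: continuous_in_subspaceT => t; rewrite inE => /sub h; apply: cf.
  by rewrite inE.
have mE n : measurable (exhaust n : set (measurableTypeR R)) by exact: measurable_itv.
have E n : (\int[mu]_(t in exhaust n) (f1 t)%:E =
    \int[mu]_(t in exhaust n) (f2 t)%:E + (F n.+1%:R - F n.+1%:R^-1)%:E)%E.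
  (* For n = 0 the interval is the point 1. *)
  have [n0|n0] := posnP n.
    rewrite /exhaust n0 invr1 set_itv1 !integral_set1 subrr addr0//.
  have lt : n.+1%:R^-1 < n.+1%:R :> R.
    by rewrite (@lt_trans _ _ 1)// ?invf_lt1 ?ltr1n.
  have p0 : 0 < n.+1%:R^-1 :> R by rewrite invr_gt0.
  have cF x : 0 < x -> {for x, continuous F}.
    by move=> x0; apply: differentiable_continuous; apply/derivable1_diffP; case: (dF x x0).
  have c12 : {within `[n.+1%:R^-1, n.+1%:R], continuous (fun t => f1 t - f2 t)}.
    apply: continuous_in_subspaceT => t; rewrite inE => /sub h.
    by apply: cvgB; [apply: c1|apply: c2]; rewrite inE.
  have := @continuous_FTC2 _ (fun t => f1 t - f2 t) F _ _ lt c12.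
  rewrite -/(exhaust n).
  under eq_integral do rewrite EFinB.
  rewrite integralB_EFin//; try exact: intx.
  have d1 : derivable_oo_LRcontinuous F n.+1%:R^-1 n.+1%:R.
    split => [x||].
    + rewrite in_itv/= => /andP[x0 _]; have := dF x (lt_trans p0 x0).
      by case.
    + by apply: cvg_at_right_filter; exact: cF.
    + by apply: cvg_at_left_filter; apply: cF; exact: lt_trans lt.
  have d2 : {in `]n.+1%:R^-1, n.+1%:R[, F^`()%classic =1 (fun t : R => f1 t - f2 t)}.
    move=> x; rewrite in_itv/= => /andP[x0 _]; rewrite derive1E.
    by have := dF x (lt_trans p0 x0); case.
  move=> /(_ d1 d2); rewrite EFinB => <-.
  by rewrite addeC subeK//; apply: integrable_fin_num => //; exact: intx.
have L3 : (F n.+1%:R - F n.+1%:R^-1)%:E @[n --> \oo] --> 0%E.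
  apply: cvg_EFin; first exact: nearW.
  by rewrite -[X in _ --> X](subr0 0); apply: cvgB.
have /= := cvgeD (fin_num_adde_defl _ (erefl : 0%E \is a fin_num)) L2 L3.
rewrite adde0 => L.
apply: (@cvg_unique _ _ _ _ _ _ L1); first exact: ereal_hausdorff.
by rewrite /= (funext E); exact: L.
Qed.

End half_line.

(** * Gamma integrals *)

Section gamma_integral.
Context (R : realType).
Local Notation mu := (@lebesgue_measure R).
Local Notation HL := (`]0%R, +oo[%classic : set R).
Implicit Types (t s lam gam : R).

Lemma expr_le_expR (x : R) n : 0 <= x -> x ^+ n / n`!%:R <= expR x.
Proof.
case: n => [|n] x0; first by rewrite expr0 divr1 -expR0 ler_expR.
by apply: le_trans (_ : 1 + x ^+ n.+1 / n.+1`!%:R <= _); rewrite ?lerDr ?expR_ge1Dxn.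
Qed.

Lemma powR_le_1Dexprn t s k : 0 <= t -> 0 <= s <= k%:R -> t `^ s <= 1 + t ^+ k.
Proof.
move=> t0 /andP[s0 sk]; have [t1|t1] := leP t 1.
  rewrite (@le_trans _ _ 1)//; last by rewrite lerDl exprn_ge0.
  have -> : 1 = 1 `^ s :> R by rewrite powR1.
  by apply: ge0_ler_powR; rewrite ?nnegrE.
rewrite ler_wpDl// -powR_mulrn// ler_powR// ltW//.
Qed.

(** Gamma(s+1) / lam^(s+1), as a possibly infinite integral. *)
Definition gint s lam : \bar R := (\int[mu]_(t in HL) (t `^ s * expR (- (lam * t)))%:E)%E.

Lemma gint_ge0 s lam : (0 <= gint s lam)%E.
Proof.
by apply: integral_ge0 => t _; rewrite lee_fin mulr_ge0// ?powR_ge0// expR_ge0.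
Qed.

Lemma measurable_gint s lam (D : set R) : measurable_fun D (fun t => t `^ s * expR (- (lam * t))).
Proof.
apply: measurable_funTS; apply: measurable_funM; first exact: measurable_powR.
by apply: measurableT_comp => //; apply: measurable_funN; exact: measurable_funM.
Qed.

Lemma continuous_powR_expR s lam t : 0 < t ->
  {for t, continuous (fun t => t `^ s * expR (- (lam * t)))}.
Proof.
move=> t0; have d : derivable (fun t => t `^ s) t 1.
  by apply: derivable_powR; rewrite in_itv/= t0.
apply: cvgM; first by have /derivable1_diffP/differentiable_continuous := d.
apply: continuous_comp; last exact: continuous_expR.
by apply: cvgN; apply: cvgM; [exact: cvg_cst|exact: cvg_id].
Qed.

Lemma powR_expR_cvg0 s lam : 0 < s -> 0 < lam ->
  (n.+1%:R^-1) `^ s * expR (- (lam * n.+1%:R^-1)) @[n --> \oo] --> (0 : R).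
Proof.
move=> s0 l0.
have h : (n.+1%:R^-1 : R) `^ s @[n --> \oo] --> (0 : R).
  have /cvg_at_rightP := powR_cvg0 s0; apply.
  by split => [n|]; [rewrite invr_gt0|exact: cvg_harmonic].
apply: (squeeze_cvgr _ (cvg_cst 0) h); near=> n.
rewrite mulr_ge0 ?powR_ge0 ?expR_ge0//= ler_piMr ?powR_ge0//.
by rewrite -expR0 ler_expR oppr_le0 mulr_ge0// ltW.
Unshelve. all: by end_near. Qed.

Lemma powR_expR_cvgy s lam : 0 < s -> 0 < lam ->
  n.+1%:R `^ s * expR (- (lam * n.+1%:R)) @[n --> \oo] --> (0 : R).
Proof.
move=> s0 l0; pose k := Num.bound s.
have sk : s <= k%:R by apply: ltW; apply: archi_boundP; exact: ltW.
pose C := k.+1`!%:R / lam ^+ k.+1.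
have C0 : 0 <= C by rewrite divr_ge0 ?exprn_ge0// ltW.
have h : C * n.+1%:R^-1 @[n --> \oo] --> (0 : R).
  by rewrite -[X in _ --> X](mulr0 C); apply: cvgM; [exact: cvg_cst|exact: cvg_harmonic].
apply: (squeeze_cvgr _ (cvg_cst 0) h); near=> n.
rewrite mulr_ge0 ?powR_ge0 ?expR_ge0//=.
rewrite (@le_trans _ _ (n.+1%:R ^+ k * expR (- (lam * n.+1%:R))))//.
  by rewrite ler_wpM2r ?expR_ge0// -powR_mulrn// ler_powR// ler1n.
have x0 : 0 <= lam * n.+1%:R by rewrite mulr_ge0// ltW.
have := expr_le_expR k.+1 x0; rewrite expRN => H.
rewrite ler_pdivrMr ?expR_gt0//; apply: le_trans (ler_wpM2l _ H); last first.
  by rewrite mulr_ge0// invr_ge0.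
rewrite /C exprMn [n.+1%:R ^+ k.+1]exprS.
have n0 : n.+1%:R != 0 :> R by rewrite pnatr_eq0.
have f0 : k.+1`!%:R != 0 :> R by rewrite pnatr_eq0 -lt0n fact_gt0.
have l1 : lam ^+ k.+1 != 0 by rewrite expf_neq0// lt0r_neq0.
move: (lam ^+ k.+1) (k.+1`!%:R) (n.+1%:R) l1 f0 n0 => a b c a0 b0 c0.
by rewrite le_eqVlt; apply/orP; left; apply/eqP; field; rewrite a0 b0 c0.
Unshelve. all: by end_near. Qed.

Lemma gintZl s lam (k : R) : 0 <= k ->
  (k%:E * gint s lam = \int[mu]_(t in HL) (k * (t `^ s * expR (- (lam * t))))%:E)%E.
Proof.
move=> k0; rewrite /gint -ge0_integralZl_EFin//.
- by move=> t _; rewrite lee_fin mulr_ge0// ?powR_ge0// expR_ge0.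
- by apply/measurable_EFinP; exact: measurable_gint.
Qed.

(** Gamma(s+1) = s Gamma(s): the two integrands differ by the derivative of
t^s e^(-lam t), which vanishes at both ends. *)
Lemma gint_rec s lam : 0 < s -> 0 < lam ->
  (s%:E * gint (s - 1) lam = lam%:E * gint s lam)%E.
Proof.
move=> s0 l0.
rewrite (gintZl _ _ (ltW s0)) (gintZl _ _ (ltW l0)).
apply: (@eq_integral_primitive _ _ _ (fun t => t `^ s * expR (- (lam * t)))).
- move=> t; rewrite inE => /half_lineP t0; apply: cvgM; first exact: cvg_cst.
  exact: continuous_powR_expR.
- move=> t; rewrite inE => /half_lineP t0; apply: cvgM; first exact: cvg_cst.
  exact: continuous_powR_expR.
- by move=> t t0; rewrite !mulr_ge0// ?powR_ge0 ?expR_ge0// ltW.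
- by move=> t t0; rewrite !mulr_ge0// ?powR_ge0 ?expR_ge0// ltW.
- move=> t t0.
  have H := is_derive_mul (is_derive1_powR s t0)
    (is_derive_comp (is_derive_scal (- lam) (is_derive_id t (1:R))) (is_derive_expR _)).
  apply: (is_derive_ext (is_derive_val H _)) => [|y]; rewrite ?mulNr//.
  by ring.
- exact: powR_expR_cvg0.
- exact: powR_expR_cvgy.
Qed.

Lemma gintD1 s lam : -1 < s -> 0 < lam ->
  (gint (s + 1) lam = ((s + 1) / lam)%:E * gint s lam)%E.
Proof.
move=> s1 l0; have s10 : 0 < s + 1 by rewrite -ltrBlDr sub0r.
have := gint_rec s10 l0; rewrite addrK => /(congr1 (fun x => (lam^-1)%:E * x)%E).
by rewrite !muleA -!EFinM (mulVf (lt0r_neq0 l0)) mul1e => <-; rewrite mulrC.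
Qed.

Lemma gint0 lam : 0 < lam -> gint 0 lam = (lam^-1)%:E.
Proof.
move=> l0; rewrite /gint.
under eq_integral do rewrite powRr0 mul1r.
pose F t := - lam^-1 * expR (- (lam * t)).
have dF t : is_derive t 1 F (expR (- (lam * t))).
  have H := is_derive_scal (- lam^-1) (is_derive_comp (is_derive_scal (- lam) (is_derive_id t (1:R))) (is_derive_expR _)).
  apply: (is_derive_ext (is_derive_val H _)) => [|y]; last by rewrite /F [- lam * y]mulNr.
  by have := lt0r_neq0 l0 => ?; rewrite [- lam * t]mulNr; field.
have cf : continuous (fun t => expR (- (lam * t))).
  move=> t; apply: continuous_comp; last exact: continuous_expR.
  by apply: cvgN; apply: cvgM; [exact: cvg_cst|exact: cvg_id].
have cF : continuous F.
  by move=> t; apply: differentiable_continuous; apply/derivable1_diffP; case: (dF t).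
rewrite integral_itv_obnd_cbnd; last first.
  by apply/measurable_EFinP; apply: measurable_funTS; exact: continuous_measurable_fun.
rewrite (@ge0_continuous_FTC2y _ _ F _ 0).
- by rewrite /F mulr0 oppr0 expR0 mulr1 EFinN sub0e oppeK.
- by move=> t _; exact: expR_ge0.
- exact: continuous_subspaceT.
- rewrite -[X in _ --> X](mulr0 (- lam^-1)); apply: cvgM; first exact: cvg_cst.
  apply: (@cvg_comp _ _ _ ( *%R lam) (fun y => expR (- y)) _ _ _ _ (@cvgr_expR R)).
  by apply: gt0_cvgMry => //; exact: cvg_id.
- by move=> t _; case: (dF t).
- by apply: cvg_at_right_filter; exact: cF.
- by move=> t _; rewrite derive1E; case: (dF t).
Qed.

Lemma gint_scale s lam : 0 < lam -> gint s lam = ((lam `^ (- (s + 1)))%:E * gint s 1)%E.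
Proof.
move=> l0; have li : 0 < lam^-1 by rewrite invr_gt0.
have mHL : measurable (HL : set (measurableTypeR R)) by exact: measurable_itv.
rewrite (gintZl s 1 (powR_ge0 _ _)) {1}/gint.
rewrite (@ge0_integral_scale _ _ lam^-1 li); last 2 first.
- by apply/measurable_EFinP; exact: measurable_gint.
- by move=> t _; rewrite lee_fin mulr_ge0// ?powR_ge0// expR_ge0.
rewrite -(ge0_integralZl_EFin _ mHL _ _ (ltW li)); last 2 first.
- by move=> t _; rewrite lee_fin mulr_ge0// ?powR_ge0// expR_ge0.
- apply/measurable_EFinP; apply: measurable_funTS; apply: measurable_funM.
    by apply: (measurableT_comp (measurable_powR s)); exact: measurable_funM.
  apply: measurableT_comp => //; apply: measurable_funN.
  by apply: measurable_funM => //; exact: measurable_funM.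
apply: eq_integral => t; rewrite inE => /half_lineP t0.
rewrite -!EFinM; congr EFin.
rewrite mulrA divff ?lt0r_neq0// powRM ?ltW// !mulrA; congr (_ * _ * _).
rewrite -powR_inv1 ?ltW// -powRrM -powRD ?lt0r_neq0 ?implybT//.
by congr powR; ring.
Qed.

Lemma gint_nat lam l : 0 < lam -> gint l%:R lam = (l`!%:R / lam ^+ l.+1)%:E.
Proof.
move=> l0; elim: l => [|l IH]; first by rewrite gint0// mul1r.
rewrite -natr1 gintD1//; last by rewrite (lt_le_trans (ltrN10 _)).
rewrite IH -EFinM; congr EFin; rewrite natr1.
rewrite factS natrM [lam ^+ l.+2]exprS.
have l2 : lam ^+ l.+1 != 0 by rewrite expf_neq0// lt0r_neq0.
by move: (lam ^+ l.+1) l2 (lt0r_neq0 l0) => a a0 b0; field; rewrite a0 b0.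
Qed.

(** For u >= 0 compare t^u with 1 + t^k for an integer k >= u; the recursion
extends the range to s > -1. *)
Lemma gint_lty s lam : -1 < s -> 0 < lam -> (gint s lam < +oo)%E.
Proof.
have pos u : 0 <= u -> 0 < lam -> (gint u lam < +oo)%E.
  move=> u0 l0; pose k := Num.bound u.
  have uk : u <= k%:R by apply: ltW; apply: archi_boundP.
  apply: (@le_lt_trans _ _ (gint 0 lam + gint k%:R lam)%E); last first.
    by rewrite gint0// gint_nat// lte_add_pinfty// ltry.
  rewrite /gint -ge0_integralD//; last 4 first.
  - by move=> t _; rewrite lee_fin mulr_ge0// ?powR_ge0// expR_ge0.
  - by apply/measurable_EFinP; exact: measurable_gint.
  - by move=> t _; rewrite lee_fin mulr_ge0// ?powR_ge0// expR_ge0.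
  - by apply/measurable_EFinP; exact: measurable_gint.
  apply: ge0_le_integral => //.
  - by move=> t _; rewrite lee_fin mulr_ge0// ?powR_ge0// expR_ge0.
  - by apply/measurable_EFinP; exact: measurable_gint.
  - by apply: emeasurable_funD; apply/measurable_EFinP; exact: measurable_gint.
  move=> t /half_lineP t0; rewrite -EFinD lee_fin -mulrDl ler_wpM2r ?expR_ge0//.
  have uk' : 0 <= u <= k%:R by rewrite u0.
  by have := powR_le_1Dexprn (ltW t0) uk'; rewrite powRr0 -(powR_mulrn k (ltW t0)).
move=> s1 l0; have s10 : 0 < s + 1 by rewrite -ltrBlDr sub0r.
have := gint_rec s10 l0; rewrite addrK => /(congr1 (fun x => ((s + 1)^-1)%:E * x)%E).
rewrite !muleA -!EFinM mulVf ?lt0r_neq0// mul1e => ->.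
rewrite lte_mul_pinfty//; first by rewrite lee_fin mulr_ge0 ?invr_ge0// ltW.
by apply: pos => //; exact: ltW.
Qed.

(** Gamma(l+1-gam) = Gamma(1-gam) (1-gam)(2-gam)...(l-gam), and the product is
l! times a Cesaro number. *)
Lemma gint_shift gam lam l : gam < 1 -> 0 < lam ->
  (gint (l%:R - gam) lam = gint (- gam) lam * (l`!%:R * cesaro (1 - gam) l / lam ^+ l)%:E)%E.
Proof.
move=> g1 l0; elim: l => [|l IH].
  by rewrite sub0r cesaro0 expr0 divr1 mulr1 mule1.
have s0 : - 1 < l%:R - gam by rewrite ltrBrDl (lt_le_trans _ (ler0n R l))//; lra.
rewrite -natr1 addrAC gintD1// IH muleCA -EFinM; congr (_ * EFin _)%E.
have := cesaroS (1 - gam) l; rewrite factS natrM exprS => E.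
have -> : l.+1%:R * l`!%:R * cesaro (1 - gam) l.+1 =
  l`!%:R * (l.+1%:R * cesaro (1 - gam) l.+1) by ring.
have l2 : lam ^+ l != 0 by rewrite expf_neq0// lt0r_neq0.
by rewrite E; move: (lam ^+ l) l2 (lt0r_neq0 l0) => a a0 b0; field; rewrite a0 b0.
Qed.

End gamma_integral.

(** * Laplace moments of a bounded function *)

Lemma dominated_cvg_Rintegral d (T : measurableType d) (R : realType)
    (mu : {measure set T -> \bar R}) (D : set T) (mD : measurable D)
    (f_ : nat -> T -> R) (f G : T -> R) :
  (forall n, measurable_fun D (f_ n)) -> measurable_fun D f ->
  (forall x, D x -> f_ n x @[n --> \oo] --> f x) ->
  mu.-integrable D (EFin \o G) -> (forall n x, D x -> `|f_ n x| <= G x) ->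
  \int[mu]_(x in D) f_ n x @[n --> \oo] --> \int[mu]_(x in D) f x.
Proof.
move=> mf_ mf f_f iG fG.
have [||||| intf _ H] := @dominated_convergence _ _ _ mu D mD
    (fun n => EFin \o f_ n) (EFin \o f) (EFin \o G).
- by move=> n; exact/measurable_EFinP.
- exact/measurable_EFinP.
- by apply: aeW => x Dx; apply: cvg_EFin; [exact: nearW|exact: f_f].
- exact: iG.
- by apply: aeW => x n Dx; rewrite /= lee_fin fG.
apply: fine_cvg; rewrite fineK//; exact: integrable_fin_num.
Qed.

Section laplace_moments.
Context (R : realType) (g : R -> R) (B : R).
Local Notation mu := (@lebesgue_measure R).
Local Notation HL := (`]0%R, +oo[%classic : set R).
Hypothesis mg : measurable_fun HL g.
Hypothesis g0 : forall t : R, 0 < t -> 0 <= g t <= B.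
Implicit Types (t kap b : R).

Let mHL : measurable (HL : set (measurableTypeR R)).
Proof. exact: measurable_itv. Qed.

(** In the application g is t |-> G_t(x) for a fixed x. *)
Definition moment kap k : R := \int[mu]_(t in HL) (expR (- (kap * t)) * t ^+ k * g t).

Lemma integrable_expR_exprn kap k C : 0 < kap ->
  mu.-integrable HL (EFin \o (fun t => C * (t ^+ k * expR (- (kap * t))))).
Proof.
move=> k0; apply: integrable_mulr => //.
apply/integrableP; split.
  apply/measurable_EFinP; apply: measurable_funTS; apply: measurable_funM => //.
  by apply: measurableT_comp => //; apply: measurable_funN; exact: measurable_funM.
have := gint_lty (lt_le_trans (ltrN10 R) (ler0n R k)) k0.
rewrite /gint; congr (_ < _)%E; apply: eq_integral => t; rewrite inE => /half_lineP t0.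
rewrite /= powR_mulrn ?(ltW t0)// ger0_norm// mulr_ge0 ?expR_ge0// exprn_ge0// ltW//.
Qed.

Lemma measurable_moment kap k : measurable_fun HL (fun t => expR (- (kap * t)) * t ^+ k * g t).
Proof.
apply: measurable_funM => //; apply: measurable_funTS; apply: measurable_funM => //.
by apply: measurableT_comp => //; apply: measurable_funN; exact: measurable_funM.
Qed.

Lemma moment_bound kap k t : HL t ->
  `|expR (- (kap * t)) * t ^+ k * g t| <= B * (t ^+ k * expR (- (kap * t))).
Proof.
move=> /half_lineP t0; have /andP[gt0 gB] := g0 t0.
rewrite ger0_norm ?mulr_ge0 ?expR_ge0 ?exprn_ge0 ?(ltW t0)//.
rewrite mulrC [X in _ * X]mulrC ler_wpM2r//.
by rewrite mulr_ge0 ?expR_ge0 ?exprn_ge0 ?(ltW t0).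
Qed.

Lemma integrable_moment kap k : 0 < kap ->
  mu.-integrable HL (EFin \o (fun t => expR (- (kap * t)) * t ^+ k * g t)).
Proof.
move=> k0; apply: le_integrable (integrable_expR_exprn k B k0) => //.
  by apply/measurable_EFinP; exact: measurable_moment.
move=> t /[dup] /half_lineP t0 /(moment_bound kap k) H.
by rewrite /= lee_fin (le_trans H)// ler_norm.
Qed.

Lemma moment_ge0 kap k : 0 <= moment kap k.
Proof.
apply: Rintegral_ge0 => t /half_lineP t0; have /andP[gt0 gB] := g0 t0.
by rewrite ?mulr_ge0 ?expR_ge0 ?exprn_ge0 ?(ltW t0).
Qed.

Lemma series_exp_le_expR (x : R) n : 0 <= x -> series (exp_coeff x) n <= expR x.
Proof.
move=> x0; apply: nondecreasing_cvgn_le; last exact: is_cvg_series_exp_coeff.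
apply/nondecreasing_seqP => k; rewrite /series/= big_nat_recr//= lerDl.
by rewrite divr_ge0// exprn_ge0.
Qed.

(** Expanding e^(bt) under the integral sign; e^(-kap t + |b| t) dominates the
partial sums. *)
Lemma cvg_series_moment kap b l : 0 < kap -> `|b| < kap ->
  series (fun i => b ^+ i / i`!%:R * moment kap (l + i)) @ \oo --> moment (kap - b) l.
Proof.
move=> k0 bk; have kb : 0 < kap - `|b| by rewrite subr_gt0.
pose f_ n t := expR (- (kap * t)) * t ^+ l * g t * series (exp_coeff (b * t)) n.
have E n : \int[mu]_(t in HL) f_ n t =
    series (fun i => b ^+ i / i`!%:R * moment kap (l + i)) n.
  rewrite /series/= big_mkord.
  transitivity (\int[mu]_(t in HL) \sum_(i < n) (b ^+ i / i`!%:R *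
      (expR (- (kap * t)) * t ^+ (l + i) * g t))).
    apply: eq_Rintegral => t _; rewrite /f_ /series/= big_mkord mulr_sumr.
    apply: eq_bigr => i _; rewrite /exp_coeff/= exprMn exprD; ring.
  rewrite Rintegral_sum//; last first.
    by move=> i; apply: integrable_mulr => //; exact: integrable_moment.
  by apply: eq_bigr => i _; rewrite RintegralZl//; exact: integrable_moment.
rewrite -(funext E) /moment.
apply: (dominated_cvg_Rintegral mHL) (integrable_expR_exprn l B kb) _.
- move=> n; apply: measurable_funM; first exact: measurable_moment.
  apply: measurable_funTS; rewrite /series/=; apply: measurable_sum => i.
  apply: measurable_funM => //; apply: measurable_funX.
  exact: measurable_funM.
- exact: measurable_moment.
- move=> t /half_lineP t0; rewrite /f_.
  rewrite (_ : expR (- ((kap - b) * t)) * t ^+ l * g t =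
    expR (- (kap * t)) * t ^+ l * g t * expR (b * t)); last first.
    rewrite (_ : - ((kap - b) * t) = - (kap * t) + b * t); last by ring.
    by rewrite expRD; ring.
  by apply: cvgM; [exact: cvg_cst|exact: is_cvg_series_exp_coeff].
- move=> n t Ht; have t0 := half_lineP Ht; rewrite /f_ normrM.
  rewrite (_ : - ((kap - `|b|) * t) = - (kap * t) + `|b| * t); last by ring.
  rewrite expRD.
  rewrite [leRHS](_ : _ = B * (t ^+ l * expR (- (kap * t))) * expR (`|b| * t)); last by ring.
  apply: ler_pM => //; first exact: moment_bound.
  apply: le_trans (ler_norm_sum _ _ _) _.
  have bt0 : 0 <= `|b| * t by rewrite mulr_ge0// ltW.
  apply: le_trans (series_exp_le_expR n bt0); rewrite le_eqVlt; apply/orP; left; apply/eqP.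
  apply: eq_bigr => i _; rewrite /exp_coeff/= normrM normrX normrM (gtr0_norm t0).
  by congr (_ * _); rewrite ger0_norm// invr_ge0.
Qed.

(** Continuity of the Laplace transform, by domination at a lower bound kap0 of the
rates. *)
Lemma cvg_moment (kap_ : nat -> R) kap0 kap l : 0 < kap0 ->
  (forall n, kap0 <= kap_ n) -> kap_ @ \oo --> kap ->
  moment (kap_ n) l @[n --> \oo] --> moment kap l.
Proof.
move=> k0 kn kc; rewrite /moment.
apply: (dominated_cvg_Rintegral mHL) (integrable_expR_exprn l B k0) _.
- by move=> n; exact: measurable_moment.
- exact: measurable_moment.
- move=> t _; apply: cvgM; last exact: cvg_cst.
  apply: cvgM; last exact: cvg_cst.
  have cE : {for kap, continuous (fun y : R => expR (- (y * t)))}.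
    apply: continuous_comp; last exact: continuous_expR.
    by apply: cvgN; apply: cvgM; [exact: cvg_id|exact: cvg_cst].
  exact: continuous_cvg cE kc.
- move=> n t Ht; have t0 := half_lineP Ht; apply: le_trans (moment_bound _ _ Ht) _.
  have /andP[gt0 gB] := g0 t0.
  rewrite ler_wpM2l//; first exact: le_trans gB.
  rewrite ler_wpM2l//; first by rewrite exprn_ge0// ltW.
  by rewrite ler_expR lerN2 ler_wpM2r// ltW.
Qed.

End laplace_moments.

(** * Abel summation *)

Section abel.
Context (R : realType).
Implicit Types (a : nat -> R) (rho : R).

Lemma series_recr a n : series a n.+1 = series a n + a n.
Proof. by rewrite /series/= big_nat_recr. Qed.

Lemma series_abel_part a rho n : series (fun j => rho ^+ j * a j) n.+1 =
  rho ^+ n * series a n.+1 + (1 - rho) * \sum_(j < n) rho ^+ j * series a j.+1.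
Proof.
elim: n => [|n IH].
  by rewrite /series/= !big_nat1 big_ord0 expr0 mulr0 addr0.
rewrite (series_recr (fun j => rho ^+ j * a j) n.+1) IH (series_recr a n.+1) big_ord_recr/= exprS.
by ring.
Qed.

(** Abel's theorem, for damping factors tending to 1 along a sequence: summation
by parts writes the damped partial sums as averages of the undamped ones. *)
Lemma abel_limit a (A : nat -> R) (rho_ : nat -> R) :
  cvgn (series a) -> (forall k, 0 < rho_ k < 1) -> rho_ @ \oo --> (1 : R) ->
  (forall k, series (fun j => rho_ k ^+ j * a j) @ \oo --> A k) ->
  A @ \oo --> limn (series a).
Proof.
move=> ca rho01 rho1 cA; set S := limn _.
(* Subtracting S from the first term reduces to a series with sum 0. *)
pose a' j := a j - (j == 0%N)%:R * S.
have shift (u : nat -> R) n : u 0%N = 1 ->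
    series (fun j => u j * a' j) n.+1 = series (fun j => u j * a j) n.+1 - S.
  move=> u0; rewrite /series/= !big_nat_recl//= /a'/= u0 !mul1r addrAC.
  by congr (_ + _ - _); apply: eq_bigr => j _; rewrite mul0r subr0.
have shift1 n : series a' n.+1 = series a n.+1 - S.
  have := shift (fun=> 1) n erefl.
  by rewrite /series/=; under eq_bigr do rewrite mul1r; under [X in _ = X - _]eq_bigr do rewrite mul1r.
have d0 : series a n.+1 - S @[n --> \oo] --> (0 : R).
  rewrite -[X in _ --> X](subrr S); apply: cvgB; last exact: cvg_cst.
  by rewrite (@cvg_shiftS _ (series a)).
apply/cvgrPdist_le => e e0.
have e4 : 0 < e / 4 by rewrite divr_gt0.
have [J _ HJ] : \forall n \near \oo, `|series a n.+1 - S| <= e / 4.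
  by move/cvgrPdist_le : d0 => /(_ _ e4); under eq_near do rewrite sub0r normrN.
pose C := \sum_(j < J) `|series a j.+1 - S|.
have C0 : 0 <= C by exact: sumr_ge0.
have bnd k : `|S - A k| <= e / 2 + (1 - rho_ k) * C.
  have /andP[r0 r1] := rho01 k; set rho := rho_ k in r0 r1 *.
  have c : `|S - series (fun j => rho ^+ j * a j) n.+1| @[n --> \oo] --> `|S - A k|.
    apply: cvg_norm; apply: cvgB; first exact: cvg_cst.
    by rewrite (@cvg_shiftS _ (series (fun j => rho ^+ j * a j))); exact: cA.
  apply: (ler_cvg_to c (cvg_cst _)).
  exists J => // n /= Jn.
  rewrite distrC -shift// series_abel_part shift1.
  apply: le_trans (ler_normD _ _) _.
  have n1 : `|rho ^+ n * (series a n.+1 - S)| <= e / 4.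
    have rn : rho ^+ n <= 1 by apply: exprn_ile1; exact: ltW.
    rewrite normrM -[leRHS]mul1r (ger0_norm (exprn_ge0 _ (ltW r0))).
    by apply: ler_pM => //; [exact: exprn_ge0 _ (ltW r0)|exact: HJ].
  have n2 : `|(1 - rho) * \sum_(j < n) rho ^+ j * series a' j.+1| <= (1 - rho) * C + e / 4.
    have r10 : 0 <= 1 - rho by rewrite subr_ge0 ltW.
    rewrite normrM (ger0_norm r10).
    apply: (@le_trans _ _ ((1 - rho) * (C + e / 4 * \sum_(j < n) rho ^+ j))).
      rewrite ler_wpM2l//; apply: le_trans (ler_norm_sum _ _ _) _.
      rewrite mulr_sumr /C.
      rewrite (big_ord_widen _ (fun j => `|series a j.+1 - S|) Jn) [X in _ <= X + _]big_mkcond/=.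
      rewrite -big_split/=; apply: ler_sum => j _; rewrite normrM shift1.
      rewrite (ger0_norm (exprn_ge0 _ (ltW r0))).
      have rj : rho ^+ j <= 1 by apply: exprn_ile1; exact: ltW.
      case: ltnP => jJ.
        apply: ler_wpDr; first by rewrite mulr_ge0 ?exprn_ge0// ltW.
        by rewrite ler_piMl.
      by rewrite add0r mulrC ler_wpM2r ?exprn_ge0 ?(ltW r0)// HJ.
    rewrite mulrDr lerD2l// mulrCA ler_piMr ?(ltW e4)//.
    by rewrite -opprB mulNr -subrX1 opprB lerBlDr lerDl exprn_ge0// ltW.
  apply: le_trans (lerD n1 n2) _; lra.
have h : (1 - rho_ k) * C @[k --> \oo] --> (0 : R).
  rewrite -[X in _ --> X](mul0r C) -[X in X * C](subrr (1 : R)).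
  by apply: cvgM; [apply: cvgB; [exact: cvg_cst|]|exact: cvg_cst].
have e2 : 0 < e / 2 by rewrite divr_gt0.
move/cvgrPdist_le : h => /(_ _ e2); apply: filterS => k; rewrite sub0r normrN => hk.
apply: le_trans (bnd k) _.
have := le_trans (ler_norm _) hk; lra.
Qed.

End abel.

(** * Sums of binomial polynomials *)

Lemma cvg_sum_ord (R : realType) M (f : 'I_M -> nat -> R) (l : 'I_M -> R) :
  (forall i, f i @ \oo --> l i) -> \sum_(i < M) f i n @[n --> \oo] --> \sum_(i < M) l i.
Proof.
elim: M f l => [|M IH] f l fl.
  rewrite big_ord0; under eq_fun do rewrite big_ord0; exact: cvg_cst.
rewrite big_ord_recr/=; under eq_fun do rewrite big_ord_recr/=.
by apply: cvgD => //; apply: IH => i; exact: fl.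
Qed.

Section binomial_sums.
Context (R : realType).

(** The difference in j of a combination of binomial polynomials is one of lower
degree, with the coefficients shifted; so by induction all coefficients but the
first vanish, and then the sum is constant. *)
Lemma binomial_sum_cvg0 M (b : nat -> R) :
  \sum_(l < M) 'C(j, l)%:R * b l @[j --> \oo] --> (0 : R) ->
  forall l, (l < M)%N -> b l = 0.
Proof.
elim: M b => // M IH b cb.
have bS l : (l < M)%N -> b l.+1 = 0.
  apply: (IH (fun l => b l.+1)).
  have d : \sum_(l < M.+1) 'C(j.+1, l)%:R * b l - \sum_(l < M.+1) 'C(j, l)%:R * b l
      @[j --> \oo] --> (0 : R).
    rewrite -[X in _ --> X](subrr (0 : R)); apply: cvgB => //.
    by rewrite (@cvg_shiftS _ (fun j => \sum_(l < M.+1) 'C(j, l)%:R * b l)).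
  apply: cvg_trans d; apply: near_eq_cvg; near=> j.
  rewrite !big_ord_recl/= !bin0 opprD addrACA subrr add0r -sumrB.
  apply: eq_bigr => i _; rewrite /bump/= add1n binS natrD mulrDl.
  by ring.
have b0 : b 0%N = 0.
  apply: (@cvg_unique _ _ (\sum_(l < M.+1) 'C(j, l)%:R * b l @[j --> \oo])) => //.
  have -> : (fun j => \sum_(l < M.+1) 'C(j, l)%:R * b l) = cst (b 0%N).
    apply/funext => j; rewrite big_ord_recl/= bin0 mul1r big1 ?addr0// => i _.
    by rewrite bS ?mulr0.
  exact: cvg_cst.
by case=> [|l]//= lM; exact: bS.
Unshelve. all: by end_near. Qed.

End binomial_sums.

(** * Bounds on the Gaussian kernel *)

Section gaussian_bounds.
Context (R : realType) (N : nat) (x : 'rV[R]_N).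
Implicit Types t : R.

Definition sqnorm : R := \sum_(i < N) x ord0 i ^+ 2.

Lemma gaussianE t : gaussian t x = (4 * pi * t) `^ (- (N%:R / 2)) * expR (- sqnorm / (4 * t)).
Proof. by []. Qed.

Lemma sqnorm_ge0 : 0 <= sqnorm.
Proof. by apply: sumr_ge0 => i _; exact: sqr_ge0. Qed.

Lemma gaussian_ge0 t : 0 <= gaussian t x.
Proof. by rewrite gaussianE mulr_ge0 ?powR_ge0 ?expR_ge0. Qed.

Lemma pi4_ge1 : 1 <= 4 * pi :> R.
Proof. by have := @pihalf_ge1 R; lra. Qed.

Let N2 : (N%:R / 2 : R) <= N%:R.
Proof. by rewrite ler_pdivrMr// ler_peMr// ler1n. Qed.

(** Away from the origin the Gaussian kernel is bounded in time: as t tends to 0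
the exponential beats the power t^(-N/2).  This makes all the moments finite. *)
Lemma gaussian_le t : 0 < t -> 0 < sqnorm ->
  gaussian t x <= 1 + N`!%:R * 4 ^+ N / sqnorm ^+ N.
Proof.
move=> t0 S0; have p1 := pi4_ge1.
have B0 : 0 <= N`!%:R * 4 ^+ N / sqnorm ^+ N.
  by rewrite !mulr_ge0// invr_ge0 exprn_ge0// ltW.
have e1 : expR (- sqnorm / (4 * t)) <= 1.
  by rewrite -expR0 ler_expR mulNr oppr_le0 divr_ge0 ?mulr_ge0 ?ltW.
have n2 : 0 <= N%:R / 2 :> R by rewrite divr_ge0.
have [t1|t1] := leP 1 t.
  rewrite ler_wpDr// -[leRHS]mulr1 gaussianE ler_pM ?powR_ge0 ?expR_ge0//.
  rewrite powRN invf_le1 ?powR_gt0//; last by rewrite mulr_gt0// (lt_le_trans ltr01).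
  have h : 1 <= 4 * pi * t by rewrite -[leLHS]mulr1 ler_pM.
  by rewrite -[leLHS](powRr0 (4 * pi * t)) ler_powR.
rewrite ler_wpDl//.
have e2 : expR (- sqnorm / (4 * t)) <= N`!%:R / (sqnorm / (4 * t)) ^+ N.
  have y0 : 0 < sqnorm / (4 * t) by rewrite divr_gt0// mulr_gt0.
  have := expr_le_expR N (ltW y0); rewrite mulNr expRN => H.
  have f0 : 0 < N`!%:R :> R by rewrite ltr0n fact_gt0.
  by rewrite -[leRHS]invf_div lef_pV2// posrE ?expR_gt0// divr_gt0// exprn_gt0.
have e3 : (4 * pi * t) `^ (- (N%:R / 2)) <= (t ^+ N)^-1.
  rewrite powRN lef_pV2 ?posrE ?exprn_gt0 ?powR_gt0//; last first.
    by rewrite mulr_gt0// (lt_le_trans ltr01).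
  apply: (@le_trans _ _ (t `^ (N%:R / 2))).
    by rewrite -powR_mulrn ?(ltW t0)// ger_powR// t0 ltW.
  apply: ge0_ler_powR => //; rewrite ?nnegrE ?(ltW t0)//.
    by rewrite mulr_ge0 ?(ltW t0)// (le_trans ler01).
  by rewrite ler_peMl// ltW.
rewrite gaussianE; apply: le_trans (ler_pM _ _ e3 e2) _; rewrite ?powR_ge0 ?expR_ge0//.
rewrite !exprMn exprVn exprMn.
have tN : t ^+ N != 0 by rewrite expf_neq0// lt0r_neq0.
have sN : sqnorm ^+ N != 0 by rewrite expf_neq0// lt0r_neq0.
have fN : (4 : R) ^+ N != 0 by rewrite expf_neq0.
move: (t ^+ N) (sqnorm ^+ N) (4 ^+ N) tN sN fN => a b c a0 b0 c0.
by rewrite le_eqVlt; apply/orP; left; apply/eqP; field; rewrite a0 b0 c0.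
Qed.

(** The power t^(-N/2) decays more slowly than any exponential e^(-eps t), and
e^(-s/t) >= 1 - s/t with s = |x|^2/4; the resulting lower bound has explicit
moments. *)
Lemma gaussian_ge (eps : R) : 0 < eps ->
  exists2 kap : R, 0 < kap & forall t, 0 < t ->
  kap * (expR (- (eps * t)) * (1 - sqnorm / 4 / t)) <= gaussian t x.
Proof.
move=> e0; pose C := 1 + (4 * pi / eps) ^+ N * N`!%:R.
have p1 := pi4_ge1.
have C1 : 0 < C.
  rewrite ltr_wpDr// mulr_ge0// exprn_ge0// divr_ge0 ?(ltW e0)//.
  exact: le_trans p1.
(* (4 pi t)^(N/2) <= 1 + (4 pi t)^N <= C e^(eps t). *)
exists C^-1; first by rewrite invr_gt0.
move=> t t0.
have t4 : 0 < 4 * pi * t by rewrite mulr_gt0// (lt_le_trans ltr01).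
have [h|h] := leP (1 - sqnorm / 4 / t) 0.
  apply: le_trans (gaussian_ge0 _); rewrite mulr_ge0_le0 ?invr_ge0 ?(ltW C1)//.
  by rewrite mulr_ge0_le0 ?expR_ge0.
rewrite gaussianE mulrA ler_pM ?mulr_ge0 ?invr_ge0 ?expR_ge0 ?(ltW C1) ?(ltW h)//.
  rewrite expRN -invfM powRN lef_pV2 ?posrE ?powR_gt0 ?mulr_gt0 ?expR_gt0 ?pi_gt0//.
  have n2 : (0 <= (N%:R / 2 : R)) && ((N%:R / 2 : R) <= N%:R).
    by apply/andP; split; [rewrite divr_ge0|exact: N2].
  apply: le_trans (powR_le_1Dexprn (ltW t4) n2) _.
  rewrite /C [leRHS]mulrDl [1 * _]mul1r; apply: lerD.
    by rewrite -expR0 ler_expR mulr_ge0 ?ltW.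
  have et0 : 0 <= eps * t by rewrite mulr_ge0 ?ltW.
  have H := expr_le_expR N et0.
  have -> : (4 * pi * t) ^+ N = (4 * pi / eps) ^+ N * N`!%:R * ((eps * t) ^+ N / N`!%:R).
    have f0 : N`!%:R != 0 :> R by rewrite pnatr_eq0 -lt0n fact_gt0.
    have -> : 4 * pi * t = 4 * pi / eps * (eps * t).
      by have := lt0r_neq0 e0 => ?; field.
    rewrite [LHS]exprMn; move: (_ ^+ N) ((eps * t) ^+ N) (N`!%:R) f0 => a b f f0.
    by field.
  rewrite ler_wpM2l// mulr_ge0// exprn_ge0// divr_ge0 ?(ltW e0)//.
  exact: le_trans p1.
apply: le_trans (expR_ge1Dx _) _.
by rewrite ler_expR mulNr lerN2 invfM mulrA.
Qed.

Lemma continuous_gaussian t : 0 < t -> {for t, continuous (fun t => gaussian t x)}.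
Proof.
move=> t0; have p1 := pi4_ge1.
have t4 : 0 < 4 * pi * t by rewrite mulr_gt0// (lt_le_trans ltr01).
apply: cvgM.
  apply: (@continuous_comp _ _ _ (fun t => 4 * pi * t) (fun y => y `^ (- (N%:R / 2)))).
    by apply: cvgM; [exact: cvg_cst|exact: cvg_id].
  have d : derivable (fun y : R => y `^ (- (N%:R / 2))) (4 * pi * t) 1.
    by apply: derivable_powR; rewrite in_itv/= t4.
  by have /derivable1_diffP/differentiable_continuous := d.
apply: continuous_comp; last exact: continuous_expR.
apply: cvgM; first exact: cvg_cst.
apply: cvgV; first by rewrite lt0r_neq0// mulr_gt0.
by apply: cvgM; [exact: cvg_cst|exact: cvg_id].
Qed.

Lemma measurable_gaussian_t : measurable_fun (`]0%R, +oo[%classic : set R) (fun t => gaussian t x).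
Proof.
apply: open_continuous_measurable_fun; first exact: interval_open.
by move=> t; rewrite inE => /half_lineP; exact: continuous_gaussian.
Qed.

End gaussian_bounds.

(** * The fundamental solution and subordination *)

Section fundamental_solution_bound.
Context (R : realType) (N : nat) (alpha h r : R).
Local Notation mu := (@lebesgue_measure R).
Local Notation HL := (`]0%R, +oo[%classic : set R).
Hypothesis alpha01 : 0 < alpha < 1.
Hypothesis h0 : 0 < h.
Hypothesis r01 : 0 < r < 1.

Let c := h `^ (1 - alpha).

(** The rate lam of the exponential in the subordination formula. *)
Definition rate : R := h `^ (- alpha).

Let c_gt0 : 0 < c.
Proof. exact: powR_gt0. Qed.

Lemma rate_gt0 : 0 < rate.
Proof. exact: powR_gt0. Qed.

Let hrate : c = h * rate.
Proof. by rewrite /c /rate powRD ?lt0r_neq0 ?implybT// powRr1// ltW. Qed.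

(** The density psi_m of the random time at step n = m + 1: a mixture of the
Gamma distributions of integer shape l + 1 and rate lam with the weights
w(m,l). *)
Definition subord m t : R :=
  rate * expR (- (rate * t)) * \sum_(l < m.+1) (rate * t) ^+ l / l`!%:R * weight alpha m l.

Lemma subord_ge0 m t : 0 <= t -> 0 <= subord m t.
Proof.
move=> t0; have l0 := ltW rate_gt0.
rewrite mulr_ge0 ?mulr_ge0 ?expR_ge0//; apply: sumr_ge0 => l _.
by rewrite mulr_ge0 ?weight_ge0// divr_ge0// exprn_ge0// mulr_ge0.
Qed.

Lemma measurable_subord m (D : set R) : measurable_fun D (subord m).
Proof.
apply: measurable_funTS; apply: measurable_funM.
  apply: measurable_funM => //; apply: measurableT_comp => //.
  by apply: measurable_funN; exact: measurable_funM.
apply: measurable_sum => l; apply: measurable_funM => //; apply: measurable_funM => //.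
by apply: measurable_funX; exact: measurable_funM.
Qed.

(** The value of the Wright number in [Re_wright]. *)
Definition wright_coef m j : R := c * symbol alpha m ((1 - c *: 'X) ^+ j).

Lemma wright_coefE m j : wright_coef m j =
  \sum_(l < m.+1) 'C(j, l)%:R * c ^+ l.+1 * (1 - c) ^+ (j - l) * weight alpha m l.
Proof.
rewrite /wright_coef symbol_expansion mulr_sumr.
pose F l := 'C(j, l)%:R * c ^+ l.+1 * (1 - c) ^+ (j - l) * weight alpha m l.
transitivity (\sum_(l < j.+1) F l).
  by apply: eq_bigr => l _; rewrite /F exprS; ring.
transitivity (\sum_(l < maxn m.+1 j.+1) F l).
  rewrite (big_ord_widen _ F (leq_maxr m.+1 j.+1)) [LHS]big_mkcond/=.
  apply: eq_bigr => l _; case: ltnP => // jl.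
  by rewrite /F bin_small// !mul0r.
rewrite [RHS](big_ord_widen _ F (leq_maxl m.+1 j.+1)) [RHS]big_mkcond/=.
apply: eq_bigr => l _; case: ltnP => // jl.
by rewrite /F weight_eq0// mulr0.
Qed.

Variable x : 'rV[R]_N.
Hypothesis x0 : 0 < sqnorm x.
Let g t := gaussian t x.
Let B := 1 + N`!%:R * 4 ^+ N / sqnorm x ^+ N.

Let mg : measurable_fun HL g.
Proof. exact: measurable_gaussian_t. Qed.

Let g0 t : 0 < t -> 0 <= g t <= B.
Proof. by move=> t0; rewrite gaussian_ge0 gaussian_le. Qed.

Local Notation moment := (moment g).

Lemma Gamma_nat j : Gamma (j.+1%:R : R) = j`!%:R.
Proof.
rewrite /Gamma -natr1 addrK /Rintegral.
have := gint_nat j (@ltr01 R); rewrite expr1n divr1 => /(congr1 fine)/= <-.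
congr fine; rewrite /gint; apply: eq_integral => t _.
by rewrite mul1r.
Qed.

Lemma discrete_gaussianE j :
  discrete_gaussian j.+1 h x = (h ^+ j.+1 * j`!%:R)^-1 * moment h^-1 j.
Proof.
rewrite /discrete_gaussian Gamma_nat /moment; congr (_ * _).
by apply: eq_Rintegral => t _; rewrite mulNr [t / h]mulrC.
Qed.

Let a m j := wright_coef m j * ((h ^+ j.+1 * j`!%:R)^-1 * moment h^-1 j).

Lemma fundamental_solutionE n :
  fundamental_solution alpha h r n x = limn (series (a n.-1)).
Proof.
rewrite /fundamental_solution; congr (limn (series _)); apply/funext => j.
by rewrite (Re_wright _ _ _ h0 r01) discrete_gaussianE.
Qed.

(** The average of the heat kernel G_t(x) for the density [subord m], written
through the moments. *)
Definition subord_kernel m : R :=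
  rate * \sum_(l < m.+1) weight alpha m l * (rate ^+ l / l`!%:R * moment rate l).

Lemma subord_kernelE m :
  (subord_kernel m)%:E = (\int[mu]_(t in HL) (subord m t * gaussian t x)%:E)%E.
Proof.
have mHL : measurable (HL : set (measurableTypeR R)) by exact: measurable_itv.
have int l : mu.-integrable HL (EFin \o (fun t =>
    (rate * weight alpha m l * (rate ^+ l / l`!%:R)) * (expR (- (rate * t)) * t ^+ l * g t))).
  by apply: integrable_mulr => //; exact: (integrable_moment mg g0 _ rate_gt0).
have -> : subord_kernel m = \int[mu]_(t in HL) (subord m t * gaussian t x).
  rewrite /subord_kernel mulr_sumr.
  transitivity (\int[mu]_(t in HL) \sum_(l < m.+1)
      (rate * weight alpha m l * (rate ^+ l / l`!%:R)) * (expR (- (rate * t)) * t ^+ l * g t)).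
    rewrite Rintegral_sum//; apply: eq_bigr => l _.
    rewrite RintegralZl//; last exact: (integrable_moment mg g0 _ rate_gt0).
    by rewrite !mulrA.
  apply: eq_Rintegral => t _; rewrite /subord -/(g t) mulr_sumr mulr_suml.
  by apply: eq_bigr => l _; rewrite exprMn; ring.
rewrite /Rintegral fineK//; apply: integrable_fin_num => //.
have := @integrable_sum _ _ _ mu HL mHL _ (index_enum 'I_m.+1) xpredT _ (fun l _ => int l).
apply: eq_integrable => // t _; rewrite sumEFin; congr EFin.
rewrite /subord -/(g t) mulr_sumr mulr_suml.
by apply: eq_bigr => l _; rewrite exprMn; ring.
Qed.

Let abel_value m rho := rate * \sum_(l < m.+1) weight alpha m l *
   ((rate * rho) ^+ l / l`!%:R * moment (h^-1 - (1 - c) * rho / h) l).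

(** For |b| < 1/h with b = (1-c) rho / h the sum over j can be taken under the
integral sign.  It is here that c <= 2 is needed: it says |1-c| <= 1. *)
Lemma cvg_abel_value m rho : c <= 2 -> 0 < rho < 1 ->
  series (fun j => rho ^+ j * a m j) @ \oo --> abel_value m rho.
Proof.
move=> c2 /andP[rho0 rho1].
have hi : 0 < h^-1 by rewrite invr_gt0.
pose b := (1 - c) * rho / h.
have bh : `|b| < h^-1.
  rewrite /b normrM (gtr0_norm hi) gtr_pMl// normrM (gtr0_norm rho0).
  rewrite (le_lt_trans _ rho1)// ler_piMl ?(ltW rho0)//.
  by rewrite ler_norml; move: c2 c_gt0 => ? ?; lra.
pose u (l : 'I_m.+1) j := rho ^+ j * ('C(j, l)%:R * c ^+ l.+1 * (1 - c) ^+ (j - l) * weight alpha m l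
   * ((h ^+ j.+1 * j`!%:R)^-1 * moment h^-1 j)).
have -> : series (fun j => rho ^+ j * a m j) = (fun n => \sum_(l < m.+1) series (u l) n).
  apply/funext => n; rewrite /series/= exchange_big/=; apply: eq_bigr => j _.
  by rewrite /a wright_coefE mulr_suml mulr_sumr.
rewrite /abel_value mulr_sumr.
apply: cvg_sum_ord => l.
have H := @cvg_series_moment _ _ _ mg g0 _ _ (val l) hi bh.
(* The terms with j < l vanish, so the sum starts at j = l. *)
rewrite -(@cvg_shiftn (nat_of_ord l) _ (series (u l))).
have -> : (fun n => series (u l) (n + l)%N) = (fun n =>
   rate * (weight alpha m l * ((rate * rho) ^+ l / l`!%:R *
   series (fun i => b ^+ i / i`!%:R * moment h^-1 (l + i)) n))).
  apply/funext => n.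
  rewrite /series/= addnC (@big_cat_nat _ _ _ l)//= ?leq_addr// big1_seq ?add0r; last first.
    move=> j; rewrite mem_index_iota => /andP[_ jl].
    by rewrite /u bin_small// !mul0r mulr0.
  rewrite -{1}[nat_of_ord l]add0n big_addn addKn !mulr_sumr.
  apply: eq_bigr => i _; rewrite /u [(i + l)%N]addnC addKn.
  have lf : l`!%:R != 0 :> R by rewrite pnatr_eq0 -lt0n fact_gt0.
  have fi : i`!%:R != 0 :> R by rewrite pnatr_eq0 -lt0n fact_gt0.
  have -> : ('C(l + i, l)%:R : R) = (l + i)`!%:R / (l`!%:R * i`!%:R).
    have := congr1 (fun n => n%:R : R) (bin_fact (leq_addr i l)).
    by rewrite /= addKn !natrM => <-; rewrite mulfK// mulf_neq0.
  have ff : (l + i)`!%:R != 0 :> R by rewrite pnatr_eq0 -lt0n fact_gt0.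
  have -> : c ^+ l.+1 = h * rate * (h ^+ l * rate ^+ l) by rewrite exprS hrate exprMn.
  have -> : b ^+ i = (1 - c) ^+ i * rho ^+ i / h ^+ i by rewrite /b !exprMn exprVn.
  have -> : h ^+ (l + i).+1 = h * (h ^+ l * h ^+ i) by rewrite exprS exprD.
  have -> : rho ^+ (l + i) = rho ^+ l * rho ^+ i by rewrite exprD.
  rewrite [(rate * rho) ^+ l]exprMn.
  have hl : h ^+ l != 0 by rewrite expf_neq0// lt0r_neq0.
  have hi' : h ^+ i != 0 by rewrite expf_neq0// lt0r_neq0.
  have h00 := lt0r_neq0 h0.
  move: (h ^+ l) (h ^+ i) (l`!%:R) (i`!%:R) ((l + i)`!%:R) lf fi ff hl hi' => v1 v2 v3 v4 v5 e1 e2 e3 e4 e5.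
  by field; rewrite e1 e2 e3 e4 e5 h00.
apply: cvgM; first exact: cvg_cst.
apply: cvgM; first exact: cvg_cst.
by apply: cvgM; first exact: cvg_cst.
Qed.

(** By [abel_limit] a convergent series has the sum given by its Abel means, and
these tend to the subordinated kernel since h^-1 - (1-c) / h = rate. *)
Lemma fundamental_solution_abel n : c <= 2 -> cvgn (series (a n.-1)) ->
  fundamental_solution alpha h r n x = subord_kernel n.-1.
Proof.
move=> c2 ca; rewrite fundamental_solutionE; set m := n.-1.
pose rho_ (k : nat) : R := 1 - k.+2%:R^-1.
have rho01 k : 0 < rho_ k < 1.
  by rewrite subr_gt0 invf_lt1// ltr1n/= ltrBlDr ltrDl invr_gt0.
have rho1 : rho_ @ \oo --> (1 : R).
  rewrite -[X in _ --> X](subr0 1); apply: cvgB; first exact: cvg_cst.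
  by rewrite (@cvg_shiftS _ (fun k => k.+1%:R^-1 : R)); exact: cvg_harmonic.
have L := abel_limit ca rho01 rho1 (fun k => @cvg_abel_value m _ c2 (rho01 k)).
apply/esym; apply: (@cvg_unique _ _ _ _ _ _ _ L) => //.
rewrite /abel_value /subord_kernel.
apply: cvgM; first exact: cvg_cst.
apply: cvg_sum_ord => l; apply: cvgM; first exact: cvg_cst.
apply: cvgM.
  apply: cvgM; last exact: cvg_cst.
  have hc : rate * rho_ k @[k --> \oo] --> rate.
    by rewrite -[X in _ --> X]mulr1; apply: cvgM; first exact: cvg_cst.
  exact: (@cvg_comp _ _ _ (fun k => rate * rho_ k) (fun y : R => y ^+ l) _ _ _ hc
    (@exprn_continuous R l rate)).
(* A common lower bound for the rates 1/h - (1-c) rho_k / h. *)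
have k0 : 0 < Num.min c 1 / h by rewrite divr_gt0// lt_min c_gt0/=.
apply: (@cvg_moment _ _ _ mg g0 (fun k => h^-1 - (1 - c) * rho_ k / h) _ rate l k0).
  move=> k; have /andP[p0 p1] := rho01 k.
  rewrite -[leRHS]/(h^-1 - (1 - c) * rho_ k * h^-1) -[X in X - _]mul1r -mulrBl.
  rewrite ler_wpM2r ?invr_ge0 ?(ltW h0)// ge_min.
  have [c1|c1] := leP c 1; apply/orP; [left|right].
    have : (1 - c) * rho_ k <= 1 - c by rewrite ler_piMr ?subr_ge0// ltW.
    by lra.
  have : (1 - c) * rho_ k <= 0 by rewrite mulr_le0_ge0 ?subr_le0 ?ltW.
  by lra.
have -> : rate = h^-1 - (1 - c) * 1 / h.
  by rewrite hrate; have h00 := lt0r_neq0 h0; field.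
apply: cvgB; first exact: cvg_cst.
by apply: cvgM; last exact: cvg_cst; apply: cvgM; first exact: cvg_cst.
Qed.

Lemma Rintegral_exprn_expR (q : R) k : 0 < q ->
  \int[mu]_(t in HL) (t ^+ k * expR (- (q * t))) = k`!%:R / q ^+ k.+1.
Proof.
move=> q0; rewrite /Rintegral.
have := gint_nat k q0 => /(congr1 fine)/= <-; congr fine.
apply: eq_integral => t; rewrite inE => /half_lineP t0.
by rewrite powR_mulrn// ltW.
Qed.

(** The bound of [gaussian_ge] integrated against e^(-t/h) t^(j+1). *)
Lemma moment_lower (eps : R) : 0 < eps -> exists2 kap : R, 0 < kap &
  forall j, kap * (j.+1`!%:R / (h^-1 + eps) ^+ j.+2 -
     sqnorm x / 4 * (j`!%:R / (h^-1 + eps) ^+ j.+1)) <= moment h^-1 j.+1.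
Proof.
move=> e0; have [kap kap0 H] := gaussian_ge x e0; exists kap => // j.
have mHL : measurable (HL : set (measurableTypeR R)) by exact: measurable_itv.
have hi : 0 < h^-1 by rewrite invr_gt0.
set q := h^-1 + eps; have q0 : 0 < q by rewrite addr_gt0.
have i1 := integrable_expR_exprn j.+1 kap q0.
have i2 := integrable_expR_exprn j (kap * (sqnorm x / 4)) q0.
have i3 := integrable_moment mg g0 j.+1 hi.
have i12 : mu.-integrable HL (EFin \o (fun t => kap * (t ^+ j.+1 * expR (- (q * t))) -
    kap * (sqnorm x / 4) * (t ^+ j * expR (- (q * t))))).
  by apply: eq_integrable (integrableB mHL i1 i2) => // t _; rewrite /= EFinB.
have one k : mu.-integrable HL (EFin \o (fun t => (t ^+ k * expR (- (q * t))))).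
  by apply: eq_integrable (integrable_expR_exprn k 1 q0) => // t _; rewrite /= mul1r.
rewrite -!Rintegral_exprn_expR// mulrBr mulrA -!RintegralZl// -RintegralB//.
rewrite /moment -subr_ge0 -RintegralB//.
apply: Rintegral_ge0 => t /half_lineP t0; rewrite subr_ge0.
apply: (@le_trans _ _ (expR (- (h^-1 * t)) * t ^+ j.+1 *
   (kap * (expR (- (eps * t)) * (1 - sqnorm x / 4 / t))))); last first.
  by rewrite ler_wpM2l ?H// mulr_ge0 ?expR_ge0 ?exprn_ge0 ?(ltW t0).
rewrite /q (_ : - ((h^-1 + eps) * t) = - (h^-1 * t) + - (eps * t)); last by ring.
rewrite expRD exprS; have t00 := lt0r_neq0 t0.
by rewrite le_eqVlt; apply/orP; left; apply/eqP; field.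
Qed.

(** For c > 2 the term of index j is c (1-c)^j P(j) times a discrete Gaussian, with
P a combination of binomial polynomials.  By [moment_lower], with eps chosen so
that 1/h + eps = (c-1)/h, the discrete Gaussian is at least of order
(c-1)^(-j); so terms tending to 0 force P(j) to tend to 0, against
[binomial_sum_cvg0] and w(m,0) > 0. *)
Lemma series_diverges m : 2 < c -> ~ cvgn (series (a m)).
Proof.
move=> c2 /cvg_series_cvg_0 ca.
have e0 : 0 < (c - 2) / h by rewrite divr_gt0// subr_gt0.
have [kap kap0 low] := moment_lower e0.
have q0 : 0 < c - 1 by lra.
(* The value of eps for which the rate 1/h + eps becomes (c-1)/h. *)
have qE : h^-1 + (c - 2) / h = (c - 1) / h by have h00 := lt0r_neq0 h0; field.
rewrite qE in low.
pose P j := \sum_(l < m.+1) 'C(j, l)%:R * ((c / (1 - c)) ^+ l * weight alpha m l).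
have c10 : 1 - c != 0 by rewrite -opprB oppr_eq0 lt0r_neq0.
have coefP j : (m <= j)%N -> wright_coef m j = c * (1 - c) ^+ j * P j.
  move=> mj; rewrite wright_coefE mulr_sumr; apply: eq_bigr => l _.
  have lj : (l <= j)%N by rewrite (leq_trans _ mj)// -ltnS.
  have -> : (1 - c) ^+ j = (1 - c) ^+ (j - l) * (1 - c) ^+ l by rewrite -exprD subnK.
  rewrite exprMn exprVn exprS.
  have cl : (1 - c) ^+ l != 0 by rewrite expf_neq0.
  by move: ((1 - c) ^+ l) cl => v v0; field.
suff PJ : P j @[j --> \oo] --> (0 : R).
  have := @binomial_sum_cvg0 R m.+1
    (fun l => (c / (1 - c)) ^+ l * weight alpha m l) PJ 0%N (ltn0Sn m).
  rewrite expr0 mul1r weight0 => /eqP; rewrite gt_eqF// cesaro_gt0//.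
  by rewrite subr_gt0; case/andP: alpha01.
(* K is the inverse of the constant by which the j-th term dominates |P j|. *)
pose K := 2 * (c - 1) / (c * kap).
have K0 : 0 < K by rewrite divr_gt0 ?mulr_gt0.
have KPJ : K * `|a m j.+1| @[j --> \oo] --> (0 : R).
  rewrite -[X in _ --> X](mulr0 K); apply: cvgM; first exact: cvg_cst.
  by rewrite (@cvg_shiftS _ (fun j => `|a m j|)); apply/norm_cvg0P.
rewrite -(@cvg_shiftS _ P); apply/norm_cvg0P.
apply: (squeeze_cvgr _ (cvg_cst 0) KPJ); near=> j; rewrite normr_ge0/=.
have mj : (m <= j.+1)%N by rewrite leqW//; near: j; exact: nbhs_infty_ge.
have jl : sqnorm x / 4 * ((c - 1) / h) * 2 <= j.+1%:R.
  apply: (@le_trans _ _ j%:R); last by rewrite ler_nat.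
  by near: j; exact: nbhs_infty_ger.
have S0 := sqnorm_ge0 x.
have Q0 : 0 < (c - 1) / h by rewrite divr_gt0.
have f0 : 0 < j`!%:R :> R by rewrite ltr0n fact_gt0.
have lowj : kap / 2 * (j.+1`!%:R / ((c - 1) / h) ^+ j.+2) <= moment h^-1 j.+1.
  apply: le_trans (low j); rewrite -mulrA ler_wpM2l ?(ltW kap0)//.
  rewrite factS natrM [_ ^+ j.+2]exprS.
  have QS : 0 < ((c - 1) / h) ^+ j.+1 by exact: exprn_gt0.
  have -> : j.+1%:R * j`!%:R / ((c - 1) / h * ((c - 1) / h) ^+ j.+1) =
     (j.+1%:R / ((c - 1) / h)) * (j`!%:R / ((c - 1) / h) ^+ j.+1).
    by rewrite invfM; ring.
  rewrite [leLHS]mulrA -[leRHS]mulrBl ler_wpM2r//; first by rewrite divr_ge0// ltW.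
  have : sqnorm x / 4 * 2 <= j.+1%:R / ((c - 1) / h).
    by rewrite ler_pdivlMr// mulrAC.
  by lra.
rewrite /a coefP// !normrM normrX.
have -> : `|1 - c| = c - 1 by rewrite distrC gtr0_norm.
rewrite (gtr0_norm c_gt0) (ger0_norm (moment_ge0 g0 _ _)).
have f1 : 0 < j.+1`!%:R :> R by rewrite ltr0n fact_gt0.
have hS : 0 < h ^+ j.+2 by exact: exprn_gt0.
rewrite (@gtr0_norm _ (_^-1)); last by rewrite invr_gt0 mulr_gt0.
have cS : 0 < (c - 1) ^+ j.+1 by exact: exprn_gt0.
apply: (@le_trans _ _ (K * (c * (c - 1) ^+ j.+1 * `|P j.+1| *
   ((h ^+ j.+2 * j.+1`!%:R)^-1 * (kap / 2 * (j.+1`!%:R / ((c - 1) / h) ^+ j.+2)))))).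
  rewrite /K exprMn exprVn [(c - 1) ^+ j.+2]exprS.
  move: (h ^+ j.+2) hS (j.+1`!%:R) f1 ((c - 1) ^+ j.+1) cS `|P j.+1| => v1 e1 v2 e2 v3 e3 v4.
  have d1 := lt0r_neq0 e1; have d2 := lt0r_neq0 e2; have d3 := lt0r_neq0 e3.
  have d4 := lt0r_neq0 q0; have d5 := lt0r_neq0 c_gt0; have d6 := lt0r_neq0 kap0.
  by rewrite le_eqVlt; apply/orP; left; apply/eqP; field; rewrite d1 d2 d3 d4 d5 d6.
rewrite ler_wpM2l ?(ltW K0)// ler_wpM2l//.
  by rewrite !mulr_ge0// ltW.
by rewrite ler_wpM2l// invr_ge0 mulr_ge0 ?ltW.
Unshelve. all: by end_near. Qed.

(** Equality holds when the series converges; otherwise the left-hand side is 0. *)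
Lemma fundamental_solution_le n : (`|fundamental_solution alpha h r n x|%:E <=
  \int[mu]_(t in HL) (subord n.-1 t * gaussian t x)%:E)%E.
Proof.
rewrite -subord_kernelE lee_fin.
have K0 : 0 <= subord_kernel n.-1.
  apply: mulr_ge0; first exact: ltW rate_gt0.
  apply: sumr_ge0 => l _; rewrite mulr_ge0 ?weight_ge0// mulr_ge0//.
    by rewrite divr_ge0// exprn_ge0// ltW// rate_gt0.
  exact: (moment_ge0 g0).
have [ca|nca] := pselect (cvgn (series (a n.-1))).
  have [c2|c2] := leP c 2; last by have := series_diverges c2 ca.
  by rewrite fundamental_solution_abel// ger0_norm.
by rewrite fundamental_solutionE (dvgP nca) normr0.
Qed.

End fundamental_solution_bound.

(** * Comparison and convexity for integrals *)

Section integral_bounds.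
Import HBNNSimple.
Context d (T : measurableType d) (R : realType).
Variable mu : {measure set T -> \bar R}.
Local Open Scope ereal_scope.

(** The integral of a non-negative function is the supremum of the integrals of
the simple functions below it, so comparison needs no measurability.  This
spares a proof that the fundamental solution is measurable. *)
Lemma le_integral_ae (A : set T) (f g : T -> \bar R) :
  measurable A -> mu A = 0 -> (forall x, 0 <= f x) -> (forall x, 0 <= g x) ->
  (forall x, ~ A x -> f x <= g x) -> \int[mu]_x f x <= \int[mu]_x g x.
Proof.
move=> mA A0 f0 g0 fg; rewrite !ge0_integralTE//.
apply: ge_ereal_sup => _ [k kf <-].
rewrite -integralT_nnsfun (ge0_negligible_integral mA)//=; last first.
- by move=> x _; rewrite lee_fin; exact: fun_ge0.
- exact/measurable_EFinP.
rewrite integral_mkcond ge0_integralTE; last first.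
  by move=> x; rewrite patchE; case: ifP => // _; rewrite lee_fin; exact: fun_ge0.
apply: ge_ereal_sup => _ [k' kf' <-].
apply: ereal_sup_ubound; exists k' => // x; apply: le_trans (kf' x) _.
rewrite patchE; case: ifPn => // /set_mem [_ Ax].
by apply: le_trans (fg x Ax); exact: kf.
Qed.

Lemma le_integral_ge0 (f g : T -> \bar R) : (forall x, 0 <= f x) ->
  (forall x, f x <= g x) -> \int[mu]_x f x <= \int[mu]_x g x.
Proof.
move=> f0 fg; apply: (@le_integral_ae set0) => //.
by move=> x; exact: le_trans (fg x).
Qed.

(** The finite part of a difference of non-negative extended reals is bounded by
the larger of the two, whether or not the difference makes sense. *)
Lemma abs_Rintegral_le (v : T -> R) :
  `|\int[mu]_x v x|%R%:E <= \int[mu]_x `|v x|%R%:E.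
Proof.
rewrite /Rintegral integralE.
set a := integral _ _ _; set b := integral _ _ _; set c := integral _ _ _.
have a0 : 0 <= a by exact: integral_ge0.
have b0 : 0 <= b by exact: integral_ge0.
have ac : a <= c.
  apply: le_integral_ge0 => x; first exact: funepos_ge0.
  by rewrite funeposE -EFin_max lee_fin ge_max normr_ge0 ler_norm.
have bc : b <= c.
  apply: le_integral_ge0 => x; first exact: funeneg_ge0.
  by rewrite funenegE -EFinN -EFin_max lee_fin ge_max normr_ge0 -normrN ler_norm.
clearbody a b c; case: a a0 ac => [a||]//; case: b b0 bc => [b||]//.
- case: c => [c||]//=; rewrite ?leey// !lee_fin => b0 bc a0 ac.
  by rewrite ler_norml; apply/andP; split; lra.
- by move=> /= b0 bc a0 ac; rewrite normr0; apply: le_trans bc.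
- by move=> /= b0 bc a0 ac; rewrite normr0; apply: le_trans ac.
- by move=> /= b0 bc a0 ac; rewrite normr0; apply: le_trans ac.
Qed.

(** Hoelder's inequality for the factorization
w a = (w^(1/p) a) w^(1 - 1/p). *)
Lemma jensen_powR (p : R) (w a : T -> R) : (1 <= p)%R ->
  (forall x, 0 <= w x)%R -> (forall x, 0 <= a x)%R ->
  measurable_fun setT w -> measurable_fun setT a ->
  \int[mu]_x (w x * a x)%:E <=
  (\int[mu]_x (w x * a x `^ p)%:E) `^ p^-1 * (\int[mu]_x (w x)%:E) `^ (1 - p^-1).
Proof.
move=> p1 w0 a0 mw ma.
have p0 : (0 < p)%R by exact: lt_le_trans p1.
have [->|pn1] := eqVneq p 1%R.
  rewrite invr1 subrr poweRe0 mule1 poweRe1; last first.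
    by apply: integral_ge0 => x _; rewrite lee_fin mulr_ge0// powR_ge0.
  by under [leRHS]eq_integral do rewrite powRr1//.
have p1' : (1 < p)%R by rewrite lt_neqAle eq_sym pn1.
pose p' := (1 - p^-1)^-1%R.
have ip : (0 < 1 - p^-1)%R by rewrite subr_gt0 invf_lt1.
have p'0 : (0 < p')%R by rewrite invr_gt0.
have pp' : (p^-1 + p'^-1 = 1)%R by rewrite /p' invrK addrC subrK.
pose f x := (w x `^ p^-1 * a x)%R.
pose g x := (w x `^ p'^-1)%R.
have mf : measurable_fun setT f.
  by apply: measurable_funM => //; exact: measurableT_comp (measurable_powR _) mw.
have mg : measurable_fun setT g by exact: measurableT_comp (measurable_powR _) mw.
have := hoelder mu mf mg p0 p'0 pp'.
rewrite Lnorm1 !unlock /=.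
congr (_ <= _).
  apply: eq_integral => x _ /=; rewrite ger0_norm ?mulr_ge0 ?powR_ge0//.
  rewrite /f /g mulrAC -powRD ?pp' ?powRr1//.
  by rewrite oner_eq0.
congr (_ * _).
  congr (_ `^ _); apply: eq_integral => x _ /=.
  rewrite ger0_norm ?mulr_ge0 ?powR_ge0// /f powRM ?powR_ge0//.
  by rewrite -powRrM mulVf ?lt0r_neq0// powRr1.
rewrite /p' invrK; congr (_ `^ _); apply: eq_integral => x _ /=.
by rewrite ger0_norm ?powR_ge0// /g -powRrM mulVf ?lt0r_neq0// powRr1.
Qed.

End integral_bounds.

(** * The mass of the Gaussian kernel *)

Section gaussian_mass.
Context (R : realType).
Local Open Scope ereal_scope.

(** Tonelli's theorem, one coordinate at a time. *)
Lemma integral_lebesgue_rV_prod N (g : 'I_N -> R -> R) :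
  (forall i s, 0 <= g i s)%R -> (forall i, measurable_fun setT (g i)) ->
  \int[lebesgue_rV R N]_y (\prod_(i < N) g i (y ord0 i))%:E =
  \prod_(i < N) \int[lebesgue_measure]_s (g i s)%:E.
Proof.
elim: N g => [|n IH] g g0 mg.
  rewrite big_ord0; under eq_integral do rewrite big_ord0.
  by rewrite /= integral_dirac//= diracT mul1e.
rewrite big_ord_recl.
pose F (y : 'rV[R]_n.+1) : \bar R := (\prod_(i < n.+1) g i (y ord0 i))%:E.
have mprod m (k : 'I_m -> R -> R) : (forall i, measurable_fun setT (k i)) ->
    measurable_fun [set: 'rV[R]_m] (fun y => \prod_(i < m) k i (y ord0 i))%R.
  move=> mk; apply: measurable_prod => i _.
  by apply: (measurableT_comp (mk i)); exact: measurable_rV_coor.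
have mF : measurable_fun setT F by apply/measurable_EFinP; exact: mprod.
have F0 y : 0 <= F y by rewrite lee_fin prodr_ge0.
transitivity (\int[pushforward (@lebesgue_measure R \x lebesgue_rV R n) (@rV_cons R n)]_y F y).
  reflexivity.
have mc := @measurable_rV_cons R n.
rewrite (ge0_integral_pushforward mc)//= preimage_setT fubini_tonelli1/=; last 2 first.
- exact: measurableT_comp mF mc.
- by move=> p; exact: F0.
rewrite /fubini_F.
under eq_integral => s _.
  under eq_integral => y _.
    rewrite /F /= big_ord_recl rV_cons0/= EFinM.
    under eq_bigr do rewrite rV_consS/=.
    over.
  rewrite ge0_integralZl//; last 3 first.
  - by apply/measurable_EFinP; exact: (mprod _ (fun i => g (lift ord0 i))).
  - by move=> y _; rewrite lee_fin prodr_ge0.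
  - by rewrite lee_fin.
  rewrite (IH (fun i => g (lift ord0 i)))//.
  over.
rewrite ge0_integralZr//.
- by apply/measurable_EFinP; exact: mg.
- by move=> s _; rewrite lee_fin.
- by apply: prode_ge0 => i _; apply: integral_ge0 => s _; rewrite lee_fin.
Qed.

(** The heat kernel at time t is a product of normal densities of variance 2 t. *)
Lemma gaussian_prod N (t : R) (x y : 'rV[R]_N) : (0 < t)%R ->
  gaussian t (x - y) = (\prod_(i < N) normal_pdf (x ord0 i) (Num.sqrt (2 * t)) (y ord0 i))%R.
Proof.
move=> t0.
have s0 : Num.sqrt (2 * t) != 0%R :> R by rewrite lt0r_neq0// sqrtr_gt0 mulr_gt0.
have s2 : (Num.sqrt (2 * t) ^+ 2 = 2 * t)%R by rewrite sqr_sqrtr// mulr_ge0// ltW.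
under eq_bigr do rewrite normal_pdfE//.
rewrite big_split/= prodr_const card_ord /normal_peak s2.
have -> : ((2 * t) * pi *+ 2 = 4 * pi * t)%R by rewrite mulr2n; ring.
rewrite gaussianE -powR12_sqrt; last by rewrite !mulr_ge0 ?pi_ge0 ?ltW.
rewrite -powRN -powR_mulrn ?powR_ge0// -powRrM; congr (_ `^ _ * _)%R; first by ring.
rewrite /normal_fun -expR_sum s2; congr expR.
rewrite mulNr /sqnorm mulr_suml -sumrN; apply: eq_bigr => i _.
rewrite !mxE; have -> : (2 * t *+ 2 = 4 * t)%R by rewrite mulr2n; ring.
by rewrite mulNr -[in RHS]sqrrN opprB.
Qed.

Lemma integral_gaussian N (t : R) (x : 'rV[R]_N) : (0 < t)%R ->
  \int[lebesgue_rV R N]_y (gaussian t (x - y))%:E = 1.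
Proof.
move=> t0; under eq_integral do rewrite gaussian_prod//.
rewrite (integral_lebesgue_rV_prod (g := fun i => normal_pdf (x ord0 i) (Num.sqrt (2 * t)%R))).
- by rewrite big1// => i _; exact: integral_normal_pdf.
- by move=> i s; exact: normal_pdf_ge0.
- by move=> i; exact: measurable_normal_pdf.
Qed.

Lemma gaussian_sym N (t : R) (x y : 'rV[R]_N) : gaussian t (x - y) = gaussian t (y - x).
Proof.
rewrite !gaussianE (_ : sqnorm (x - y) = sqnorm (y - x))//.
by apply: eq_bigr => i _; rewrite !mxE -sqrrN opprB.
Qed.

(** Stated along measurable maps, so that it gives measurability in the space and
time variables jointly. *)
Lemma measurable_gaussian N d (T : measurableType d) (t : T -> R) (z : T -> 'rV[R]_N) :
  measurable_fun setT t ->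
  (forall i, measurable_fun setT (fun w => z w ord0 i)) ->
  measurable_fun setT (fun w => gaussian (t w) (z w)).
Proof.
move=> mt mz.
have minv (s : T -> R) : measurable_fun setT s -> measurable_fun setT (fun w => (s w)^-1%R).
  move=> ms.
  have -> : (fun w => (s w)^-1)%R = (fun w => s w * (s w ^+ 2) `^ (-1))%R.
    apply/funext => w; have [->|s0] := eqVneq (s w) 0%R.
      by rewrite mul0r invr0.
    by rewrite powR_inv1 ?sqr_ge0// expr2 invfM mulrA divff// mul1r.
  apply: measurable_funM => //; apply: (measurableT_comp (measurable_powR _)).
  exact: measurable_funX.
have mt4 (c : R) : measurable_fun setT (fun w => c * t w)%R by exact: measurable_funM.
apply: measurable_funM.
  exact: (measurableT_comp (measurable_powR _) (mt4 _)).
apply: (measurableT_comp (@measurable_expR R)); apply: measurable_funM.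
  apply: measurableT_comp => //; apply: measurable_sum => i.
  exact: measurable_funX.
exact: minv.
Qed.

End gaussian_mass.

(** * Averages over a random time *)

(** The setting is a family of kernels k t x y, indexed by a time t, that are
probability densities in y and in x and bounded by B t, with a density w of the
random time. *)
Section subordination.
Context d1 d2 (T : measurableType d1) (X : measurableType d2) (R : realType).
Variables (nu : {sigma_finite_measure set T -> \bar R})
          (mu : {sigma_finite_measure set X -> \bar R}).
Variables (w B : T -> R) (k : T -> X -> X -> R) (f : X -> R).
Hypotheses (w0 : forall t, 0 <= w t) (B0 : forall t, 0 <= B t).
Hypotheses (k0 : forall t x y, 0 <= k t x y) (kB : forall t x y, k t x y <= B t).
Hypotheses (mw : measurable_fun setT w) (mB : measurable_fun setT B).
Hypothesis mk : measurable_fun setT (fun z : T * (X * X) => k z.1 z.2.1 z.2.2).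
Hypothesis mf : measurable_fun setT f.
Hypotheses (k1 : forall t x, (\int[mu]_y (k t x y)%:E = 1)%E)
           (k2 : forall t y, (\int[mu]_x (k t x y)%:E = 1)%E).
Local Open Scope ereal_scope.

Definition subordinated x := \int[mu]_y ((\int[nu]_t (w t * k t x y)%:E) * `|f y|%:E).

Let mkcomp d (S : measurableType d) (a : S -> T) (b c : S -> X) :
  measurable_fun setT a -> measurable_fun setT b -> measurable_fun setT c ->
  measurable_fun setT (fun s => k (a s) (b s) (c s)).
Proof.
move=> ma mb mc.
apply: (measurableT_comp (f := fun z : T * (X * X) => k z.1 z.2.1 z.2.2) (g := fun s => (a s, (b s, c s)))) => //.
by apply/measurable_fun_pair => //; exact/measurable_fun_pair.
Qed.

Let mnf : measurable_fun setT (fun y => `|f y|%R).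
Proof. exact: measurableT_comp. Qed.

Let average (g : X -> R) t x := \int[mu]_y (k t x y * g y)%:E.

Let average_ge0 g t x : (forall y, 0 <= g y)%R -> 0 <= average g t x.
Proof. by move=> g0; apply: integral_ge0 => y _; rewrite lee_fin mulr_ge0. Qed.

Lemma subordinatedE x :
  subordinated x = \int[nu]_t ((w t)%:E * average (fun y => `|f y|%R) t x).
Proof.
rewrite /subordinated.
transitivity (\int[mu]_y \int[nu]_t (w t * k t x y * `|f y|)%:E).
  apply: eq_integral => y _; rewrite -ge0_integralZr//.
  - apply/measurable_EFinP; apply: measurable_funM => //.
    exact: mkcomp.
  - by move=> t _; rewrite lee_fin mulr_ge0.
rewrite (fubini_tonelli (fun z : X * T => (w z.2 * k z.2 x z.1 * `|f z.1|)%:E)).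
- apply: eq_integral => t _; rewrite -ge0_integralZl//.
  + by apply: eq_integral => y _; rewrite -EFinM mulrA.
  + apply/measurable_EFinP; apply: measurable_funM => //; exact: mkcomp.
  + by move=> y _; rewrite lee_fin mulr_ge0.
  + by rewrite lee_fin.
- apply/measurable_EFinP; apply: measurable_funM.
    apply: measurable_funM; first exact: measurableT_comp.
    exact: mkcomp.
  exact: measurableT_comp mnf _.
- by move=> z; rewrite lee_fin !mulr_ge0.
Qed.

Lemma subordinated_le_ess_sup (L : R) x : (0 <= L)%R ->
  (\forall y \ae mu, `|f y| <= L)%R ->
  subordinated x <= (\int[nu]_t (w t)%:E) * L%:E.
Proof.
move=> L0 [A [mA A0 fA]]; rewrite subordinatedE -ge0_integralZr//; last first.
- by move=> t _; rewrite lee_fin.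
- exact/measurable_EFinP.
apply: le_integral_ge0 => t.
  by rewrite mule_ge0 ?lee_fin ?average_ge0.
rewrite lee_wpmul2l ?lee_fin//.
rewrite -[leRHS]mul1e -(k1 t x) -ge0_integralZr//; last first.
- by move=> y _; rewrite lee_fin.
- by apply/measurable_EFinP; exact: mkcomp.
apply: (le_integral_ae mA A0) => y.
- by rewrite lee_fin mulr_ge0.
- by rewrite mule_ge0 ?lee_fin.
- move=> Ay; rewrite -EFinM lee_fin ler_wpM2l//; apply: contrapT => fL.
  by apply: Ay; apply: fA.
Qed.

Section powers.
Variables (q M : R).
Hypotheses (q1 : (1 <= q)%R) (M0 : (0 <= M)%R)
  (fM : \int[mu]_y (`|f y| `^ q)%:E = M%:E).

Let q0 : (0 < q)%R. Proof. exact: lt_le_trans q1. Qed.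

Let fq y : R := (`|f y| `^ q)%R.

Let fq0 y : (0 <= fq y)%R. Proof. exact: powR_ge0. Qed.

Let mfq : measurable_fun setT fq.
Proof. exact: measurableT_comp (measurable_powR _) mnf. Qed.

Let average_jensen t x :
  average (fun y => `|f y|%R) t x <= average fq t x `^ q^-1.
Proof.
apply: le_trans (@jensen_powR _ _ _ _ q (k t x) (fun y => `|f y|%R) _ _ _ _ _) _ => //.
  exact: mkcomp.
by rewrite k1 poweR_EFin powR1 mule1.
Qed.

Let average_le t x : average fq t x <= (B t * M)%:E.
Proof.
rewrite EFinM -fM -ge0_integralZl//; last first.
- by rewrite lee_fin.
- exact/measurable_EFinP.
apply: le_integral_ge0 => y; first by rewrite lee_fin mulr_ge0.
by rewrite -EFinM lee_fin ler_wpM2r.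
Qed.

Let j t x : R := fine (average fq t x).

Let averageE t x : average fq t x = (j t x)%:E.
Proof.
rewrite fineK// ge0_fin_numE ?average_ge0//.
by apply: le_lt_trans (average_le t x) _; rewrite ltry.
Qed.

Let j0 t x : (0 <= j t x)%R.
Proof. by rewrite -lee_fin -averageE average_ge0. Qed.

Let jB t x : (j t x <= B t * M)%R.
Proof. by rewrite -lee_fin -averageE average_le. Qed.

Let mj : measurable_fun setT (fun z : X * T => j z.2 z.1).
Proof.
apply: measurableT_comp; first exact: fine_measurable.
have -> : (fun z : X * T => average fq z.2 z.1) =
    fubini_F mu (fun z : (X * T) * X => (k z.1.2 z.1.1 z.2 * fq z.2)%:E) by [].
apply: measurable_fun_fubini_tonelli_F.
  apply/measurable_EFinP; apply: measurable_funM.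
    by apply: mkcomp => //; apply: measurableT_comp.
  exact: measurableT_comp mfq _.
by move=> z; rewrite lee_fin mulr_ge0.
Qed.

Let subordinated_le_j x :
  subordinated x <= \int[nu]_t (w t * j t x `^ q^-1)%:E.
Proof.
rewrite subordinatedE; apply: le_integral_ge0 => t.
  by rewrite mule_ge0 ?lee_fin ?average_ge0.
rewrite EFinM lee_wpmul2l ?lee_fin//.
by apply: le_trans (average_jensen t x) _; rewrite averageE poweR_EFin.
Qed.

(** The bound J_t <= B t * M is used for the whole power J_t^(1/q). *)
Lemma subordinated_le_pinfty x :
  subordinated x <= (\int[nu]_t (w t * B t `^ q^-1)%:E) * (M `^ q^-1)%:E.
Proof.
apply: le_trans (subordinated_le_j x) _.
rewrite -ge0_integralZr//; last 3 first.
- apply/measurable_EFinP; apply: measurable_funM => //.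
  exact: measurableT_comp (measurable_powR _) mB.
- by move=> t _; rewrite lee_fin mulr_ge0 ?powR_ge0.
- by rewrite lee_fin powR_ge0.
apply: le_integral_ge0 => t; first by rewrite lee_fin mulr_ge0 ?powR_ge0.
rewrite -EFinM lee_fin -mulrA ler_wpM2l// -powRM//.
by apply: ge0_ler_powR; rewrite ?nnegrE ?mulr_ge0// invr_ge0 ltW.
Qed.

(** Jensen in space bounds the average of |f| at time t by J_t^(1/q), where J_t is
the average of |f|^q.  From J_t <= B t * M one factor J_t^(1/q - 1/p) is
estimated by a constant times B t^(1/q - 1/p), which goes into the time measure
v; Jensen in time for the remaining J_t^(1/p), and the integral in x of J_t is M. *)
Lemma subordinated_le_finite (p W : R) : (q <= p)%R -> (0 <= W)%R ->
  \int[nu]_t (w t * B t `^ (q^-1 - p^-1))%:E = W%:E ->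
  (\int[mu]_x subordinated x `^ p) `^ p^-1 <= (W * M `^ q^-1)%:E.
Proof.
move=> qp W0 vW.
have p0 : (0 < p)%R by exact: lt_le_trans qp.
have p1 : (1 <= p)%R by exact: le_trans qp.
have pn0 : p != 0%R by exact: lt0r_neq0.
pose e : R := (q^-1 - p^-1)%R.
have e0 : (0 <= e)%R by rewrite subr_ge0 lef_pV2.
pose v t : R := (w t * B t `^ e)%R.
have v0 t : (0 <= v t)%R by rewrite mulr_ge0 ?powR_ge0.
have mv : measurable_fun setT v.
  by apply: measurable_funM => //; exact: measurableT_comp (measurable_powR _) mB.
have mjx x : measurable_fun setT (j ^~ x).
  exact: (measurableT_comp mj (pair1_measurable x)).
pose V x := \int[nu]_t (v t * j t x)%:E.
have V0 x : 0 <= V x by apply: integral_ge0 => t _; rewrite lee_fin mulr_ge0.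
have U0 x : 0 <= subordinated x.
  rewrite subordinatedE; apply: integral_ge0 => t _.
  by rewrite mule_ge0 ?lee_fin ?average_ge0.
have UV x : subordinated x <= (M `^ e)%:E * (V x `^ p^-1 * (W `^ (1 - p^-1))%:E).
  apply: (@le_trans _ _ ((M `^ e)%:E * \int[nu]_t (v t * j t x `^ p^-1)%:E)).
    rewrite -ge0_integralZl//; last first.
    - by rewrite lee_fin powR_ge0.
    - by move=> t _; rewrite lee_fin mulr_ge0 ?powR_ge0.
    - apply/measurable_EFinP; apply: measurable_funM => //.
      exact: measurableT_comp (measurable_powR _) (mjx x).
    apply: le_trans (subordinated_le_j x) _; apply: le_integral_ge0 => t.
      by rewrite lee_fin mulr_ge0 ?powR_ge0.
    rewrite -EFinM lee_fin mulrCA /v -mulrA ler_wpM2l//.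
    have -> : (q^-1 = p^-1 + e)%R by rewrite /e addrC subrK.
    rewrite powRD; last by rewrite /e addrC subrK invr_eq0 (gt_eqF q0).
    rewrite [leRHS]mulrA [leRHS]mulrC -powRM// ler_wpM2l ?powR_ge0//.
    by apply: ge0_ler_powR; rewrite ?nnegrE ?mulr_ge0.
  rewrite lee_wpmul2l ?lee_fin ?powR_ge0//.
  apply: le_trans (@jensen_powR _ _ _ _ p v (fun t => j t x `^ p^-1)%R _ _ _ _ _) _ => //.
  - by move=> t; exact: powR_ge0.
  - exact: measurableT_comp (measurable_powR _) (mjx x).
  rewrite vW poweR_EFin le_eqVlt; apply/orP; left; apply/eqP.
  congr (_ `^ _ * _); apply: eq_integral => t _.
  by rewrite -powRrM mulVf// powRr1.
pose c : R := (M `^ (p * e) * W `^ (p - 1))%R.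
have c0 : (0 <= c)%R by rewrite mulr_ge0 ?powR_ge0.
(* The constants are kept apart from V x, which may be infinite. *)
have UVp x : subordinated x `^ p <= c%:E * V x.
  apply: le_trans (gt0_ler_poweR (ltW p0) _ _ (UV x)) _.
  - by rewrite in_itv/= leey U0.
  - by rewrite in_itv/= leey !mule_ge0 ?lee_fin ?powR_ge0 ?poweR_ge0.
  rewrite !poweRM ?mule_ge0 ?lee_fin ?powR_ge0 ?poweR_ge0//.
  rewrite -poweRrM mulVf// poweRe1// !poweR_EFin -!powRrM.
  have -> : ((1 - p^-1) * p = p - 1)%R by rewrite mulrBl mul1r mulVf.
  by rewrite muleCA -EFinM /c [(e * p)%R]mulrC muleC.
have IV : \int[mu]_x V x = (W * M)%:E.
  rewrite (fubini_tonelli (fun z : X * T => (v z.2 * j z.2 z.1)%:E)); last 2 first.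
  - apply/measurable_EFinP; apply: measurable_funM; last exact: mj.
    exact: measurableT_comp mv _.
  - by move=> z; rewrite lee_fin mulr_ge0.
  have IJ t : \int[mu]_x (j t x)%:E = M%:E.
    under eq_integral do rewrite -averageE.
    rewrite (fubini_tonelli (fun z : X * X => (k t z.1 z.2 * fq z.2)%:E)); last 2 first.
    - apply/measurable_EFinP; apply: measurable_funM; first exact: mkcomp.
      exact: measurableT_comp mfq _.
    - by move=> z; rewrite lee_fin mulr_ge0.
    rewrite -fM; apply: eq_integral => y _.
    under eq_integral do rewrite /= EFinM.
    rewrite ge0_integralZr// ?k2 ?mul1e ?lee_fin//.
    + by apply/measurable_EFinP; exact: mkcomp.
    + by move=> x _; rewrite lee_fin.
  rewrite EFinM -vW -ge0_integralZr//.
  - apply: eq_integral => t _; rewrite -(IJ t) -ge0_integralZl//.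
    + apply/measurable_EFinP; exact: (measurableT_comp mj (pair2_measurable t)).
    + by move=> x _; rewrite lee_fin.
    + by rewrite lee_fin; exact: v0.
  - exact/measurable_EFinP.
  - by move=> t _; rewrite lee_fin; exact: v0.
have IU : \int[mu]_x subordinated x `^ p <= ((W * M `^ q^-1) `^ p)%:E.
  apply: (@le_trans _ _ (\int[mu]_x (c%:E * V x))).
    by apply: le_integral_ge0 => x; rewrite ?poweR_ge0.
  rewrite ge0_integralZl ?lee_fin//; last first.
    apply: (@measurable_fun_fubini_tonelli_F _ _ _ _ _ nu (fun z : X * T => (v z.2 * j z.2 z.1)%:E)).
      apply/measurable_EFinP; apply: measurable_funM; last exact: mj.
      exact: measurableT_comp mv _.
    by move=> z; rewrite lee_fin mulr_ge0.
  rewrite IV -EFinM lee_fin /c.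
  have -> : (M `^ (p * e) * W `^ (p - 1) * (W * M) =
      (W `^ (p - 1) * W) * (M `^ (p * e) * M))%R by ring.
  have E a (x : R) : (0 <= x)%R -> (a + 1 != 0)%R -> (x `^ a * x = x `^ (a + 1))%R.
    move=> x0 a1; rewrite powRD; last by rewrite (negbTE a1).
    by rewrite powRr1.
  have pe : (p * e + 1 = p / q)%R by rewrite /e mulrBr divff// subrK.
  rewrite !E ?subrK ?pe ?mulf_neq0 ?invr_neq0 ?(gt_eqF q0)//.
  by rewrite powRM ?powR_ge0// -powRrM [(q^-1 * p)%R]mulrC.
apply: le_trans (gt0_ler_poweR _ _ _ IU) _.
- by rewrite invr_ge0 ltW.
- by rewrite in_itv/= leey integral_ge0// => x _; rewrite poweR_ge0.
- by rewrite in_itv/= leey lee_fin powR_ge0.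
by rewrite poweR_EFin -powRrM divff// powRr1// mulr_ge0 ?powR_ge0.
Qed.

End powers.
End subordination.

(** * Negative moments of the random time *)

Section subordinator_moment.
Context (R : realType) (alpha h : R).
Hypotheses (alpha01 : 0 < alpha < 1) (h0 : 0 < h).
Local Notation HL := (`]0%R, +oo[%classic : set R).

(** Each term is a Gamma integral, and [weight_newton] sums the Cesaro numbers
that [gint_shift] produces. *)
Lemma integral_subord_powR m gam : gam < 1 ->
  (\int[lebesgue_measure]_(t in HL) (subord alpha h m t * t `^ (- gam))%:E =
   gint (- gam) 1 * (rate alpha h `^ gam * cesaro (1 - alpha * gam) m)%:E)%E.
Proof.
move=> gam1; have r0 := rate_gt0 alpha h0; set lam := rate alpha h in r0 *.
have ln0 : lam != 0 by exact: lt0r_neq0.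
have gam1' : - 1 < - gam by rewrite ltrN2.
pose a (l : 'I_m.+1) := lam ^+ l.+1 / l`!%:R * weight alpha m l.
have a0 l : 0 <= a l.
  by rewrite mulr_ge0 ?weight_ge0// divr_ge0// exprn_ge0// ltW.
transitivity (\int[lebesgue_measure]_(t in HL)
    \sum_(l < m.+1) (a l * (t `^ (l%:R - gam) * expR (- (lam * t))))%:E)%E.
  apply: eq_integral => t; rewrite inE/= in_itv/= andbT => t0.
  rewrite sumEFin; congr EFin; rewrite /subord -/lam mulr_sumr mulr_suml.
  apply: eq_bigr => l _; rewrite powRD ?(gt_eqF t0) ?implybT// powR_mulrn ?(ltW t0)//.
  by rewrite /a exprMn exprS; ring.
rewrite ge0_integral_sum//; last 2 first.
- move=> l; apply/measurable_EFinP; apply: measurable_funM => //.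
  apply: measurable_funM; first exact: measurable_funTS (measurable_powR _).
  apply: measurableT_comp => //; apply: measurable_funN; exact: measurable_funM.
- by move=> l t _; rewrite lee_fin mulr_ge0// mulr_ge0 ?powR_ge0 ?expR_ge0.
have gfin : (gint (- gam) 1 : \bar R) \is a fin_num.
  by rewrite ge0_fin_numE ?gint_ge0// gint_lty.
transitivity (\sum_(l < m.+1) (gint (- gam) 1 *
     (lam `^ gam * (weight alpha m l * cesaro (1 - gam) l))%:E))%E.
  apply: eq_bigr => l _; rewrite -gintZl ?a0//.
  rewrite gint_shift// gint_scale// -(fineK gfin) -!EFinM; congr EFin.
  have -> : - (- gam + 1) = gam + (- 1) by rewrite opprD opprK.
  rewrite powRD ?ln0 ?implybT// powR_inv1 ?(ltW r0)// /a exprS.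
  have f0 : (l`!%:R : R) != 0 by rewrite pnatr_eq0 -lt0n fact_gt0.
  have p0 : lam ^+ l != 0 by rewrite expf_neq0.
  move: (l`!%:R) (lam ^+ l) (weight _ _ _) (fine _) (cesaro _ _) (powR _ _) f0 p0 => x y u v z s f0 p0.
  by field; rewrite f0 ln0 p0.
under eq_bigr do rewrite -(fineK gfin) -EFinM.
rewrite sumEFin -(fineK gfin) -EFinM; congr EFin; rewrite /=.
rewrite -!mulr_sumr weight_newton; congr (_ * (_ * cesaro _ _)).
by ring.
Qed.

Lemma integral_subord_powR_le m gam : 0 <= gam < 1 ->
  (\int[lebesgue_measure]_(t in HL) (subord alpha h m t * t `^ (- gam))%:E <=
   (fine (gint (- gam) 1 : \bar R) / (m.+1%:R * h) `^ (alpha * gam))%:E)%E.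
Proof.
case/andP: alpha01 => a0 a1 /andP[g0 g1].
rewrite integral_subord_powR//.
have gfin : (gint (- gam) 1 : \bar R) \is a fin_num.
  by rewrite ge0_fin_numE ?gint_ge0// gint_lty// ltrN2.
rewrite -[X in (X * _)%E](fineK gfin) -EFinM lee_fin ler_wpM2l ?fine_ge0 ?gint_ge0//.
rewrite powRM// ?(ltW h0)// invfM mulrC /rate -powRrM mulNr -powRN.
rewrite -[X in _ <= _ * X]powRN ler_wpM2r ?powR_ge0// cesaro_le_powR//.
by rewrite mulr_ge0 ?(ltW a0)//= mulr_ilt1 ?(ltW a0).
Qed.
End subordinator_moment.

(** * The decay estimate *)

Lemma lebesgue_rV_set1 (R : realType) N (x : 'rV[R]_N) : (0 < N)%N ->
  measurable [set x] /\ lebesgue_rV R N [set x] = 0%E.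
Proof.
move=> N0.
have E : [set x] = [set y : 'rV[R]_N | forall i, [set x ord0 i] (y ord0 i)].
  apply/seteqP; split => [_ -> //|y xy] /=.
  by apply/rowP => i; rewrite xy.
rewrite E; split.
  rewrite [X in measurable X](_ : _ =
      \bigcap_(i in [set: 'I_N]) (rV_coor i @^-1` [set x ord0 i])).
    apply: fin_bigcap_measurable => [|i _]; first exact: finite_finset.
    rewrite -[X in measurable X]setTI; exact: measurable_rV_coor.
  by apply/seteqP; split => [y xy i _|y xy i]; [exact: xy|exact: (xy i)].
rewrite (@lebesgue_rV_box R N (fun i => [set x ord0 i])); last by move=> i; exact: measurable_set1.
by case: N N0 x {E} => // n _ x; rewrite big_ord_recl lebesgue_measure_set1 mul0e.
Qed.

Section solution_bound.
Context (R : realType) (N : nat) (alpha h r : R).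
Hypotheses (N0 : (0 < N)%N) (alpha01 : 0 < alpha < 1) (h0 : 0 < h) (r01 : 0 < r < 1).
Local Notation HL := (`]0%R, +oo[%classic : set R).
Local Notation nu := (@lebesgue_measure R).
Local Notation mu := (lebesgue_rV R N).
Variable m : nat.

(* Times t <= 0 have density 0; replacing them by 1 makes every kernel a
   probability density, so that the integrals can run over the whole line. *)
Let pos (t : R) : R := if 0 < t then t else 1.

Let pos_gt0 t : 0 < pos t.
Proof. by rewrite /pos; case: ifP. Qed.

Let psi (t : R) : R := if 0 < t then subord alpha h m t else 0.

Let psi_ge0 t : 0 <= psi t.
Proof. by rewrite /psi; case: ifP => // t0; exact: subord_ge0 (ltW t0). Qed.

Let heat t (x y : 'rV[R]_N) : R := gaussian (pos t) (x - y).

Let peak t : R := (4 * pi * pos t) `^ (- (N%:R / 2)).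

Let peak_ge0 t : 0 <= peak t.
Proof. exact: powR_ge0. Qed.

Let mpos : measurable_fun setT pos.
Proof. by apply: measurable_fun_ifT => //; exact: measurable_fun_ltr. Qed.

Let mpsi : measurable_fun setT psi.
Proof.
apply: measurable_fun_ifT => //; first exact: measurable_fun_ltr.
exact: measurable_subord.
Qed.

Let mpeak : measurable_fun setT peak.
Proof.
apply: (measurableT_comp (measurable_powR _)); exact: measurable_funM.
Qed.

Let heat_ge0 t x y : 0 <= heat t x y.
Proof. exact: gaussian_ge0. Qed.

Let heat_le t x y : heat t x y <= peak t.
Proof.
rewrite /heat gaussianE ler_piMr ?powR_ge0// -expR0 ler_expR mulNr oppr_le0.
by rewrite divr_ge0 ?sqnorm_ge0// mulr_ge0// ltW.
Qed.

Let mheat : measurable_fun setT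
  (fun z : measurableTypeR R * ('rV[R]_N * 'rV[R]_N) => heat z.1 z.2.1 z.2.2).
Proof.
apply: measurable_gaussian => [|i].
  exact: measurableT_comp mpos _.
under eq_fun do rewrite !mxE.
by apply: measurable_funB; apply: (measurableT_comp (@measurable_rV_coor R N i));
  apply: measurableT_comp.
Qed.

Let heat1 t x : (\int[mu]_y (heat t x y)%:E = 1)%E.
Proof. exact: integral_gaussian. Qed.

Let heat2 t y : (\int[mu]_x (heat t x y)%:E = 1)%E.
Proof. by under eq_integral do rewrite /heat gaussian_sym; exact: integral_gaussian. Qed.

Let integral_psi (g g' : R -> R) : (forall t, 0 < t -> g t = g' t) ->
  (\int[nu]_t (psi t * g t)%:E =
   \int[nu]_(t in HL) (subord alpha h m t * g' t)%:E)%E.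
Proof.
move=> gg'; rewrite [RHS]integral_mkcond; apply: eq_integral => t _.
rewrite patchE; have [t0|t0] := boolP (0 < t).
  by rewrite mem_set /psi/= ?in_itv/= ?andbT// t0 gg'.
rewrite memNset /psi/= ?in_itv/= ?andbT ?(negbTE t0) ?mul0r//.
Qed.

Variables (f : 'rV[R]_N -> R) (mf : measurable_fun setT f).

Lemma convolution_le x :
  (`|convolution (fundamental_solution alpha h r m.+1) f x|%:E <=
   subordinated nu mu psi heat f x)%E.
Proof.
apply: le_trans (abs_Rintegral_le _ _) _.
have [mx x0] := lebesgue_rV_set1 x N0.
apply: (le_integral_ae mx x0) => y.
- by rewrite lee_fin.
- by rewrite mule_ge0// ?integral_ge0// => t _; rewrite lee_fin mulr_ge0// gaussian_ge0.
- move=> yx; rewrite normrM EFinM lee_wpmul2r//.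
  rewrite (@integral_psi _ (fun t => gaussian t (x - y))); last first.
    by move=> t t0; rewrite /heat /pos t0.
  apply: fundamental_solution_le => //; rewrite lt_neqAle sqnorm_ge0 andbT eq_sym.
  apply/eqP => s0; apply: yx; apply/esym/eqP; rewrite -subr_eq0; apply/eqP/rowP => i.
  have /(_ i isT)/eqP := psumr_eq0P (fun j _ => sqr_ge0 ((x - y) ord0 j)) s0.
  by rewrite sqrf_eq0 => /eqP ->; rewrite mxE.
Qed.

(* The time integral of (4 pi t)^(-gam), for gam = (N/2) e. *)
Let W e := (\int[nu]_t (psi t * peak t `^ e)%:E)%E.

Let W_le e : 0 <= N%:R / 2 * e < 1 ->
  (W e <= ((4 * pi) `^ (- (N%:R / 2 * e)) * fine (gint (- (N%:R / 2 * e)) 1 : \bar R) /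
     (m.+1%:R * h) `^ (alpha * (N%:R / 2 * e)))%:E)%E.
Proof.
set gam := _ / 2 * e => /[dup] gam01 /andP[gam0 gam1].
have p4 : 0 <= 4 * pi :> R by rewrite mulr_ge0// pi_ge0.
rewrite /W (@integral_psi _ (fun t => (4 * pi) `^ (- gam) * t `^ (- gam))); last first.
  move=> t t0; rewrite /peak /pos t0 -powRrM mulNr -/gam powRM//.
  by rewrite ltW.
rewrite (_ : (fun t => _) = (fun t => ((4 * pi) `^ (- gam))%:E *
    (subord alpha h m t * t `^ (- gam))%:E)%E); last first.
  by apply/funext => t; rewrite -EFinM mulrCA.
rewrite ge0_integralZl_EFin//; last 3 first.
- move=> t; rewrite /= in_itv/= andbT => t0.
  by rewrite lee_fin mulr_ge0 ?powR_ge0// subord_ge0// ltW.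
- apply/measurable_EFinP; apply: measurable_funM; first exact: measurable_subord.
  exact: measurable_funTS (measurable_powR _).
- exact: powR_ge0.
by rewrite -mulrA EFinM lee_wpmul2l ?lee_fin ?powR_ge0// integral_subord_powR_le.
Qed.

Let W_ge0 e : (0 <= W e)%E.
Proof. by apply: integral_ge0 => t _; rewrite lee_fin mulr_ge0// powR_ge0. Qed.

Let u := convolution (fundamental_solution alpha h r m.+1) f.

Local Open Scope ereal_scope.

Lemma Lnorm_convolution_pinfty : 'N[mu]_+oo[EFin \o u] <= 'N[mu]_+oo[EFin \o f].
Proof.
have := Lnorm_ge0 mu +oo (EFin \o f).
have : \forall y \ae mu, `|f y|%:E <= ess_sup mu (abse \o (EFin \o f)).
  exact: (ess_sup_ge mu (abse \o (EFin \o f))).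
rewrite unlock; case: ifPn => // mu0.
case: (ess_sup _ _) => [L||]; last 2 first.
- by move=> _ _; rewrite leey.
- by [].
move=> fL L0; apply/ess_supP; apply: nearW => x /=.
apply: le_trans (convolution_le x) _.
apply: le_trans (subordinated_le_ess_sup nu psi_ge0 heat_ge0 mpsi mheat mf heat1 x L0 fL) _.
rewrite -[leRHS]mul1e lee_wpmul2r//.
have := @W_le 0; rewrite mulr0 lexx ltr01 => /(_ isT).
rewrite oppr0 mulr0 !powRr0 mul1r divr1 gint0// /= invr1; apply: le_trans.
rewrite le_eqVlt; apply/orP; left; apply/eqP; apply: eq_integral => t _.
by rewrite powRr0 mulr1.
Qed.

Lemma Lnorm_convolution_le (q p : \bar R) : 1 <= q -> q < +oo -> q <= p ->
  f \in Lfun mu q ->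
  forall gam, gam = (N%:R / 2 * (recip q - recip p))%R -> (gam < 1)%R ->
  'N[mu]_p[EFin \o u] <=
  ((4 * pi) `^ (- gam) * fine (gint (- gam) 1 : \bar R) /
     (m.+1%:R * h) `^ (alpha * gam))%:E * 'N[mu]_q[EFin \o f].
Proof.
case: q => [q||]// q1 _ qp fq gam -> gam1.
rewrite lee_fin in q1; have q0 : (0 < q)%R by exact: lt_le_trans q1.
have [M M0 fM] : exists2 M : R, (0 <= M)%R & \int[mu]_y (`|f y| `^ q)%:E = M%:E.
  have I0 : 0 <= \int[mu]_y (`|f y| `^ q)%:E.
    by apply: integral_ge0 => y _; rewrite lee_fin powR_ge0.
  have Ioo : \int[mu]_y (`|f y| `^ q)%:E < +oo.
    have := set_mem (sub_Lfun_finLfun fq); rewrite /finite_norm /= unlock.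
    by apply: lty_poweRy; rewrite invr_eq0 gt_eqF.
  exists (fine (\int[mu]_y (`|f y| `^ q)%:E)); first exact: fine_ge0.
  by rewrite fineK// ge0_fin_numE.
have Nq : 'N[mu]_q%:E[EFin \o f] = (M `^ q^-1)%:E.
  by rewrite unlock -poweR_EFin -fM.
have e0 : (0 <= recip q%:E - recip p)%R.
  rewrite subr_ge0 /recip /=; case: p qp {gam1} => [p||]//= qp; last by rewrite invr0 invr_ge0 ltW.
  by rewrite lee_fin in qp; rewrite lef_pV2// posrE (lt_le_trans q0).
set e := (recip _ - _)%R in gam1 e0 *.
have := @W_le e; rewrite gam1 mulr_ge0// => /(_ isT).
set C := (X in _ <= X%:E) => WC.
have C0 : (0 <= C)%R by rewrite -lee_fin (le_trans (W_ge0 e)).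
have [V V0 WV] : exists2 V : R, (0 <= V)%R & W e = V%:E.
  exists (fine (W e)); first exact: fine_ge0.
  by rewrite fineK// ge0_fin_numE// (le_lt_trans WC)// ltry.
apply: (@le_trans _ _ (W e * (M `^ q^-1)%:E)); last first.
  by rewrite Nq lee_wpmul2r// lee_fin powR_ge0.
case: p @e e0 gam1 qp C WC C0 WV => [p||]// e e0 gam1 qp C WC C0 WV; last first.
  rewrite (_ : 'N[mu]_+oo[EFin \o u] =
      if 0 < mu setT then ess_sup mu (abse \o (EFin \o u)) else 0); last by rewrite unlock.
  case: ifPn => _; last first.
    by rewrite mule_ge0// lee_fin powR_ge0.
  apply/ess_supP; apply: nearW => x /=; apply: le_trans (convolution_le x) _.
  have -> : e = q^-1%R by rewrite /e /recip /= invr0 subr0.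
  exact: (subordinated_le_pinfty nu psi_ge0 peak_ge0 heat_ge0 heat_le mpsi mpeak mheat mf heat1 q1 M0 fM).
rewrite lee_fin in qp; have p0 : (0 < p)%R by exact: lt_le_trans qp.
rewrite WV -EFinM.
have := subordinated_le_finite (nu := nu) psi_ge0 peak_ge0 heat_ge0 heat_le mpsi mpeak mheat
  mf heat1 heat2 q1 M0 fM qp V0 WV.
apply: le_trans.
rewrite unlock; apply: gt0_ler_poweR.
- by rewrite invr_ge0 ltW.
- by rewrite in_itv/= leey integral_ge0// => x _; rewrite poweR_ge0.
- by rewrite in_itv/= leey integral_ge0// => x _; rewrite poweR_ge0.
apply: le_integral_ge0 => x; first exact: poweR_ge0.
apply: gt0_ler_poweR; [exact: ltW| | |exact: convolution_le].
- by rewrite in_itv/= leey lee_fin normr_ge0.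
- by rewrite in_itv/= leey (le_trans _ (convolution_le x)).
Qed.
End solution_bound.

Local Open Scope ereal_scope.

(** The condition on the exponent is the integrability at t = 0 of the time factor
t^(-gam). *)
Lemma decay_estimate_lt1 (R : realType) (N : nat) (alpha : R) (q p : \bar R) :
  (0 < N)%N -> (0 < alpha < 1)%R -> 1 <= q -> q < +oo -> q <= p ->
  (N%:R / 2 * (recip q - recip p) < 1)%R -> decay_estimate N alpha q p.
Proof.
move=> N0 alpha01 q1 qoo qp; set gam := (_ * _)%R => gam1.
exists ((4 * pi) `^ (- gam) * fine (gint (- gam) 1 : \bar R))%R.
move=> h r f u h0 r01 fq [_ uE] [//|m] _.
have -> : (alpha * N%:R / 2 * (recip q - recip p) = alpha * gam)%R.
  by rewrite /gam !mulrA.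
rewrite uE//; apply: (Lnorm_convolution_le N0 alpha01 h0 r01 _ _ q1 qoo qp fq) => //.
exact: set_mem (sub_Lfun_mfun fq).
Qed.

Theorem theorem6p2 (R : realType) (N : nat) (alpha : R) (q p : \bar R)
    (hN : (0 < N)%N) (halpha : (0 < alpha < 1)%R)
    (hq : 1 <= q) (hqp : q <= p) :
  [/\ q = +oo ->
      forall (h r : R) (f : 'rV[R]_N -> R) (u : nat -> 'rV[R]_N -> R),
        (0 < h)%R -> (0 < r < 1)%R ->
        f \in Lfun (lebesgue_rV R N) q ->
        diffusion_solution alpha h r f u ->
        forall n, (0 < n)%N ->
        'N[lebesgue_rV R N]_+oo[EFin \o u n] <=
        'N[lebesgue_rV R N]_+oo[EFin \o f],
      q < +oo -> 2%:E * q < N%:R%:E ->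
        p < ((N%:R * fine q) / (N%:R - 2 * fine q))%R%:E ->
        decay_estimate N alpha q p,
      q < +oo -> N%:R%:E = 2%:E * q -> p < +oo ->
        decay_estimate N alpha q p &
      q < +oo -> N%:R%:E < 2%:E * q ->
        decay_estimate N alpha q p].
Proof.
have [->|qoo] := eqVneq q +oo.
  split => // _ h r f u h0 r01 fq [_ uE] [//|m] _.
  rewrite uE//; apply: Lnorm_convolution_pinfty => //.
  exact: set_mem (sub_Lfun_mfun fq).
case: q hq hqp qoo => [q||]// q1 qp _; rewrite lee_fin in q1.
have q0 : (0 < q)%R by exact: lt_le_trans q1.
have n0 : (0 < N%:R :> R)%R by rewrite ltr0n.
have dec := @decay_estimate_lt1 R N alpha q%:E p hN halpha q1 (ltry q) qp.
split => // _; rewrite -?EFinM ?lte_fin.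
- case: p qp dec => [p||]// qp dec Nq; rewrite lte_fin /= => pN; apply: dec.
  rewrite lee_fin in qp; have p0 : (0 < p)%R by exact: lt_le_trans qp.
  rewrite /recip /=; move: pN; rewrite ltr_pdivlMr ?subr_gt0// => pN.
  have -> : (N%:R / 2 * (q^-1 - p^-1) = (N%:R * (p - q)) / (2 * p * q))%R.
    by field; rewrite !gt_eqF.
  rewrite ltr_pdivrMr ?mulr_gt0// mul1r -subr_gt0.
  by move: pN; rewrite -subr_gt0; congr (is_true (0 < _)%R); ring.
- move=> [Nq]; case: p qp dec => [p||]// qp dec _; apply: dec.
  rewrite lee_fin in qp; have p0 : (0 < p)%R by exact: lt_le_trans qp.
  have -> : (N%:R / 2 * (recip q%:E - recip p%:E) = 1 - q / p)%R.
    by rewrite /recip /= Nq; field; rewrite !gt_eqF.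
  by rewrite gtrBl divr_gt0.
- move=> Nq; apply: dec; apply: (@le_lt_trans _ _ (N%:R / 2 * q^-1)%R).
    rewrite ler_wpM2l ?divr_ge0 ?(ltW n0)// /recip /= gerBl invr_ge0.
    by case: p qp => [p||]//=; rewrite lee_fin; apply: le_trans; exact: ltW.
  by rewrite ltr_pdivrMr// mul1r ltr_pdivrMr// mulrC.
Qed.
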